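(* Let $X$ be a Banach space with a Schauder basis. If $X$ admits $c_0$ as a spreading model generated by a weakly relatively compact $\mathcal{F}$-subsequence (for some regular thin family $\mathcal{F}$), then $X$ also admits $c_0$ as a plegma block generated spreading model.
   Context: $\mathbb{N}=\{1,2,\dots\}$. For $M\subseteq\mathbb{N}$ infinite, $M(k)$ is its $k$-th element; for a finite set $s$, $s(k)$ is its $k$-th element; $t\sqsubseteq s$ means initial segment. For a family $\mathcal{F}$ of finite subsets of $\mathbb{N}$ let $\widehat{\mathcal{F}}=\{t:\exists s\in\mathcal{F},\ t\sqsubseteq s\}$ and $\mathcal{F}\upharpoonright M=\{s\in\mathcal{F}:s\subseteq M\}$. $\mathcal{F}$ is thin if no element is a proper initial segment of another. A family is regular if it is hereditary (closed under subsets), spreading (if $\{n_1<\dots<n_k\}$ is in it, $m_1<\dots<m_k$, $n_i\le m_i$ for all $i$, then $\{m_1,\dots,m_k\}$ is in it) and compact (its characteristic functions form a closed subset of $\{0,1\}^{\mathbb{N}}$). $\mathcal{F}$ is regular thin if it is thin and $\widehat{\mathcal{F}}$ is regular; regular thin families are assumed to contain a nonempty set. A tuple $(s_1,\dots,s_l)$ of nonempty finite subsets of $\mathbb{N}$ is plegma if $s_i(k)<s_j(k)$ whenever $i<j$ and $k\le\min(|s_i|,|s_j|)$, and $s_i(k)<s_j(k+1)$ for all $i,j$ and $k\le\min(|s_i|,|s_j|-1)$. An $\mathcal{F}$-subsequence $(x_s)_{s\in\mathcal{F}\upharpoonright M}$ in $X$ ($M\subseteq\mathbb{N}$ infinite)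 is a map $s\mapsto x_s$ from $\mathcal{F}\upharpoonright M$ to $X$; it is weakly relatively compact if the weak closure of $\{x_s:s\in\mathcal{F}\upharpoonright M\}$ is weakly compact. Let $(e_n)_n$ be a Hamel basis of an infinite-dimensional seminormed space with seminorm $\|\cdot\|_*$. $(x_s)_{s\in\mathcal{F}\upharpoonright M}$ generates $(e_n)_n$ as an $\mathcal{F}$-spreading model if there is a null sequence $(\delta_n)_n$ of positive reals such that $\big|\,\|\sum_{j=1}^k a_jx_{s_j}\|-\|\sum_{j=1}^k a_je_j\|_*\big|\le\delta_l$ for all $1\le k\le l$, all plegma $k$-tuples $(s_j)_{j=1}^k$ in $\mathcal{F}\upharpoonright M$ with $s_1(1)\ge M(l)$ and all $a_1,\dots,a_k\in[-1,1]$. It generates $c_0$ as a spreading model if it generates some $(e_n)_n$ equivalent to the usual basis of $c_0$. $(x_s)_{s\in\mathcal{F}\upharpoonright M}$ is plegma block if all $x_s$ are finitely supported (with respect to the Schauder basis) and $\mathrm{supp}(x_{s_1})<\mathrm{supp}(x_{s_2})$ (i.e. $\max<\min$) for every plegma pair $(s_1,s_2)$ in $\mathcal{F}\upharpoonright M$. $X$ admits $c_0$ as a plegma block generated spreading model if for some regular thin $\mathcal{F}$ there is a plegma block $\mathcal{F}$-subsequence in $X$ generating $c_0$ as an $\mathcal{F}$-spreading model. *)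

(* Defs.v *)
From HB Require Import structures.
From mathcomp Require Import all_boot all_order all_algebra.
From mathcomp Require Import finmap.
From mathcomp Require Import all_classical all_reals all_analysis.
Import Order.TTheory GRing.Theory Num.Theory.
Import numFieldNormedType.Exports.

Set Implicit Arguments.
Unset Strict Implicit.
Unset Printing Implicit Defensive.

Local Open Scope classical_set_scope.
Local Open Scope ring_scope.

(* The natural numbers of the theory are {1, 2, ...}: families of finite sets
   and infinite index sets live in [nat] but are required to avoid 0 (see
   [regular_thin] and [infinite_subset]).  Positions of elements in finite and
   infinite sets are counted from 1. *)

Section FiniteSets.
Implicit Types (s t : {fset nat}) (F : set {fset nat}) (M : set nat).

Definition elts s : seq nat := sort leq s.

(* s(k), for 1 <= k <= #|` s| *)
Definition elt s (k : nat) : nat := nth 0%N (elts s) k.-1.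

(* M(k), for k >= 1: the m in M such that exactly k elements of M are <= m *)
Definition inf_elt M (k : nat) : nat :=
  xget 0%N [set m | M m /\ count (fun i => `[< M i >]) (iota 0 m.+1) = k].

Definition infinite_subset M : Prop := infinite_set M /\ ~ M 0%N.

Definition initial_segment t s : bool := prefix (elts t) (elts s).

Definition hat F : set {fset nat} :=
  [set t | exists2 s, F s & initial_segment t s].

Definition restrict_family F M : set {fset nat} :=
  [set s | F s /\ [set` s] `<=` M].

Definition thin F : Prop :=
  forall s t, F s -> F t -> initial_segment s t -> s = t.

Definition hereditary F : Prop :=
  forall s t, F s -> (t `<=` s)%fset -> F t.

Definition spreading F : Prop :=
  forall s t, F s -> #|` t| = #|` s| ->
    (forall k, (1 <= k <= #|` s|)%N -> (elt s k <= elt t k)%N) -> F t.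

Definition char_fun s : cantor_space := fun n : nat => n \in s.

Definition compact_family F : Prop := closed (char_fun @` F).

Definition regular F : Prop :=
  [/\ hereditary F, spreading F & compact_family F].

Definition regular_thin F : Prop :=
  [/\ forall s, F s -> 0%N \notin s,
      thin F,
      regular (hat F) &
      exists2 s, F s & s != fset0].

Definition plegma (t : seq {fset nat}) : Prop :=
  [/\ forall s, s \in t -> s != fset0,
      forall i j k, (i < j < size t)%N ->
        (1 <= k <= minn #|` nth fset0 t i| #|` nth fset0 t j|)%N ->
        (elt (nth fset0 t i) k < elt (nth fset0 t j) k)%N &
      forall i j k, (i < size t)%N -> (j < size t)%N ->
        (1 <= k <= minn #|` nth fset0 t i| (#|` nth fset0 t j| - 1))%N ->
        (elt (nth fset0 t i) k < elt (nth fset0 t j) k.+1)%N].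

End FiniteSets.

Section WeakTopology.
Context {R : realType}.

Definition dual (X : normedModType R) : Type :=
  {f : {scalar X} | continuous (f : X -> R)}.

Definition weak_space (X : normedModType R) : Type :=
  sup_topology (fun f : dual X =>
    Topological.class (initial_topology (sval f : X -> R))).

HB.instance Definition _ (X : normedModType R) :=
  Topological.copy (weak_space X) (sup_topology (fun f : dual X =>
    Topological.class (initial_topology (sval f : X -> R)))).

Definition weakly_relatively_compact (X : normedModType R) (A : set X) : Prop :=
  compact (closure (A : set (weak_space X))).

End WeakTopology.

Section SchauderBasis.
Context {R : realType} {X : normedModType R}.
Implicit Types (b : nat -> X) (x : X).

Definition expansion b x (a : nat -> R) : Prop :=
  series (fun n => a n *: b n) @ \oo --> x.

Definition schauder_basis b : Prop :=
  forall x, exists! a : nat -> R, expansion b x a.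

(* The default value is irrelevant when b is a Schauder basis. *)
Definition coord b x : nat -> R := xget (fun=> 0) (expansion b x).

Definition supp b x : set nat := [set n | coord b x n != 0].

Definition finitely_supported b x : Prop := finite_set (supp b x).

(* max (supp x) < min (supp y); vacuous if x or y is 0 *)
Definition block_lt b x y : Prop :=
  forall i j, supp b x i -> supp b y j -> (i < j)%N.

End SchauderBasis.

Section SpreadingModels.
Context {R : realType}.

Definition seminorm {V : lmodType R} (N : V -> R) : Prop :=
  [/\ forall v, 0 <= N v,
      forall v w, N (v + w) <= N v + N w &
      forall c v, N (c *: v) = `|c| * N v].

(* A Hamel basis indexed by [nat]; the space is then infinite-dimensional. *)
Definition hamel_basis {V : lmodType R} (e : nat -> V) : Prop :=
  (forall n (a : 'I_n -> R), \sum_(i < n) a i *: e i = 0 ->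
     forall i, a i = 0) /\
  (forall v, exists n (a : 'I_n -> R), v = \sum_(i < n) a i *: e i).

Definition equivalent {V W : lmodType R} (N : V -> R) (e : nat -> V)
    (P : W -> R) (f : nat -> W) : Prop :=
  exists c C : R, [/\ 0 < c, 0 < C &
    forall n (a : 'I_n -> R),
      c * P (\sum_(i < n) a i *: f i) <= N (\sum_(i < n) a i *: e i) <=
      C * P (\sum_(i < n) a i *: f i)].

(* [sup] is only meaningful on bounded sets: here it is applied to finitely
   supported sequences only. *)
Definition c0_norm (u : nat -> R^o) : R := sup [set `|u n| | n in setT].

Definition c0_basis (n : nat) : nat -> R^o := fun i => (i == n)%:R.

Context {X : normedModType R}.
Implicit Types (F : set {fset nat}) (M : set nat) (x : {fset nat} -> X).

(* Only the values of x on the restriction of F to M are relevant. *)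
Definition generates F M x (V : lmodType R) (N : V -> R) (e : nat -> V) : Prop :=
  exists delta : nat -> R, [/\ forall n, 0 < delta n, delta @ \oo --> 0 &
    forall (k l : nat) (s : k.-tuple {fset nat}) (a : 'I_k -> R),
      (1 <= k <= l)%N ->
      plegma s ->
      (forall j, restrict_family F M (tnth s j)) ->
      (inf_elt M l <= elt (nth fset0 s 0) 1)%N ->
      (forall j, -1 <= a j <= 1) ->
      `| `|\sum_(j < k) a j *: x (tnth s j)| - N (\sum_(j < k) a j *: e j) |
        <= delta l].

Definition generates_c0 F M x : Prop :=
  exists (V : lmodType R) (N : V -> R) (e : nat -> V),
    [/\ seminorm N, hamel_basis e, generates F M x N e &
        equivalent N e c0_norm c0_basis].

Definition plegma_block (b : nat -> X) F M x : Prop :=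
  (forall s, restrict_family F M s -> finitely_supported b (x s)) /\
  (forall s1 s2, restrict_family F M s1 -> restrict_family F M s2 ->
     plegma [:: s1; s2] -> block_lt b (x s1) (x s2)).

End SpreadingModels.

Definition admits_c0_wrc {R : realType} (X : normedModType R) : Prop :=
  exists (F : set {fset nat}) (M : set nat) (x : {fset nat} -> X),
    [/\ regular_thin F, infinite_subset M,
        weakly_relatively_compact (x @` restrict_family F M) &
        generates_c0 F M x].

Definition admits_c0_plegma_block {R : realType} {X : normedModType R}
    (b : nat -> X) : Prop :=
  exists (F : set {fset nat}) (M : set nat) (x : {fset nat} -> X),
    [/\ regular_thin F, infinite_subset M,
        plegma_block b F M x &
        generates_c0 F M x].

(* Main.v *)
(** Let [U] be a nonprincipal ultrafilter. Iterated weak limits along [U] extend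
    [s |-> x_s] to a map [phi] on the initial segments of the members of [F], and
    reading the elements of a plegma tuple in increasing order, each under the
    quantifier "for U-many n", gives a notion of generic plegma tuple with a
    Ramsey property. As averages over plegma tuples tend to 0, [phi] vanishes at
    the empty set. The norm being convex, hence weakly lower semicontinuous,
    replacing each [x_(s_j)] by the value of [phi] at an initial segment chosen
    by a stopping rule does not increase generic norms: all stopped vectors keep
    an upper c_0 estimate.

    Let [c] be a lower bound of the [|x_s|], let [a_n = c / 2^(n+1)], and let
    [r_n(s)] be the least [i] such that U-almost all one-point extensions [t] of
    [s|i] satisfy [|phi(t)| >= a_n]. If [r_(n+1)(s_2) < r_n(s_1)] held for generic
    plegma pairs and every [n], a sequence of consecutive plegma pairs would give
    an infinite descent. So [r_n(s_1) <= r_(n+1)(s_2)] for some [n] and generic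
    plegma pairs. Then [w_s = phi(s|(r_n(s) + 1)) - phi(s|r_(n+1)(s))] has norm at
    least [a_(n+1)], has an upper c_0 estimate, and is up to a small error
    supported between coordinates determined by [s(r_(n+1)(s) + 1)] and
    [s(r_n(s) + 1)], so that plegma pairs are blocks. The lower c_0 estimate
    comes from the basis constant, and a last extraction gives the norm of the
    spreading model as a limit of norms over plegma tuples. *)
Require Import Defs.
From HB Require Import structures.
From mathcomp Require Import all_boot all_order all_algebra.
From mathcomp Require Import finmap.
From mathcomp Require Import all_classical all_reals all_analysis.
From mathcomp Require Import zify ring lra.
Import Order.TTheory GRing.Theory Num.Theory.
Import numFieldNormedType.Exports.

Set Implicit Arguments.
Unset Strict Implicit.
Unset Printing Implicit Defensive.

Local Open Scope classical_set_scope.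
Local Open Scope ring_scope.

(** * Fronts of increasing sequences *)

Section Fronts.
Local Open Scope nat_scope.

(** Write [x_s] as the telescoping sum of the increments [phi(s|i+1) - phi(s|i)]. After an
    extraction the i-th increment is small before a coordinate fixed when [s(i+1)] is chosen, being
    a term of a weakly convergent family minus its limit, and nearly vanishes after a coordinate
    fixed one choice later. Since a plegma pair satisfies [s_1(k) < s_2(k) < s_1(k+1)], the whole
    vectors [x_(s_1)] and [x_(s_2)] interleave; only slices of increments, from step [p(s)] to step
    [q(s)] with [q(s_1) <= p(s_2)], can form blocks. As members of the family may be arbitrarily
    long, fixed [p] and [q] need not capture a part of [x_s] bounded away from 0: both ends have to
    be stopping times, for which the upper estimate survives. The slice must not be small: a jump at
    one level ends it, and the absence of earlier jumps at half that level keeps its initial value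
    smaller. Hence the comparison of ranks at consecutive levels; lowering the level by one at each
    set of a sequence is what lets the descent of ranks go on for ever. *)

Definition initials (E : seq nat -> Prop) (u : seq nat) : Prop :=
  exists2 v, E v & prefix u v.

(* The increasing enumerations of the members of a regular thin family; the
   well-foundedness of the tree of their initial segments is compactness. *)
Record front (E : seq nat -> Prop) : Prop := Front {
  front_sorted : forall u, E u -> sorted ltn u;
  front_thin : forall u v, E u -> E v -> prefix u v -> u = v;
  front_spread : forall u v, initials E u -> size v = size u ->
    sorted ltn v -> (forall i, i < size u -> nth 0 u i <= nth 0 v i) ->
    initials E v;
  front_wf : well_founded
    (fun u t => initials E u /\ exists n, u = rcons t n);
  front_ne : exists2 u, E u & u != [::] }.

Variables (E : seq nat -> Prop) (hE : front E).
Local Notation T := (initials E).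

Lemma initials_self u : E u -> T u.
Proof. by move=> Eu; exists u => //; apply: prefix_refl. Qed.

Lemma initials_prefix u v : T v -> prefix u v -> T u.
Proof. by move=> [w Ew vw] uv; exists w => //; apply: prefix_trans uv vw. Qed.

Lemma initials_take u i : T u -> T (take i u).
Proof. by move=> /initials_prefix; apply; exact: prefix_take. Qed.

Lemma initials_sorted u : T u -> sorted ltn u.
Proof.
move=> [v /(front_sorted hE) sv /prefixP[w vE]]; move: sv; rewrite vE.
by move=> /cat_sorted2[].
Qed.

Lemma initials_nil : T [::].
Proof. by have [u Eu _] := front_ne hE; exists u => //; apply: prefix0s. Qed.

Lemma front_nil : ~ E [::].
Proof.
have [u Eu /eqP u0] := front_ne hE => /(front_thin hE)/(_ Eu (prefix0s _)) uE.
exact: u0.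
Qed.

(** Some member properly continues [t]; by spreading, its next element may be raised to any larger
    [n]. *)
Lemma initials_extend t : T t -> ~ E t -> exists n0, forall n, n0 <= n ->
  T (rcons t n).
Proof.
move=> [v Ev tv] nEt.
have st : size t < size v.
  rewrite ltn_neqAle size_prefix// andbT; apply/eqP => sE.
  by apply: nEt; move: tv; rewrite prefixE sE take_size => /eqP <-.
have tE : take (size t) v = t by apply/eqP; rewrite -prefixE.
have vs := front_sorted hE Ev.
exists (nth 0 v (size t)) => n hn.
have Tv : T (take (size t).+1 v) by apply/initials_take/initials_self.
have tvE : take (size t).+1 v = rcons t (nth 0 v (size t)).
  by rewrite (take_nth 0)// tE.
apply: (front_spread hE Tv).
- by rewrite tvE !size_rcons.
- have := initials_sorted Tv; rewrite tvE.
  move: (nth 0 v (size t)) hn => m mn.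
  case: (t) => [//|x s] /=; rewrite !rcons_path => /andP[-> /=] h.
  exact: leq_trans h mn.
- move=> i; rewrite tvE size_rcons ltnS leq_eqVlt => /orP[/eqP ->|it].
  + by rewrite !nth_rcons !ltnn !eqxx.
  + by rewrite !nth_rcons it.
Qed.

(** If the walk never met [E], its initial stretches would descend for ever in the tree, against
    [front_wf]. *)
Lemma front_walk (A : nat -> nat) :
  (forall i, T (mkseq A i) -> ~ E (mkseq A i) -> T (mkseq A i.+1)) ->
  exists i, E (mkseq A i).
Proof.
move=> hA; suff: forall t, forall i, t = mkseq A i -> T t -> exists i, E (mkseq A i).
  by move=> /(_ [::] 0 erefl); apply; exact: initials_nil.
elim/(well_founded_ind (front_wf hE)) => t IH i tE Tt.
have [Et|nEt] := pselect (E t); first by exists i; rewrite -tE.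
apply: (IH (mkseq A i.+1) _ i.+1 erefl); last by apply: hA; rewrite -tE.
split; first by apply: hA; rewrite -tE.
by exists (A i); rewrite mkseqS tE.
Qed.

End Fronts.

(** * Generic plegma tuples *)

Section Generic.
Local Open Scope nat_scope.

Variables (E : seq nat -> Prop) (hE : front E).
Local Notation T := (initials E).
Local Notation state := (seq (seq nat)).
Implicit Types (s t : state) (Q : state -> Prop).

(** A state is a tuple under construction: place [i] holds the elements given so far to its [i]-th
    set. *)
Definition tok s i : seq nat := nth [::] s i.

Definition push s i n : state := set_nth [::] s i (rcons (tok s i) n).

Definition done s : Prop := forall i, i < size s -> E (tok s i).

(** Shorter sets first, ties broken to the left: the order [s_1(1), s_2(1), ..., s_1(2), ...] forced
    by the plegma inequalities. *)
Definition lexle s i j : bool :=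
  (size (tok s i) < size (tok s j)) ||
  ((size (tok s i) == size (tok s j)) && (i <= j)).

(* The elements of a plegma tuple, in increasing order, are distributed
   round-robin among the sets of the tuple, skipping the complete ones. *)
Definition turn s i : Prop :=
  [/\ i < size s, T (tok s i), ~ E (tok s i) &
      forall j, j < size s -> ~ E (tok s j) -> lexle s i j].

Lemma tok_set s i j u : tok (set_nth [::] s i u) j = if j == i then u else tok s j.
Proof. by rewrite /tok nth_set_nth. Qed.

Lemma size_set s i u : i < size s -> size (set_nth [::] s i u) = size s.
Proof. by move=> h; rewrite size_set_nth; apply/maxn_idPr. Qed.

Lemma size_push s i n : i < size s -> size (push s i n) = size s.
Proof. exact: size_set. Qed.

Lemma tok_push s i n j :
  tok (push s i n) j = if j == i then rcons (tok s i) n else tok s j.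
Proof. exact: tok_set. Qed.

Lemma turn_uniq s i j : turn s i -> turn s j -> i = j.
Proof.
move=> [ik _ nEi hi] [jk _ nEj hj].
by have := hi _ jk nEj; have := hj _ ik nEi; rewrite /lexle; lia.
Qed.

Lemma turn_done s i : turn s i -> ~ done s.
Proof. by move=> [ik _ nE _] /(_ _ ik). Qed.

Lemma turn_ex s : (forall i, i < size s -> T (tok s i)) -> ~ done s ->
  exists i, turn s i.
Proof.
move=> hT nd.
pose P p := `[< exists i, [/\ i < size s, ~ E (tok s i) & size (tok s i) = p] >].
have exP : exists p, P p.
  apply: contra_notP nd => np i ik; apply: contrapT => nE; apply: np.
  by exists (size (tok s i)); apply/asboolP; exists i.
case: (ex_minnP exP) => p /asboolP[i0 [i0k nE0 s0]] pmin.
pose P' i := `[< [/\ i < size s, ~ E (tok s i) & size (tok s i) = p] >].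
have exP' : exists i, P' i by exists i0; apply/asboolP.
case: (ex_minnP exP') => i /asboolP[ik nEi si] imin.
exists i; split=> //; first exact: hT.
move=> j jk nEj; rewrite /lexle si.
have := pmin (size (tok s j)); rewrite leq_eqVlt => /(_ _)/orP[||->//].
  by apply/asboolP; exists j.
move=> /eqP pj; rewrite -pj eqxx ltnn /=; apply: imin; apply/asboolP; split=> //.
Qed.

Lemma turn_set s i j u : turn s i -> i != j -> j < size s -> E u ->
  turn (set_nth [::] s j u) i.
Proof.
move=> [ik Ti nEi hi] ij jk Eu; split; rewrite ?size_set ?tok_set ?(negbTE ij)//.
move=> m mk; rewrite /lexle !tok_set (negbTE ij).
by case: eqP => // _; apply: hi.
Qed.

Lemma push_set s i j n u : i != j ->
  set_nth [::] (push s i n) j u = push (set_nth [::] s j u) i n.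
Proof.
move=> ij; rewrite /push tok_set (negbTE ij) set_set_nth.
by rewrite (negbTE ij).
Qed.

Lemma state_eq s t : size s = size t ->
  (forall i, i < size s -> tok s i = tok t i) -> s = t.
Proof. by move=> h k; apply: (eq_from_nth (x0 := [::])). Qed.

(** A finite product of well-founded trees: the outer induction is on place [k], the inner one on
    the moves at the first [k] places. *)
Lemma move_wf k : well_founded (fun t s => exists i, [/\ i < k, i < size s,
  T (tok t i) /\ exists n, tok t i = rcons (tok s i) n &
  t = set_nth [::] s i (tok t i)]).
Proof.
elim: k => [s|k IH s]; first by apply: Acc_intro => t [i []].
move: {-1}(tok s k) (erefl (tok s k)) => u.
elim/(well_founded_ind (front_wf hE)) : u s => u IHu s.
elim/(well_founded_ind IH) : s => s IHs su.
apply: Acc_intro => t [i [ik isz Hi tE]].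
move: ik; rewrite ltnS leq_eqVlt => /orP[/eqP ik|ik].
  by subst i; apply: (IHu (tok t k)) => //; rewrite -su.
apply: IHs; first by exists i.
by rewrite tE tok_set gtn_eqF.
Qed.

Variable U : set_system nat.

(* [gen Q s]: when the elements that complete the tuple [s] are added one by one
   and each of them is quantified by "for U-many n", the result satisfies [Q]. *)
Inductive gen Q s : Prop :=
| GenDone : done s -> Q s -> gen Q s
| GenTurn i (A : set nat) : turn s i -> U A ->
    (forall n, A n -> gen Q (push s i n)) -> gen Q s.

Hypothesis UU : UltraFilter U.
Hypothesis Uinf : forall n0, U [set n | n0 <= n].

Lemma gen_push Q s i : gen Q s -> turn s i -> U [set n | gen Q (push s i n)].
Proof.
case=> [d _ /turn_done//|j A tj UA hA ti].
by rewrite (turn_uniq ti tj); apply: filterS UA.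
Qed.

Lemma gen_done Q s : gen Q s -> done s -> Q s.
Proof. by case=> // i A /turn_done. Qed.

Lemma gen_near Q s i : turn s i -> U [set n | gen Q (push s i n)] -> gen Q s.
Proof. by move=> ti UA; apply: (GenTurn ti UA). Qed.

Lemma gen_mono Q Q' s : (forall t, Q t -> Q' t) -> gen Q s -> gen Q' s.
Proof.
move=> QQ'; elim=> {s} [s d q|s i A ti UA _ IH]; first by apply: GenDone; auto.
exact: GenTurn ti UA IH.
Qed.

Lemma gen_and Q Q' s : gen Q s -> gen Q' s -> gen (fun t => Q t /\ Q' t) s.
Proof.
elim=> {s} [s d q /gen_done|s i A ti UA _ IH g']; first by move=> /(_ d); left.
apply: (gen_near ti); 
by apply: filterS (filterI UA (gen_push g' ti)) => n [An gn]; apply: IH.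
Qed.

(** Termination of the generic process. A derivation of it is a well-founded tree of moves, so it
    serves as an induction principle on states. *)
Definition bar s : Prop := gen (fun=> True) s.

Lemma gen_bar Q s : gen Q s -> bar s.
Proof. exact: gen_mono. Qed.

(** The Ramsey property: at every move the ultrafilter decides which alternative holds for almost
    all next elements. *)
Lemma gen_ultra Q s : bar s -> gen Q s \/ gen (fun t => ~ Q t) s.
Proof.
elim=> {s} [s d _|s i A ti UA _ IH].
  by have [q|q] := pselect (Q s); [left|right]; left.
have [UB|UB] := in_ultra_setVsetC [set n | gen Q (push s i n)] UU.
  by left; apply: gen_near UB.
right; apply: (gen_near ti); apply: filterS (filterI UA UB) => n [An nn].
by have [/nn|] := IH _ An.
Qed.

Lemma gen_all (I : eqType) (r : seq I) (Q : I -> state -> Prop) s : bar s ->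
  (forall i, i \in r -> gen (Q i) s) ->
  gen (fun t => forall i, i \in r -> Q i t) s.
Proof.
move=> b; elim: r => [|i r IH] h; first exact: gen_mono b.
have hr : forall j, j \in r -> gen (Q j) s.
  by move=> j jr; apply: h; rewrite inE jr orbT.
apply: gen_mono (gen_and (h i (mem_head _ _)) (IH hr)) => t [qi qr] j.
by rewrite inE => /predU1P[->|/qr].
Qed.

Lemma gen_prefix Q s : gen Q s -> gen (fun t => [/\ Q t, size t = size s &
  forall j, prefix (tok s j) (tok t j)]) s.
Proof.
elim=> {s} [s d q|s i A ti UA _ IH].
  by left=> //; split=> // j; exact: prefix_refl.
apply: (GenTurn ti UA) => n An; have [ik _ _ _] := ti.
apply: gen_mono (IH _ An) => t [qt st pt]; split=> //.
  by rewrite st size_push.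
move=> j; apply: prefix_trans (pt j); rewrite tok_push; case: eqP => [->|_].
  exact: prefix_rcons.
exact: prefix_refl.
Qed.

Lemma bar_initials s : (forall i, i < size s -> T (tok s i)) -> bar s.
Proof.
move: {2}(size s) (erefl (size s)) => k.
elim/(well_founded_ind (move_wf k)) : s => s IH sk hT.
have [d|nd] := pselect (done s); first by left.
have [i ti] := turn_ex hT nd; have [ik Ti nEi _] := ti.
have [n0 hn0] := initials_extend hE Ti nEi.
apply: (GenTurn ti (Uinf n0)) => n /= hn; apply: IH.
- exists i; split; rewrite ?tok_push ?eqxx -?sk//.
  by split; [exact: hn0|exists n].
- by rewrite size_push.
- move=> j; rewrite size_push// tok_push; case: eqP => [_ _|_]; [exact: hn0|exact: hT].
Qed.

Definition start k : state := nseq k [::].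

Lemma tok_start k j : tok (start k) j = [::].
Proof. by rewrite /tok nth_nseq if_same. Qed.

Lemma bar_start k : bar (start k).
Proof.
by apply: bar_initials => i _; rewrite tok_start; exact: initials_nil.
Qed.

(** The turns of [j] are skipped: at such a turn any one generic element will do, since the [j]-th
    set is overwritten anyway. *)
Lemma gen_set1 Q j s : j < size s ->
  (forall t u, Q t -> Q (set_nth [::] t j u)) ->
  forall u, E u -> gen Q s -> gen Q (set_nth [::] s j u).
Proof.
move=> js Qj u Eu g; elim: g js => {s} [s d q js|s i A ti UA _ IH js].
  left; last exact: Qj.
  by move=> m; rewrite size_set// tok_set; case: eqP => // _; exact: d.
have [ik _ _ _] := ti; have [ij|ij] := eqVneq i j.
  subst j; have [n An] := filter_ex UA; have := IH _ An.
  by rewrite size_push// /push set_set_nth eqxx; apply.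
apply: (GenTurn (turn_set ti ij js Eu) UA) => n An.
by rewrite -push_set//; apply: IH => //; rewrite size_push.
Qed.

Lemma gen_set2 Q j s : bar s -> j < size s ->
  (forall t u, Q (set_nth [::] t j u) -> Q t) ->
  forall u, E u -> gen Q (set_nth [::] s j u) -> gen Q s.
Proof.
move=> b js Qj u Eu; elim: b js => {s} [s d _ js /gen_done h|s i A ti UA _ IH js g].
  left=> //; apply: Qj; apply: h.
  by move=> m; rewrite size_set// tok_set; case: eqP => // _; exact: d.
have [ik _ _ _] := ti; have [ij|ij] := eqVneq i j.
  subst j; apply: (GenTurn ti UA) => n An; apply: IH => //.
    by rewrite size_push.
  by rewrite /push set_set_nth eqxx.
apply: (gen_near ti); 
by apply: filterS (filterI UA (gen_push g (turn_set ti ij js Eu))) => n [An] /=; rewrite -push_set//; apply: IH => //; rewrite size_push.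
Qed.

(** Both states are compared with the one holding a complete [v] at place [j], where [j] never gets
    a turn. *)
Lemma gen_indep Q j s u : bar s -> j < size s -> T (tok s j) ->
  (forall t v, Q (set_nth [::] t j v) <-> Q t) ->
  gen Q (set_nth [::] s j u) -> gen Q s.
Proof.
move=> b js Tj Qj; have [v Ev _] := Tj.
move=> /gen_set1-/(_ j); rewrite size_set// => /(_ js _ v Ev).
rewrite set_set_nth eqxx => h; apply: (gen_set2 b js _ Ev (h _)).
- by move=> t w /Qj.
- by move=> t w /Qj.
Qed.

(* Invariant of the round-robin order of [turn]. *)
Definition balanced s : Prop := forall m j, m < size s -> j < size s ->
  ~ E (tok s j) -> size (tok s m) <= size (tok s j) + (m < j).

Lemma balanced_push s i n : turn s i -> balanced s -> balanced (push s i n).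
Proof.
move=> [ik Ti nEi hi] bs m j; rewrite size_push// => mk jk.
rewrite !tok_push; case: (eqVneq j i) => [-> _|ji nEj].
  case: eqP => [_|_]; first by rewrite leq_addr.
  by rewrite size_rcons (leq_trans (bs _ _ mk ik nEi))//; lia.
case: eqP => [->|_]; last exact: bs.
by rewrite size_rcons; have := hi _ jk nEj; rewrite /lexle; lia.
Qed.

(** Indices count from 0, and incomplete tuples are allowed; the second clause with [i = j] says
    that each set is increasing. *)
Definition plegmas s : Prop := forall i j k, i < size s -> j < size s ->
  (i < j -> k < size (tok s i) -> k < size (tok s j) ->
    nth 0 (tok s i) k < nth 0 (tok s j) k) /\
  (k < size (tok s i) -> k.+1 < size (tok s j) ->
    nth 0 (tok s i) k < nth 0 (tok s j) k.+1).

(** The new element is maximal, so only inequalities having it on the left could fail; [balanced]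
    makes these vacuous. *)
Lemma plegmas_push s i n : turn s i -> balanced s -> plegmas s ->
  (forall j x, j < size s -> x \in tok s j -> x < n) -> plegmas (push s i n).
Proof.
move=> [ik Ti nEi hi] bs ps hn a b k; rewrite size_push// => ak bk.
have small j p : j < size s -> p < size (tok s j) -> nth 0 (tok s j) p < n.
  by move=> js pj; apply: (hn _ _ js); exact: mem_nth.
have [h1 h2] := ps a b k ak bk; have ba := bs a i ak ik nEi; have bb := bs b i bk ik nEi.
rewrite !tok_push.
case: (eqVneq a i) => ai; case: (eqVneq b i) => bi.
- split=> [|]; first by rewrite ai bi ltnn.
  rewrite !size_rcons !nth_rcons => _ ks.
  have kb : k < size (tok s i) by lia.
  rewrite ai bi in h2; have [k1|k1] := ltnP k.+1 (size (tok s i)).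
    by rewrite kb; exact: h2.
  by rewrite kb (_ : k.+1 == size (tok s i)) ?small//; lia.
- rewrite ai in h1 h2 ba *; rewrite !size_rcons !nth_rcons; split.
    move=> ib; rewrite ltnS leq_eqVlt => /orP[/eqP kE|ks] kb; last by rewrite ks h1.
    by lia.
  rewrite ltnS leq_eqVlt => /orP[/eqP kE|ks] kb; last by rewrite ks h2.
  by lia.
- rewrite bi in h1 h2 bb *; rewrite !size_rcons !nth_rcons; split.
    move=> ab ka; rewrite ltnS leq_eqVlt => /orP[/eqP kE|kb]; last by rewrite kb h1.
    by rewrite kE ltnn eqxx small// -kE.
  move=> ka kb; have [k1|k1] := ltnP k.+1 (size (tok s i)); first exact: h2.
  by rewrite (_ : k.+1 == size (tok s i)) ?small//; lia.
- by [].
Qed.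

Lemma gen_plegmas (M : set nat) s : U M -> bar s -> balanced s -> plegmas s ->
  (forall j x, j < size s -> x \in tok s j -> M x) ->
  gen (fun t => [/\ done t, plegmas t & forall j x, j < size t -> x \in tok t j -> M x]) s.
Proof.
move=> UM; elim=> {s} [s d _ bs ps ms|s i A ti UA _ IH bs ps ms]; first by left.
have [ik _ _ _] := ti.
have [n0 hn0] : exists n0, forall j x, j < size s -> x \in tok s j -> x < n0.
  exists (\max_(u <- s) \max_(x <- u) x).+1 => j x js xj.
  rewrite ltnS; apply: (@leq_trans (\max_(y <- tok s j) y)).
    exact: (@leq_bigmax_seq _ (tok s j) xpredT id).
  apply: (@leq_bigmax_seq _ s xpredT (fun u : seq nat => \max_(y <- u) y)) => //.
  exact: mem_nth.
apply: (gen_near ti); apply: filterS (filterI UA (filterI UM (Uinf n0))) => n [An [Mn hn]].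
apply: IH => //.
- exact: balanced_push.
- apply: plegmas_push => // j x js xj; apply: leq_trans hn; exact: hn0 xj.
- move=> j x; rewrite size_push// tok_push => js; case: eqP => [_|_]; last exact: ms.
  by rewrite mem_rcons inE => /predU1P[->//|]; exact: ms.
Qed.

Lemma gen_start (M : set nat) k : U M ->
  gen (fun t => [/\ done t, plegmas t, size t = k &
    forall j x, j < size t -> x \in tok t j -> M x]) (start k).
Proof.
move=> UM; have b := bar_start k.
have b1 : balanced (start k) by move=> m j _ _ _; rewrite !tok_start.
have b2 : plegmas (start k) by move=> i j p _ _; rewrite !tok_start.
have b3 j x : j < size (start k) -> x \in tok (start k) j -> M x.
  by rewrite tok_start.
apply: gen_mono (gen_prefix (gen_plegmas UM b b1 b2 b3)) => t [[? ? ?]].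
by rewrite size_nseq.
Qed.

End Generic.

(** * Homogeneous sequences by diagonalization against finitely many states *)

Section Words.
Local Open Scope nat_scope.
Variable I : eqType.

Fixpoint words (A : seq I) k : seq (seq I) :=
  if k is k'.+1 then [seq a :: w | a <- A, w <- words A k'] else [:: [::]].

Lemma mem_words (A w : seq I) k :
  (w \in words A k) = (size w == k) && all (mem A) w.
Proof.
elim: k w => [|k IH] [|a w] //=.
- by apply/allpairsP => -[[? ?] []].
- rewrite eqSS; apply/allpairsP/and3P => [[[b v] /= [bA vw [-> ->]]]|[sw aA wA]].
    by move: vw; rewrite IH => /andP[].
  by exists (a, w); rewrite IH sw.
Qed.

Definition words_upto A k : seq (seq I) := flatten [seq words A i | i <- iota 0 k.+1].

Lemma mem_words_upto (A w : seq I) k :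
  size w <= k -> {subset w <= A} -> w \in words_upto A k.
Proof.
move=> wk wA; apply/flatten_mapP; exists (size w).
  by rewrite mem_iota add0n ltnS wk.
by rewrite mem_words eqxx; apply/allP.
Qed.

End Words.

Section Homogeneous.
Local Open Scope nat_scope.
Variables (E : seq nat -> Prop) (hE : front E).
Variables (U : set_system nat) (UU : UltraFilter U).
Hypothesis Uinf : forall n0, U [set n | n0 <= n].
Local Notation T := (initials E).
Local Notation state := (seq (seq nat)).
Local Notation gen := (gen E U).

Lemma filter_all (I : eqType) (r : seq I) (P : I -> nat -> Prop) :
  (forall i, i \in r -> U [set n | P i n]) ->
  U [set n | forall i, i \in r -> P i n].
Proof.
elim: r => [|i r IH] h; first by apply: filterS filterT.
have hr : forall j, j \in r -> U [set n | P j n].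
  by move=> j jr; apply: h; rewrite inE jr orbT.
apply: filterS (filterI (h i (mem_head _ _)) (IH hr)) => n [pi pr] j.
by rewrite inE => /predU1P[->|/pr].
Qed.

Lemma diagonal_sequence (P : seq nat -> nat -> Prop) :
  (forall u, U [set n | P u n]) ->
  exists l : nat -> nat, (forall i j, i < j -> l i < l j) /\
    forall i, P (mkseq l i) (l i).
Proof.
move=> hP.
have : forall u, exists n, P u n /\ forall x, x \in u -> x < n.
  move=> u; apply: (@filter_ex _ U).
  apply: filterS (filterI (hP u) (Uinf (\max_(y <- u) y).+1)) => n [Pn hn].
  split=> // x xu; apply: leq_trans hn; rewrite ltnS.
  exact: (@leq_bigmax_seq _ u xpredT id).
move=> /choice[f hf].
pose p := fix p i := if i is j.+1 then rcons (p j) (f (p j)) else [::].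
have pE i : mkseq (f \o p) i = p i by elim: i => // i IH; rewrite mkseqS IH.
exists (f \o p); split; last by move=> i; rewrite pE; exact: (hf _).1.
move=> i j ij; apply: (hf (p j)).2; rewrite -pE.
by apply/mapP; exists i; rewrite ?mem_iota.
Qed.

(** Each new term keeps generic all of the finitely many generic states written with the earlier
    terms. A plegma tuple in the range of [l] is then rebuilt element by element in the order of
    turns, staying generic until it is complete. Entries of index at least [m] ensure that [Q m] was
    already handled at each stage used. *)
Lemma homogeneous (Q : nat -> state -> Prop) (P : seq nat -> nat -> Prop)
    (M : set nat) :
  (forall m k, k <= m -> gen (Q m) (start k)) ->
  (forall u, U [set n | P u n]) -> U M ->
  exists l : nat -> nat, [/\ forall i j, i < j -> l i < l j,
    forall i, M (l i), forall i, P (mkseq l i) (l i) &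
    forall m s, size s <= m -> plegmas s -> done E s ->
      (forall j x, j < size s -> x \in tok s j -> exists2 i, m <= i & x = l i) ->
      Q m s].
Proof.
move=> hQ hP UM.
pose W u n := forall m, m \in iota 0 (size u).+1 -> forall s,
  s \in words_upto (words_upto u (size u)) m ->
  forall i, i \in iota 0 (size s) -> turn E s i -> gen (Q m) s ->
  gen (Q m) (push s i n).
have hW u : U [set n | W u n].
  apply: filter_all => m _; apply: filter_all => s _; apply: filter_all => i _.
  have [[ti gs]|nh] := pselect (turn E s i /\ gen (Q m) s).
    by apply: filterS (gen_push UU gs ti) => n gn _ _.
  by apply: filterS filterT => n _ ti gs; case: nh.
have [|l [lmono hl]] := @diagonal_sequence (fun u n => [/\ M n, P u n & W u n]).
  move=> u; apply: filterS (filterI UM (filterI (hP u) (hW u))) => n [? []].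
  by split.
exists l; split=> //; [by move=> i; have [] := hl i|by move=> i; have [] := hl i|].
move=> m s sm ps ds hs.
suff: forall t, size t = size s -> (forall j, prefix (tok t j) (tok s j)) ->
    balanced E t -> gen (Q m) t -> Q m s.
  move=> /(_ (start (size s))); apply; rewrite ?size_nseq//.
  - by move=> j; rewrite tok_start prefix0s.
  - by move=> i j _ _ _; rewrite !tok_start.
  - exact: hQ.
elim/(well_founded_ind (move_wf hE (size s))) => t IH ts pt bt gt.
have Tt i : i < size t -> T (tok t i).
  by move=> it; exists (tok s i) => //; apply: ds; rewrite -ts.
have [dt|nd] := pselect (done E t).
  suff <- : t = s by apply: gen_done gt dt.
  apply: state_eq => // i it; apply: (front_thin hE) => //; first exact: dt.
  by apply: ds; rewrite -ts.
have [i ti] := turn_ex Tt nd; have [it Ti nEi tmin] := ti.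
have is_ : i < size s by rewrite -ts.
set p := size (tok t i).
have ps_ : p < size (tok s i).
  rewrite ltn_neqAle (size_prefix (pt i)) andbT; apply/eqP => pE.
  apply: nEi; have := pt i; rewrite prefixE -/p pE take_size => /eqP <-.
  exact: ds.
have takeE j : take (size (tok t j)) (tok s j) = tok t j.
  by apply/eqP; rewrite -prefixE.
have [c mc nE] := hs i _ is_ (mem_nth 0 ps_).
have rE : rcons (tok t i) (l c) = take p.+1 (tok s i).
  by rewrite (take_nth 0)// takeE nE.
(* The element next in turn exceeds all those already placed: the balance of [t] leaves only
   comparisons that the plegma inequalities of [s] settle. *)
have small j x : j < size t -> x \in tok t j -> x < l c.
  move=> jt /(nthP 0)[k kt <-]; rewrite -nE -(takeE j) nth_take//.
  have js : j < size s by rewrite -ts.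
  have := bt j i jt it nEi; rewrite -/p => jb.
  have kj : k < size (tok s j) by apply: leq_trans kt (size_prefix (pt j)).
  have [kp|kp] := ltnP k p.
    apply: leq_trans ((ps j i k js is_).2 kj (leq_ltn_trans kp ps_)) _.
    have si := front_sorted hE (ds _ is_).
    apply: (sorted_leq_nth leq_trans leqnn) => //.
    + by apply: sub_sorted si => a b /ltnW.
    + by rewrite inE; exact: leq_ltn_trans ps_.
  have kb : k < p + (j < i) := leq_trans kt jb.
  have ji : j < i by move: kb kp; clear; case: (j < i) => //; lia.
  have kE : k = p by move: kb kp; rewrite ji; clear; lia.
  by move: kj; rewrite kE => kj; exact: (ps j i p js is_).1.
have lc j x : j < size t -> x \in tok t j -> x \in mkseq l c.
  move=> jt xj; have := small _ _ jt xj.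
  have [//||d _ ->] := hs j x; first by rewrite -ts.
    by rewrite -(takeE j) in xj; exact: mem_take xj.
  move=> ld; apply/mapP; exists d => //; rewrite mem_iota /= add0n ltnNge.
  apply/negP; rewrite leq_eqVlt => /predU1P[dc|/lmono]; last by lia.
  by move: ld; rewrite dc ltnn.
have szc j : j < size t -> size (tok t j) <= c.
  move=> jt; rewrite -(size_mkseq l c); apply: uniq_leq_size.
    exact: (sorted_uniq ltn_trans ltnn (initials_sorted hE (Tt _ jt))).
  by move=> x; exact: lc.
have tw : t \in words_upto (words_upto (mkseq l c) (size (mkseq l c))) m.
  apply: mem_words_upto; first by rewrite ts.
  move=> u /(nthP [::])[j jt <-]; apply: mem_words_upto.
    by rewrite size_mkseq; exact: szc.
  by move=> x; exact: lc.
have [_ _ Wc] := hl c.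
have gp : gen (Q m) (push t i (l c)).
  apply: (Wc m _ t tw i _ ti gt); last by rewrite mem_iota.
  by rewrite mem_iota size_mkseq.
apply: (IH _ _ _ _ _ gp).
- exists i; split=> //; rewrite tok_push eqxx//; split; last by exists (l c).
  by rewrite rE; apply: initials_take; apply: initials_self; exact: ds.
- by rewrite size_push.
- move=> j; rewrite tok_push; case: eqP => [->|_]; last exact: pt.
  by rewrite rE; exact: prefix_take.
- exact: balanced_push.
Qed.

Lemma gen_ex Q s : gen Q s -> exists t, Q t.
Proof.
elim=> {s} [s d q|s i A ti UA _ IH]; first by exists s.
by have [n /IH] := filter_ex UA.
Qed.

Local Open Scope ring_scope.

Lemma ultra_lim (R : realType) (v : nat -> R) (B : R) :
  U [set n | `|v n| <= B] ->
  exists y, forall e, 0 < e -> U [set n | `|v n - y| < e].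
Proof.
move=> hB; pose S := [set r : R | U [set n | r <= v n]].
have S0 : S (- B).
  by apply: filterS hB => n /=; rewrite ler_norml => /andP[].
have SB : ubound S B.
  move=> r Sr; have [n [/= rn]] := filter_ex (filterI Sr hB).
  by rewrite ler_norml => /andP[_]; exact: le_trans.
have hS : has_sup S by split; [exists (- B)|exists B].
exists (sup S) => e e0.
have [r Sr re] := sup_adherent e0 hS.
have nS : U (~` [set n | sup S + e / 2 <= v n]).
  have [h|//] := in_ultra_setVsetC [set n | sup S + e / 2 <= v n] UU.
  by have := sup_upper_bound hS h; lra.
apply: filterS (filterI Sr nS) => n [/= rn /negP]; rewrite -ltNge => nv.
by rewrite ltr_distl; apply/andP; split; lra.
Qed.

Lemma genlim (R : realType) (h : state -> R) (B : R) s :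
  (forall t, `|h t| <= B) ->
  bar E U s ->
  exists v, forall e, 0 < e -> gen (fun t => `|h t - v| < e) s.
Proof.
move=> hB; elim=> {s} [s d _|s i A ti UA _ IH].
  by exists (h s) => e e0; left=> //; rewrite subrr normr0.
have : forall n, exists v, A n -> forall e, 0 < e ->
    gen (fun t => `|h t - v| < e)%R (push s i n).
  move=> n; have [An|nA] := pselect (A n); last by exists 0%R.
  by have [v hv] := IH _ An; exists v.
move=> /choice[v hv].
(* Each [v n] is within 1 of a value of [h], hence bounded uniformly in [n]. *)
have vB : U [set n | `|v n| <= B + 1].
  apply: filterS UA => n An; have [t] := gen_ex (hv n An _ ltr01).
  move=> ht /=; have := hB t.
  have := ler_normB (h t) (h t - v n); rewrite opprB addrC subrK; lra.
have [y hy] := ultra_lim vB; exists y => e e0.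
have e20 : 0 < e / 2 by lra.
apply: (gen_near ti); apply: filterS (filterI UA (hy _ e20)) => n [An hn].
apply: gen_mono (hv n An _ e20) => t ht; rewrite /= in hn.
by apply: le_lt_trans (ler_distD (v n) _ _) _; lra.
Qed.

End Homogeneous.

(** * Separation of convex sets *)

Section HahnBanach.
Variables (R : realType).

Lemma infimum_ex (S : set R) (b : R) : S !=set0 -> (forall s, S s -> b <= s) ->
  exists2 m, (forall s, S s -> m <= s) & forall e, 0 < e -> exists2 s, S s & s < m + e.
Proof.
move=> S0 Sb; have hS : has_inf S by split=> //; exists b.
exists (inf S); first by move=> s Ss; apply: ge_inf => //; exists b.
by move=> e e0; have [s ? ?] := inf_adherent e0 hS; exists s.
Qed.

Section Sublinear.
Variable X : lmodType R.

Definition sublinear (p : X -> R) : Prop :=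
  (forall x y, p (x + y) <= p x + p y) /\
  (forall t x, 0 < t -> p (t *: x) <= t * p x).

Lemma sublinear0 p : sublinear p -> p 0 = 0.
Proof.
move=> [_ h]; apply/eqP; rewrite eq_le.
have := h 2 0 (ltr0n _ _); have := h 2^-1 0; rewrite !scaler0 invr_gt0 ltr0n.
by move=> /(_ isT) ? ?; apply/andP; split; lra.
Qed.

Lemma sublinear_opp p x : sublinear p -> - p (- x) <= p x.
Proof.
move=> hp; have [h _] := hp; have := h x (- x).
by rewrite subrr (sublinear0 hp); lra.
Qed.

Lemma sublinearZ p t x : sublinear p -> 0 <= t -> p (t *: x) = t * p x.
Proof.
move=> hp; rewrite le_eqVlt => /predU1P[<-|t0].
  by rewrite scale0r mul0r sublinear0.
have [_ h] := hp; apply/eqP; rewrite eq_le h//=.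
have ti : 0 < t^-1 by rewrite invr_gt0.
have := h _ (t *: x) ti.
by rewrite scalerA mulVf ?gt_eqF// scale1r mulrC ler_pdivlMr// mulrC.
Qed.

(** The pointwise infimum works: [- q (- x)] bounds it below, and comparability in the chain gives
    one member nearly attaining it at two points at once. *)
Lemma sublinear_chain (q : X -> R) (A : set (X -> R)) : A !=set0 ->
  (forall p, A p -> sublinear p /\ forall x, p x <= q x) ->
  (forall p p', A p -> A p' -> (forall x, p x <= p' x) \/ (forall x, p' x <= p x)) ->
  exists2 m, sublinear m & forall p x, A p -> m x <= p x.
Proof.
move=> [p0 Ap0] Aq Achain.
have : forall x, exists m, (forall p, A p -> m <= p x) /\
    forall e, 0 < e -> exists2 p, A p & p x < m + e.
  move=> x; have [||m m1 m2] := @infimum_ex [set p x | p in A] (- q (- x)).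
  - by exists (p0 x), p0.
  - move=> _ [p Ap <-]; have [sp pq] := Aq _ Ap.
    by apply: le_trans (sublinear_opp x sp); rewrite lerN2.
  exists m; split; first by move=> p Ap; apply: m1; exists p.
  by move=> e /m2[_ [p Ap <-] pm]; exists p.
move=> /choice[m hm]; exists m; last by move=> p x; apply: (hm x).1.
split=> [x y|t x t0]; apply/ler_addgt0Pr => e e0.
  have e20 : 0 < e / 2 by lra.
  have [p1 Ap1 h1] := (hm x).2 _ e20; have [p2 Ap2 h2] := (hm y).2 _ e20.
  have [p [Ap px py]] : exists p, [/\ A p, p x <= p1 x & p y <= p2 y].
    by have [p12|p21] := Achain _ _ Ap1 Ap2; [exists p1|exists p2].
  have [[sp _] _] := Aq _ Ap.
  by have := (hm (x + y)).1 _ Ap; have := sp x y; lra.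
have et0 : 0 < e / t by rewrite divr_gt0.
have [p Ap h] := (hm x).2 _ et0; have [[_ sp] _] := Aq _ Ap.
apply: le_trans ((hm (t *: x)).1 _ Ap) _; apply: le_trans (sp _ _ t0) _.
have : t * p x <= t * (m x + e / t) by rewrite ler_pM2l// ltW.
by rewrite mulrDr mulrCA divff ?gt_eqF// mulr1.
Qed.

(* A sublinear functional that is minimal below [q] is linear. *)
Lemma sublinear_dominates_linear (q : X -> R) : sublinear q ->
  exists f : X -> R, [/\ forall x y, f (x + y) = f x + f y,
    forall t x, f (t *: x) = t * f x & forall x, f x <= q x].
Proof.
move=> sq; pose S := {p : X -> R | sublinear p /\ forall x, p x <= q x}.
pose r (s t : S) := `[< forall x, sval t x <= sval s x >].
have [|||A Achain|[p [sp pq]] pmin] := @Zorn S r.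
- by move=> t; apply/asboolP.
- move=> a b c /asboolP ab /asboolP bc; apply/asboolP => x.
  exact: le_trans (bc x) (ab x).
- move=> [a ha] [b hb] /asboolP ab /asboolP ba; apply: eq_exist => /=.
  by apply/funext => x; apply/eqP; rewrite eq_le (ab x) (ba x).
- have [[a Aa]|nA] := pselect (A !=set0); last first.
    exists (exist _ q (conj sq (fun x => lexx _))) => s As.
    by case: nA; exists s.
  have [|||m sm mA] := @sublinear_chain q [set sval s | s in A].
  + by exists (sval a), a.
  + by move=> _ [s _ <-]; exact: (svalP s).
  + move=> _ _ [s As <-] [t At <-].
    by have [/asboolP st|/asboolP ts] := Achain _ _ As At; [right|left].
  have mq x : m x <= q x.
    by apply: le_trans ((svalP a).2 x); apply: mA; exists a.
  by exists (exist _ m (conj sm mq)) => s As; apply/asboolP => x; apply: mA; exists s.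
have [spD spZ] := sp.
(* The functional [y |-> inf {p (y + t x) - t p x : 0 <= t}] is sublinear and below [p], hence equal
   to [p] by minimality; [y = - x] and [t = 1] give [p (- x) <= - p x]. *)
have podd x : p (- x) = - p x.
  have : forall y, exists m, (forall t, 0 <= t -> m <= p (y + t *: x) - t * p x) /\
      forall e, 0 < e -> exists2 t, 0 <= t & p (y + t *: x) - t * p x < m + e.
    move=> y.
    have [||m m1 m2] := @infimum_ex [set p (y + t *: x) - t * p x | t in [set t | 0 <= t]]
      (- p (- y)).
    + by exists (p (y + 0 *: x) - 0 * p x), 0 => /=.
    + move=> _ [t /= t0 <-]; have := spD (y + t *: x) (- y).
      by rewrite addrC addKr (sublinearZ _ sp t0); lra.
    exists m; split; first by move=> t t0; apply: m1; exists t.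
    by move=> e /m2[_ [t t0 <-] tm]; exists t.
  move=> /choice[m hm].
  have mp y : m y <= p y.
    by have := (hm y).1 0 (lexx _); rewrite scale0r addr0 mul0r subr0.
  have sm : sublinear m.
    split=> [y z|t y t0]; apply/ler_addgt0Pr => e e0.
      have e20 : 0 < e / 2 by lra.
      have [t1 t10 h1] := (hm y).2 _ e20; have [t2 t20 h2] := (hm z).2 _ e20.
      have := (hm (y + z)).1 (t1 + t2) (addr_ge0 t10 t20).
      have := spD (y + t1 *: x) (z + t2 *: x).
      by rewrite addrACA -scalerDl mulrDl; lra.
    have et0 : 0 < e / t by rewrite divr_gt0.
    have [a a0 h] := (hm y).2 _ et0.
    have := (hm (t *: y)).1 (t * a) (mulr_ge0 (ltW t0) a0).
    rewrite -scalerA -scalerDr (sublinearZ _ sp (ltW t0)) -mulrA -mulrBr => h1.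
    apply: (le_trans h1).
    have : t * (p (y + a *: x) - a * p x) <= t * (m y + e / t).
      by rewrite ler_pM2l// ltW.
    by rewrite [t * (m y + _)]mulrDr mulrCA divff ?gt_eqF// mulr1.
  have mq y : m y <= q y by apply: le_trans (mp y) (pq y).
  have /(congr1 sval)/= mE : exist _ m (conj sm mq) = exist _ p (conj sp pq) :> S.
    by apply: pmin; apply/asboolP.
  have := (hm (- x)).1 1 ler01; rewrite scale1r mul1r addNr mE (sublinear0 sp).
  by have := sublinear_opp (- x) sp; rewrite opprK; lra.
exists p; split; [move=> x y|move=> t x|exact: pq].
  have := spD x y; have := spD (- x) (- y); rewrite -opprD !podd.
  by move=> ? ?; apply/eqP; rewrite eq_le; apply/andP; split; lra.
have [t0|t0] := leP 0 t; first exact: sublinearZ.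
rewrite -[t in LHS]opprK scaleNr podd (sublinearZ _ sp) ?oppr_ge0 ?ltW//.
by rewrite mulNr opprK.
Qed.

End Sublinear.

(* Separates [D] from [y]: apply the previous lemma to the sublinear functional
   [h |-> inf {`|h - t (z - y)| - t e : 0 <= t, z in D}]. *)
Lemma separation (X : normedModType R) (D : set X) (y : X) (e : R) : D !=set0 ->
  (forall u v t, D u -> D v -> 0 <= t <= 1 -> D (t *: u + (1 - t) *: v)) ->
  (forall z, D z -> e <= `|z - y|) ->
  exists f : dual X, forall z, D z -> sval f (z - y) <= - e.
Proof.
move=> [z0 Dz0] Dconv Dy.
pose V (h : X) := [set a : R | exists t z, [/\ 0 <= t, D z & a = `|h - t *: (z - y)| - t * e]].
have Vb h a : V h a -> - `|h| <= a.
  move=> [t [z [t0 Dz ->]]].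
  have : t * e <= `|t *: (z - y)| by rewrite normrZ ger0_norm// ler_wpM2l// Dy.
  by have := ler_normD h (t *: (z - y) - h); rewrite addrC subrK distrC; lra.
have V0 h : V h `|h|.
  by exists 0, z0; rewrite scale0r subr0 mul0r subr0.
have : forall h, exists m, (forall a, V h a -> m <= a) /\
    forall d, 0 < d -> exists2 a, V h a & a < m + d.
  move=> h; have Vh : V h !=set0 by exists `|h|.
  by have [m m1 m2] := infimum_ex Vh (Vb h); exists m.
move=> /choice[q hq].
have sq : sublinear q.
  split=> [h k|t h t0]; apply/ler_addgt0Pr => d d0.
    have d20 : 0 < d / 2 by lra.
    have [a [t [z [t0 Dz aE]]] ha] := (hq h).2 _ d20.
    have [b [s [w [s0 Dw bE]]] hb] := (hq k).2 _ d20.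
    have [ts0|ts0] := eqVneq (t + s) 0.
      have [tE sE] : t = 0 /\ s = 0 by split; lra.
      have := (hq (h + k)).1 _ (V0 _); have := ler_normD h k.
      by move: ha hb; rewrite aE bE tE sE !scale0r !subr0 !mul0r !subr0; lra.
    have ts : 0 < t + s by rewrite lt_def ts0 addr_ge0.
    (* Two near-minimizers [z], [w] with weights [t], [s] merge into one point of [D] of weight
       [t + s]; this is the use of convexity. *)
    pose c := t / (t + s).
    have cs : 1 - c = s / (t + s).
      by rewrite /c; field.
    have Dc : D (c *: z + (1 - c) *: w).
      apply: Dconv => //; apply/andP; split; first by rewrite divr_ge0// ltW.
      by rewrite -subr_ge0 cs divr_ge0// ltW.
    have tsc : (t + s) *: (c *: z + (1 - c) *: w - y) = t *: (z - y) + s *: (w - y).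
      rewrite cs scalerBr scalerDr !scalerA /c !(mulrCA (t + s)) divff// !mulr1.
      by rewrite !scalerBr scalerDl opprD addrACA.
    have := (hq (h + k)).1 (`|h + k - (t + s) *: (c *: z + (1 - c) *: w - y)| - (t + s) * e).
    rewrite tsc opprD addrACA => /(_ _)/le_trans; apply.
      exists (t + s), (c *: z + (1 - c) *: w).
      by rewrite tsc opprD addrACA ltW.
    have := ler_normD (h - t *: (z - y)) (k - s *: (w - y)).
    by move: ha hb; rewrite aE bE; lra.
  have dt0 : 0 < d / t by rewrite divr_gt0.
  have [a [s [z [s0 Dz aE]]] ha] := (hq h).2 _ dt0.
  have h1 : q (t *: h) <= t * a.
    apply: (hq (t *: h)).1; exists (t * s), z.
    rewrite mulr_ge0 ?(ltW t0)// -scalerA -scalerBr normrZ gtr0_norm// aE.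
    by rewrite mulrBr mulrA.
  apply: (le_trans h1); have : t * a <= t * (q h + d / t).
    by rewrite ler_pM2l// ltW.
  by rewrite mulrDr mulrCA divff ?gt_eqF// mulr1.
have [f [fD fZ fq]] := sublinear_dominates_linear sq.
have fle x : f x <= `|x| by apply: le_trans (fq x) _; apply: (hq x).1.
have flin : linear_for *%R f by move=> t u v; rewrite fD fZ.
pose F : {scalar X} := HB.pack f (GRing.isLinear.Build R X R *%R f flin).
have Fabs x : `|f x| <= `|x|.
  by rewrite ler_norml fle andbT lerNl -mulN1r -fZ scaleN1r -(normrN x) fle.
have Fc : continuous (F : X -> R).
  move=> x; apply/cvgrPdist_lt => d d0; near=> u.
  have -> : F x - F u = f (x - u) by rewrite fD -(scaleN1r u) fZ mulN1r.
  apply: le_lt_trans (Fabs _) _; near: u.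
  by apply: (@cvgr_dist_lt _ _ _ _ _ id x) => //; exact: cvg_id.
exists (exist _ F Fc) => z Dz /=; apply: le_trans (fq _) _.
apply: (hq _).1; exists 1, z; rewrite ler01 scale1r subrr normr0 mul1r sub0r.
by split.
Unshelve. all: end_near. Qed.

End HahnBanach.

Lemma free_ultrafilter (M : set nat) : infinite_set M ->
  exists U : set_system nat, [/\ UltraFilter U,
    forall n0, U [set n | (n0 <= n)%N] & U M].
Proof.
move=> Minf; pose F : set_system nat := [set A | exists n0, forall n, M n -> (n0 <= n)%N -> A n].
have FF : ProperFilter F.
  apply: Build_ProperFilter_ex.
    move=> A [n0 hA]; apply: contrapT => nA; apply: Minf.
    apply: (sub_finite_set _ (finite_II n0)) => n Mn /=.
    by rewrite ltnNge; apply/negP => /(hA _ Mn) An; apply: nA; exists n.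
  split.
  - by exists 0%N.
  - move=> A B [n hA] [m hB]; exists (maxn n m) => k Mk; rewrite geq_max => /andP[nk mk].
    by split; [exact: hA|exact: hB].
  - by move=> A B AB [n hA]; exists n => k Mk nk; apply: AB; exact: hA.
have [U [UU FU]] := ultraFilterLemma FF; exists U; split=> //.
- by move=> n0; apply: FU; exists n0.
- by apply: FU; exists 0%N.
Qed.

(** * Partial sums of a Schauder basis *)

Section Schauder.
Variables (R : realType) (X : completeNormedModType R) (b : nat -> X).
Hypothesis hb : schauder_basis b.

Local Notation coord := (Defs.coord b).

Lemma coordP x : expansion b x (coord x).
Proof.
have [a [ha _]] := hb x.
exact: (@xgetI _ (fun=> 0) (expansion b x) a ha).
Qed.

Lemma coord_uniq x a : expansion b x a -> coord x = a.
Proof.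
move=> ha; have [c [hc huniq]] := hb x.
by rewrite -(huniq _ ha) (huniq _ (@coordP x)).
Qed.

Definition proj N x : X := \sum_(i < N) coord x i *: b i.

Lemma proj_cvg x : (fun N => proj N x) @ \oo --> x.
Proof.
have := @coordP x; rewrite /expansion.
suff -> : series (fun n => coord x n *: b n) = (fun N => proj N x) by [].
by apply/funext => N; rewrite /series/= big_mkord.
Qed.

Lemma proj_cvg_lt x (e : R) : 0 < e -> exists N0, forall N, (N0 <= N)%N -> `|x - proj N x| < e.
Proof.
move=> e0; have /cvgrPdist_lt/(_ _ e0)[N0 _ h] := @proj_cvg x.
by exists N0 => N; exact: h.
Qed.

Lemma expansion_le x (a : nat -> R) : (forall e : R, 0 < e -> exists N0, forall N, (N0 <= N)%N ->
  `|x - \sum_(i < N) a i *: b i| < e) -> coord x = a.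
Proof.
move=> h; apply: coord_uniq; apply/cvgrPdist_lt => e /h[N0 hN0].
by exists N0 => // N /= /hN0; rewrite /series/= big_mkord.
Qed.

Lemma coordD x y i : coord (x + y) i = coord x i + coord y i.
Proof.
suff -> : coord (x + y) = fun i => coord x i + coord y i by [].
apply: expansion_le => e e0; have e20 : 0 < e / 2 by lra.
have [Nx hx] := proj_cvg_lt x e20; have [Ny hy] := proj_cvg_lt y e20.
exists (maxn Nx Ny) => N; rewrite geq_max => /andP[/hx h1 /hy h2].
under eq_bigr do rewrite scalerDl.
rewrite big_split/= opprD addrACA; apply: le_lt_trans (ler_normD _ _) _.
by move: h1 h2; rewrite /proj; lra.
Qed.

Lemma coordZ t x i : coord (t *: x) i = t * coord x i.
Proof.
suff -> : coord (t *: x) = fun i => t * coord x i by [].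
apply: expansion_le => e e0.
have e20 : 0 < e / (`|t| + 1) by rewrite divr_gt0// ltr_wpDl.
have [N0 hx] := proj_cvg_lt x e20; exists N0 => N /hx h.
under eq_bigr do rewrite -scalerA.
rewrite -scaler_sumr -scalerBr normrZ; move: h; rewrite /proj ltr_pdivlMr ?ltr_wpDl//.
by apply: le_lt_trans; rewrite mulrC ler_wpM2l// lerDl.
Qed.

Lemma coord_finite N (a : nat -> R) i : coord (\sum_(i < N) a i *: b i) i = if (i < N)%N then a i else 0.
Proof.
suff -> : coord (\sum_(i < N) a i *: b i) = fun i => if (i < N)%N then a i else 0 by [].
apply: expansion_le => e e0; exists N => M NM.
suff -> : \sum_(j < M) (if (j < N)%N then a j else 0) *: b j = \sum_(j < N) a j *: b j.
  by rewrite subrr normr0.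
rewrite (big_ord_widen M (fun i => a i *: b i) NM) [RHS]big_mkcond.
by apply: eq_bigr => j _; case: ifP => // _; rewrite scale0r.
Qed.

Lemma projD N x y : proj N (x + y) = proj N x + proj N y.
Proof.
by rewrite /proj -big_split/=; apply: eq_bigr => i _; rewrite coordD scalerDl.
Qed.

Lemma projZ N t x : proj N (t *: x) = t *: proj N x.
Proof.
by rewrite /proj scaler_sumr; apply: eq_bigr => i _; rewrite coordZ scalerA.
Qed.

Lemma projN N x : proj N (- x) = - proj N x.
Proof. by rewrite -scaleN1r projZ scaleN1r. Qed.

Lemma projB N x y : proj N (x - y) = proj N x - proj N y.
Proof. by rewrite projD projN. Qed.

Lemma proj_sum N k (f : 'I_k -> X) : proj N (\sum_i f i) = \sum_i proj N (f i).
Proof.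
apply: (big_morph _ (projD N)).
by rewrite -(scale0r (0 : X)) projZ !scale0r.
Qed.

Lemma coord_proj N x i : coord (proj N x) i = if (i < N)%N then coord x i else 0.
Proof. exact: coord_finite. Qed.

Lemma projS n x : proj n.+1 x = proj n x + coord x n *: b n.
Proof. by rewrite /proj big_ord_recr. Qed.

Lemma basis_neq0 n : b n != 0.
Proof.
apply/eqP => bn0; have := coord_finite n.+1 (fun i => (i == n)%:R : R) n.
rewrite ltnSn eqxx big1 => [|i _].
  rewrite -(scale0r (0 : X)) coordZ mul0r => /eqP.
  by rewrite eq_sym oner_eq0.
by case: eqP => [->|_]; rewrite ?bn0 ?scaler0 ?scale0r.
Qed.

(* [sup_N `|proj N x|] is a complete norm; as in the open mapping theorem,
   Baire's theorem compares it with the original one. *)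
Lemma proj_bounded_approx : exists2 C, 0 < C & forall x e, 0 < e ->
  exists2 y, `|x - y| < e & forall N, `|proj N y| <= C * `|x|.
Proof.
pose A (m : nat) := [set x : X | forall N, `|proj N x| <= m%:R].
have Acover x : exists m, A m x.
  have [N0 h] := proj_cvg_lt x ltr01.
  pose B := `|x| + 1 + \sum_(i < N0) `|proj i x|.
  have S0 (D : pred 'I_N0) : 0 <= \sum_(i < N0 | D i) `|proj i x| by apply: sumr_ge0.
  have B0 : 0 <= B by rewrite addr_ge0// ?addr_ge0//; exact: S0.
  exists (Num.truncn B).+1 => N; apply: le_trans (ltW (truncnS_gt B)).
  have [NN|NN] := ltnP N N0.
    rewrite /B (bigD1 (Ordinal NN))//=; have := normr_ge0 x; have := S0 (fun i => i != Ordinal NN).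
    by lra.
  have := ler_normB x (x - proj N x); rewrite subKr; have := h _ NN.
  by rewrite /B; have := S0 xpredT; lra.
have [m [x0 [r r0 hr]]] : exists m x0, exists2 r, 0 < r &
    forall x, `|x - x0| < r -> closure (A m) x.
  apply: contrapT => nint.
  have : dense (\bigcap_m ~` closure (A m)).
    apply: Baire => m; split; first exact/closed_openC/closed_closure.
    move=> O [x0 Ox0] Oo; apply: contrapT => nO; apply: nint; exists m, x0.
    have /nbhs_ballP[r /= r0 hr] : nbhs x0 O by exact: open_nbhs_nbhs.
    exists r => // x xr; apply: contrapT => nx; apply: nO; exists x; split=> //.
    by apply: hr; rewrite -ball_normE /= distrC.
  move=> /(_ setT) [||x [_ hx]]; [by exists 0|exact: openT|].
  by have [m Am] := Acover x; apply: (hx m I); exact: subset_closure.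
(* The ball is moved from [x0] to 0: half the difference of approximants of [x0 + x] and [x0 - x]
   approximates [x], and [A m] is convex and symmetric. *)
have approx x e : `|x| < r -> 0 < e -> exists2 y, `|x - y| < e & A m y.
  move=> xr e0.
  have cl z : `|z| < r -> exists2 y, `|x0 + z - y| < e & A m y.
    move=> zr; have xz : `|x0 + z - x0| < r by rewrite addrC addKr.
    have [y [Ay hy]] := hr _ xz _ (nbhsx_ballx (x0 + z) e e0).
    by exists y => //; move: hy; rewrite -ball_normE.
  have [y1 h1 A1] := cl x xr.
  have [|y2 h2 A2] := cl (- x); first by rewrite normrN.
  exists (2^-1 *: (y1 - y2)).
    have xE : x0 + x - y1 - (x0 - x - y2) = (x + x) - (y1 - y2).
      rewrite -[x0 + x - y1]addrA -[x0 - x - y2]addrA opprD addrACA subrr add0r.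
      by rewrite opprD !opprK addrACA opprB [y2 - y1]addrC.
    have -> : x - 2^-1 *: (y1 - y2) = 2^-1 *: (x0 + x - y1 - (x0 - x - y2)).
      rewrite xE [RHS]scalerBr [X in _ = X - _]scalerDr -scalerDl (_ : 2^-1 + 2^-1 = 1 :> R) ?scale1r//.
      by lra.
    rewrite normrZ gtr0_norm ?invr_gt0//.
    by have := ler_normB (x0 + x - y1) (x0 - x - y2); lra.
  move=> N; rewrite projZ projB normrZ gtr0_norm ?invr_gt0//.
  by have := A1 N; have := A2 N; have := ler_normB (proj N y1) (proj N y2); lra.
exists (2 * m%:R / r + 1).
  by rewrite ltr_wpDl// divr_ge0// ?ltW// mulr_gt0.
move=> x e e0; have [->|x0'] := eqVneq x 0.
  exists 0; first by rewrite subrr normr0.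
  by move=> N; rewrite -(scale0r (0 : X)) projZ !scale0r normr0 mulr0.
have xn0 : 0 < `|x| by rewrite normr_gt0.
pose t := r / (2 * `|x|).
have t0 : 0 < t by rewrite divr_gt0// mulr_gt0.
have txE : t * `|x| = r / 2 by rewrite /t; field; rewrite gt_eqF.
have [||y yx Ay] := approx (t *: x) (t * e).
- by rewrite normrZ gtr0_norm// txE; lra.
- by rewrite mulr_gt0.
exists (t^-1 *: y).
  rewrite -(ltr_pM2l t0) -{1}(gtr0_norm t0) -normrZ scalerBr scalerA divff ?gt_eqF//.
  by rewrite scale1r.
move=> N; rewrite projZ normrZ gtr0_norm ?invr_gt0//.
have tV : t^-1 = 2 / r * `|x| by rewrite /t; field; rewrite !gt_eqF.
have : t^-1 * `|proj N y| <= t^-1 * m%:R by rewrite ler_pM2l ?invr_gt0.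
rewrite tV => h; apply: (le_trans h).
rewrite (_ : 2 / r * `|x| * m%:R = 2 * m%:R / r * `|x|); last by ring.
by rewrite ler_wpM2r// lerDl.
Qed.

(** Successive approximation: the bounds on the remainders halve, and their projections move by at
    most [C * h i], uniformly in the projection. The ultralimit [c] of their coordinates turns out
    to be an expansion of 0, so it vanishes by uniqueness, and comparing the first remainder [x]
    with this limit gives the bound. *)
Lemma proj_bounded_seq C : 0 < C ->
  (forall x e, 0 < e -> exists2 y, `|x - y| < e & forall N, `|proj N y| <= C * `|x|) ->
  forall x N, `|proj N x| <= 2 * C * `|x|.
Proof.
move=> C0 hC x N.
have [->|x0] := eqVneq x 0.
  by rewrite -(scale0r (0 : X)) projZ !scale0r normr0 mulr0.
have xn0 : 0 < `|x| by rewrite normr_gt0.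
pose h (i : nat) : R := `|x| / 2 ^+ i.
have h0 i : 0 < h i by rewrite divr_gt0// exprn_gt0.
have hS i : h i = 2 * h i.+1 by rewrite /h exprS; field; rewrite expf_neq0.
have : forall zi : X * nat, exists y,
    `|zi.1 - y| < h zi.2.+1 /\ forall N, `|proj N y| <= C * `|zi.1|.
  by move=> [z i]; have [y ? ?] := hC z _ (h0 i.+1); exists y.
move=> /choice[Y hY].
(* [r i] is what remains of [x] after [i] steps of the approximation. *)
pose r := fix r i := if i is j.+1 then r j - Y (r j, j) else x.
have rh i : `|r i| <= h i.
  case: i => [|i]; first by rewrite /h expr0 divr1.
  by apply/ltW; exact: (hY (r i, i)).1.
have step i M : `|proj M (r i) - proj M (r i.+1)| <= C * h i.
  rewrite /= projB subKr; apply: le_trans ((hY (r i, i)).2 M) _.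
  by rewrite ler_pM2l//=; exact: rh.
have tele i j M : `|proj M (r i) - proj M (r (i + j)%N)| <= 2 * C * (h i - h (i + j)%N).
  elim: j => [|j IH]; first by rewrite addn0 !subrr normr0 mulr0.
  have := ler_distD (proj M (r (i + j)%N)) (proj M (r i)) (proj M (r (i + j.+1)%N)).
  have := step (i + j)%N M; rewrite addnS; move: IH; rewrite (hS (i + j)%N); lra.
have near0 e : 0 < e -> exists k0, forall k, (k0 <= k)%N -> h k < e.
  move=> e0; exists (Num.truncn (`|x| / e)).+1 => k k0.
  rewrite /h ltr_pdivrMr ?exprn_gt0// mulrC -ltr_pdivrMr//.
  apply: (lt_le_trans (truncnS_gt _)); rewrite -natrX ler_nat.
  by apply: (leq_trans k0); rewrite ltnW// ltn_expl.
have [U [UU Uinf _]] := free_ultrafilter infinite_nat.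
have : forall n, exists c, forall e, 0 < e -> U [set k | `|coord (r k) n - c| < e].
  move=> n; apply: (@ultra_lim _ UU _ _ ((`|proj n.+1 x| + `|proj n x| + 4 * C * h 0%N) / `|b n|)).
  apply: filterS filterT => k _ /=.
  rewrite ler_pdivlMr ?normr_gt0 ?basis_neq0// -normrZ.
  have -> : coord (r k) n *: b n = proj n.+1 (r k) - proj n (r k).
    by rewrite projS addrC addKr.
  have := tele 0%N k n.+1; have := tele 0%N k n; rewrite add0n => t1 t2.
  have := ler_normB (proj n.+1 (r k)) (proj n (r k)).
  have := ler_normB (proj n.+1 x) (proj n.+1 x - proj n.+1 (r k)).
  have := ler_normB (proj n x) (proj n x - proj n (r k)); rewrite !subKr.
  have : 0 <= C * h k by rewrite mulr_ge0 ?ltW.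
  by move: t1 t2; rewrite /=; lra.
move=> /choice[c hc].
pose t N : X := \sum_(i < N) c i *: b i.
have close k M : `|t M - proj M (r k)| <= 2 * C * h k.
  apply/ler_addgt0Pr => e e0.
  pose B := \sum_(i < M) `|b i| + 1.
  have B0 : 0 < B by rewrite ltr_wpDl// sumr_ge0.
  have : U [set k' | forall i, i \in iota 0 M -> `|coord (r k') i - c i| < e / B].
    by apply: filter_all => i _; apply: hc; rewrite divr_gt0.
  move=> /(filterI (Uinf k))/filter_ex[k' [/= kk' hk']].
  have h1 : `|t M - proj M (r k')| <= e.
    rewrite /t /proj -sumrB; apply: (le_trans (ler_norm_sum _ _ _)).
    apply: (@le_trans _ _ (\sum_(i < M) (e / B) * `|b i|)).
      apply: ler_sum => i _; rewrite -scalerBl normrZ ler_wpM2r//.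
      by rewrite distrC; apply/ltW/hk'; rewrite mem_iota add0n/= ltn_ord.
    rewrite -mulr_sumr -mulrA ler_piMr ?(ltW e0)//.
    by rewrite mulrC ler_pdivrMr// mul1r /B lerDl.
  have := tele k (k' - k)%N M; rewrite subnKC// distrC => h2.
  have := ler_distD (proj M (r k')) (t M) (proj M (r k)).
  have : 0 <= C * h k' by rewrite mulr_ge0 ?ltW.
  by move: h1 h2; lra.
have c0 : coord 0 = c.
  apply: expansion_le => e e0.
  have C30 : 0 < 2 * C + 1 by lra.
  have [k0 hk0] : exists k0, forall k, (k0 <= k)%N -> h k < e / 2 / (2 * C + 1).
    by apply: near0; rewrite !divr_gt0.
  have hk := hk0 _ (leqnn _).
  have e20 : 0 < e / 2 by lra.
  have [N0 hN0] := proj_cvg_lt (r k0) e20.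
  exists N0 => M /hN0 hM; rewrite sub0r normrN.
  have := close k0 M; have := rh k0; rewrite -/(t M).
  have := ler_normD (t M - proj M (r k0)) (proj M (r k0)); rewrite subrK.
  have := ler_normB (r k0) (r k0 - proj M (r k0)); rewrite subKr.
  move: hk; rewrite ltr_pdivlMr// mulrDr mulr1; lra.
have := close 0%N N; rewrite /t -c0.
under eq_bigr => i _.
  have -> : coord 0 i = 0 by rewrite -(scale0r (0 : X)) coordZ mul0r.
  rewrite scale0r; over.
by rewrite big1// sub0r normrN /h expr0 divr1.
Qed.

Lemma proj_bounded : exists2 K, 0 < K & forall N x, `|proj N x| <= K * `|x|.
Proof.
have [C C0 hC] := proj_bounded_approx; exists (2 * C); first by lra.
by move=> N x; apply: proj_bounded_seq.
Qed.

Lemma coord_dual n : exists f : dual X, forall x, sval f x = coord x n.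
Proof.
have [K K0 hK] := proj_bounded.
have flin : linear_for *%R (fun x => coord x n).
  by move=> t u v; rewrite coordD coordZ.
pose F : {scalar X} := HB.pack (fun x => coord x n)
  (GRing.isLinear.Build R X R *%R (fun x => coord x n) flin).
have bn : 0 < `|b n| by rewrite normr_gt0 basis_neq0.
have Fabs x : `|coord x n| <= 2 * K / `|b n| * `|x|.
  rewrite mulrAC ler_pdivlMr// -normrZ.
  have -> : coord x n *: b n = proj n.+1 x - proj n x.
    by rewrite projS addrC addKr.
  have := ler_normB (proj n.+1 x) (proj n x); have := hK n x; have := hK n.+1 x; lra.
have Fc : continuous (F : X -> R).
  move=> x; apply/cvgrPdist_lt => d d0; near=> u.
  have -> : F x - F u = coord (x - u) n.
    by rewrite coordD -(scaleN1r u) coordZ mulN1r.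
  apply: le_lt_trans (Fabs _) _; rewrite mulrC -ltr_pdivlMr ?divr_gt0 ?mulr_gt0//.
  near: u; apply: (@cvgr_dist_lt _ _ _ _ _ id x); first exact: cvg_id.
  by rewrite divr_gt0// divr_gt0// mulr_gt0.
by exists (exist _ F Fc).
Unshelve. all: end_near. Qed.

(** A projection of finite rank sees finitely many coordinate functionals, so after it weak
    convergence becomes norm convergence. *)
Lemma proj_weak (U : set_system nat) (g : nat -> X) (y : X) N : UltraFilter U ->
  (forall (f : dual X) e, 0 < e -> U [set n | `|sval f (g n) - sval f y| < e]) ->
  forall e, 0 < e -> U [set n | `|proj N (g n - y)| < e].
Proof.
move=> UU hg e e0.
pose B := \sum_(i < N) `|b i| + 1.
have B0 : 0 < B by rewrite ltr_wpDl// sumr_ge0.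
have : U [set n | forall i, i \in iota 0 N -> `|coord (g n) i - coord y i| < e / B].
  apply: filter_all => i _; have [f hf] := coord_dual i.
  by rewrite -!hf; under eq_fun do rewrite -!hf; apply: hg; rewrite divr_gt0.
apply: filterS => n hn /=; apply: (le_lt_trans (ler_norm_sum _ _ _)).
apply: (@le_lt_trans _ _ (\sum_(i < N) (e / B) * `|b i|)).
  apply: ler_sum => i _; rewrite normrZ ler_wpM2r// coordD -scaleN1r coordZ mulN1r.
  by apply/ltW/hn; rewrite mem_iota add0n/= ltn_ord.
rewrite -mulr_sumr -mulrA gtr_pMr//.
by rewrite mulrC ltr_pdivrMr// mul1r /B ltrDl.
Qed.

End Schauder.

(** * Iterated weak limits *)

Section WeakLimits.
Variables (R : realType) (X : normedModType R).
Variables (E : seq nat -> Prop) (hE : front E).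
Variables (U : set_system nat) (UU : UltraFilter U).
Hypothesis Uinf : forall n0, U [set n | (n0 <= n)%N].
Local Notation T := (initials E).
Local Notation state := (seq (seq nat)).
Local Notation gen := (gen E U).

Definition weak_lim (g : nat -> X) (y : X) : Prop :=
  forall (f : dual X) (e : R), 0 < e -> U [set n | `|sval f (g n) - sval f y| < e].

Lemma cvg_weak_space (F : set_system X) (y : X) (f : dual X) (e : R) : Filter F ->
  (F : set_system (weak_space X)) --> (y : weak_space X) -> 0 < e ->
  F [set z | `|sval f z - sval f y| < e].
Proof.
move=> FF /cvg_sup-/(_ f) Fy e0; apply: Fy.
have := @initial_continuous X R (sval f : X -> R) y.
move=> /cvgrPdist_lt/(_ e e0); apply: filterS => z /=.
by rewrite distrC.
Qed.

Lemma ultra_fmap (Y : Type) (g : nat -> Y) : UltraFilter (g @ U).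
Proof.
split; first exact: fmap_proper_filter.
move=> G GF UG; apply/seteqP; split=> // A GA.
have [//|UnA] := in_ultra_setVsetC (g @^-1` A) UU.
have GnA : G (~` A) by apply: UG.
by have [y []] := filter_ex (filterI GA GnA).
Qed.

Lemma weak_lim_ex (K : set X) (g : nat -> X) : compact (K : set (weak_space X)) ->
  U [set n | K (g n)] -> exists2 y, K y & weak_lim g y.
Proof.
rewrite compact_ultra => Kc Kg.
have [y [Ky yl]] := Kc _ (@ultra_fmap (weak_space X) g) Kg.
exists y => // f e e0.
exact: (@cvg_weak_space (g @ U) y f e _ yl e0).
Qed.

(** Well-founded recursion from the members of [E] towards the root; the limits exist because all
    values stay in the weakly compact set [K]. *)
Lemma iterated_weak_limit (K : set X) (x : seq nat -> X) :
  compact (K : set (weak_space X)) -> (forall u, E u -> K (x u)) ->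
  exists phi : seq nat -> X, (forall u, E u -> phi u = x u) /\
    forall t, T t -> ~ E t -> weak_lim (fun n => phi (rcons t n)) (phi t).
Proof.
move=> Kc Kx.
pose r (u t : seq nat) := T u /\ exists n, u = rcons t n.
(* The inner default 0 is met by no [n] from some [n0] on, and the outer one at no node of the tree,
   where a weak limit exists by induction. *)
pose F t (rec : forall u, r u t -> X) : X :=
  if pselect (E t) then x t else xget 0 [set y | K y /\ weak_lim (fun n =>
    if pselect (r (rcons t n) t) is left h then rec _ h else 0) y].
pose phi := Fix (front_wf hE) (fun=> X) F.
have phiE t : phi t = F t (fun u _ => phi u).
  rewrite /phi Fix_eq// => {}t f g fg; congr F.
  by apply/functional_extensionality_dep => u; apply/functional_extensionality_dep => h.
have phi_x u : E u -> phi u = x u by rewrite phiE /F; case: pselect.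
have phi_w t : T t -> ~ E t -> K (phi t) /\ weak_lim (fun n => phi (rcons t n)) (phi t).
  elim/(well_founded_ind (front_wf hE)) : t => t IH Tt nEt.
  have [n0 hn0] := initials_extend hE Tt nEt.
  pose g n := if pselect (r (rcons t n) t) is left _ then phi (rcons t n) else 0.
  have gE n : (n0 <= n)%N -> g n = phi (rcons t n).
    by move=> /hn0 Tn; rewrite /g; case: pselect => // -[]; split=> //; exists n.
  have [|y Ky yl] := @weak_lim_ex K g Kc.
    apply: filterS (Uinf n0) => n /= nn; rewrite gE//.
    have [/[dup] En /phi_x ->|nE] := pselect (E (rcons t n)); first exact: Kx.
    by apply: (IH _ _ (hn0 _ nn) nE).1; split; [exact: hn0|exists n].
  have [Kp pl] : K (phi t) /\ weak_lim g (phi t).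
    have -> : phi t = xget 0 [set y | K y /\ weak_lim g y].
      by rewrite phiE /F; case: (pselect (E t)).
    exact: (@xgetI _ 0 [set y | K y /\ weak_lim g y] y (conj Ky yl)).
  split=> // f e e0; apply: filterS (filterI (Uinf n0) (pl f e e0)) => n [/= nn].
  by rewrite gE.
by exists phi; split=> // t Tt nEt; exact: (phi_w _ Tt nEt).2.
Qed.

Variable phi : seq nat -> X.
Hypothesis phi_lim : forall t, T t -> ~ E t -> weak_lim (fun n => phi (rcons t n)) (phi t).

(* The payoff [`|h t + a *: phi (tok t j)|] is a convex continuous, hence weakly
   lower semicontinuous, function of [phi (tok t j)]. *)
Lemma gen_freeze (h : state -> X) (a c : R) j (s : state) (e : R) : 0 < e ->
  (forall t u, h (set_nth [::] t j u) = h t) -> (j < size s)%N ->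
  gen (fun t => `|h t + a *: phi (tok t j)| < c) s ->
  gen (fun t => `|h t + a *: phi (tok s j)| < c + e) s.
Proof.
move=> e0 hj js g.
suff: forall s, bar E U s -> forall e, 0 < e -> (j < size s)%N ->
    gen (fun t => `|h t + a *: phi (tok t j)| < c) s ->
    gen (fun t => `|h t + a *: phi (tok s j)| < c + e) s.
  by move=> /(_ s (gen_bar g) e e0 js g).
move: s e {e0 js g} => _ _ s; elim=> {s}.
  move=> s d _ e e0 js /gen_done/(_ d) hs; left=> //.
  by apply: (lt_trans hs); rewrite ltrDl.
move=> s i A ti UA hA IH e e0 js g; have [ik Ti nEi _] := ti.
have [ji|ij] := eqVneq j i; last first.
  apply: (gen_near ti); apply: filterS (filterI UA (gen_push UU g ti)) => n [An gn].
  have := IH n An e e0; rewrite size_push// tok_push (negbTE ij).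
  by apply.
subst i; have e20 : 0 < e / 2 by lra.
(* The payoff with a fixed vector [y] ignores place [j], so it can be judged at [s] itself; by
   induction and [gen_indep], [D] contains [U]-almost all one-step values. *)
pose D := [set y | gen (fun t => `|h t + y| < c + e / 2) s].
have UD : U [set n | D (a *: phi (rcons (tok s j) n))].
  apply: filterS (filterI UA (gen_push UU g ti)) => n [An gn].
  have := IH n An _ e20; rewrite size_push// tok_push eqxx => /(_ js gn) g'.
  apply: (gen_indep UU _ js Ti _ g').
    by apply: (GenTurn ti UA) => m Am; apply: gen_bar (hA _ Am).
  by move=> t v; rewrite hj.
(* Mazur's argument: a functional separating the convex set [D] from the weak limit of its points
   would contradict weak convergence. *)
have [y Dy yl] : exists2 y, D y & `|y - a *: phi (tok s j)| < e / 2.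
  apply: contrapT => nD.
  have D0 : D !=set0.
    by have [n Dn] := filter_ex UD; exists (a *: phi (rcons (tok s j) n)).
  have [||f hf] := @separation R X D (a *: phi (tok s j)) (e / 2) D0.
  - move=> u v t Du Dv /andP[t0 t1].
    apply: gen_mono (gen_and UU Du Dv) => w [hu hv].
    have -> : h w + (t *: u + (1 - t) *: v) = t *: (h w + u) + (1 - t) *: (h w + v).
      by rewrite !scalerDr addrACA -scalerDl (addrC t) subrK scale1r.
    apply: le_lt_trans (ler_normD _ _) _; rewrite !normrZ !ger0_norm ?subr_ge0//.
    have [->|t0'] := eqVneq t 0; first by rewrite mul0r add0r subr0 mul1r.
    have tp : 0 < t by rewrite lt_def t0'.
    have : t * `|h w + u| < t * (c + e / 2) by rewrite ltr_pM2l.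
    have : (1 - t) * `|h w + v| <= (1 - t) * (c + e / 2).
      by rewrite ler_wpM2l ?subr_ge0// ltW.
    by lra.
  - by move=> z Dz; rewrite leNgt; apply/negP => zl; apply: nD; exists z.
  have e2a : 0 < e / 2 / (`|a| + 1) by rewrite divr_gt0// ltr_wpDl.
  have := phi_lim Ti nEi f e2a.
  move=> /(filterI UD)/filter_ex[n [/hf]].
  rewrite -scalerBr linearZ/= linearB/= ltr_pdivlMr ?ltr_wpDl// => h1 h2.
  have := ler_norm (- (a * (sval f (phi (rcons (tok s j) n)) - sval f (phi (tok s j))))).
  rewrite normrN normrM; move: h1 h2; set w := `|_ - _|.
  have : `|a| * w <= w * (`|a| + 1) by rewrite mulrDr mulr1 mulrC lerDl /w.
  by move=> ? ? ? ?; lra.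
apply: gen_mono Dy => t ht.
have -> : h t + a *: phi (tok s j) = (h t + y) - (y - a *: phi (tok s j)).
  by rewrite opprB addrA addrAC addrK.
by apply: le_lt_trans (ler_normB _ _) _; lra.
Qed.

(** The [k] places are frozen one after the other, at a cost of [e] each. *)
Lemma gen_freeze_nil k (c e : R) : 0 < e ->
  gen (fun t => `|\sum_(j < k) phi (tok t j)| < c) (start k) ->
  `|phi [::]| *+ k < c + e *+ k.
Proof.
move=> e0 g.
have : forall m, (m <= k)%N -> gen (fun t => `|\sum_(j < k)
    (if (j < m)%N then phi [::] else phi (tok t j))| < c + e *+ m) (start k).
  elim=> [_|m IH mk].
    by apply: gen_mono g => t; rewrite mulr0n addr0.
  pose i0 := Ordinal mk.
  pose h (t : state) := \sum_(j < k | j != i0) (if (j < m)%N then phi [::] else phi (tok t j)).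
  have hi0 t : \sum_(j < k) (if (j < m)%N then phi [::] else phi (tok t j)) =
      h t + 1 *: phi (tok t m).
    by rewrite (bigD1 i0)//= ltnn scale1r addrC.
  have hj t u : h (set_nth [::] t m u) = h t.
    apply: eq_bigr => j ji; rewrite tok_set.
    by have /negbTE -> : (j : nat) != m by exact: ji.
  have := @gen_freeze h 1 (c + e *+ m) m (start k) e e0 hj.
  rewrite size_nseq => /(_ mk) g'; rewrite mulrSr addrA.
  apply: gen_mono (g' _) => [t|].
    rewrite tok_start scale1r (bigD1 i0)//= ltnSn addrC.
    suff -> : h t = \sum_(j < k | j != i0)
        (if (j < m.+1)%N then phi [::] else phi (tok t j)) by [].
    apply: eq_bigr => j ji; rewrite ltnS [in RHS]leq_eqVlt.
    by have /negbTE -> : (j : nat) != m by exact: ji.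
  by apply: gen_mono (IH (ltnW mk)) => t; rewrite hi0.
move=> /(_ k (leqnn _)) /(gen_ex UU)[t].
rewrite (eq_bigr (fun=> phi [::])); last by move=> j _; rewrite ltn_ord.
by rewrite sumr_const card_ord normrMn.
Qed.

(** Only proper initial segments are tested; if none satisfies [D] the value is [size u], and
    nothing is cut off. *)
Definition stop (D : seq nat -> Prop) u : nat :=
  find (fun i => `[< D (take i u) >]) (iota 0 (size u)).

Lemma stop_le D u : (stop D u <= size u)%N.
Proof. by rewrite -[X in (_ <= X)%N](size_iota 0) find_size. Qed.

Lemma stop_lt D u i : (i < stop D u)%N -> ~ D (take i u).
Proof.
move=> h; have iu : (i < size u)%N by apply: leq_trans h (stop_le _ _).
by have := before_find 0%N h; rewrite nth_iota// add0n => /asboolP.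
Qed.

Lemma stopP D u : (stop D u < size u)%N -> D (take (stop D u) u).
Proof.
move=> h; have : has (fun i => `[< D (take i u) >]) (iota 0 (size u)).
  by rewrite has_find size_iota.
by move=> /(nth_find 0%N); rewrite nth_iota// add0n => /asboolP.
Qed.

Lemma stop_uniq D u i : (i <= size u)%N -> (forall m, (m < i)%N -> ~ D (take m u)) ->
  (i < size u)%N -> D (take i u) -> stop D u = i.
Proof.
move=> iu hm iu' Di; apply/eqP; rewrite eqn_leq; apply/andP; split.
  by rewrite leqNgt; apply/negP => /stop_lt.
rewrite leqNgt; apply/negP => si; apply: (hm _ si); apply: stopP.
exact: ltn_trans si iu'.
Qed.

Lemma stop_size D u : (forall m, (m < size u)%N -> ~ D (take m u)) -> stop D u = size u.
Proof.
move=> hm; apply/eqP; rewrite eqn_leq stop_le leqNgt; apply/negP => h.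
exact: (hm _ h (stopP h)).
Qed.

Definition stopped D u : seq nat := take (stop D u) u.

Definition alive (D : seq nat -> Prop) u : Prop :=
  forall i, (i <= size u)%N -> ~ D (take i u).

Lemma stopped_alive D u : alive D u -> stopped D u = u.
Proof. by move=> h; rewrite /stopped stop_size ?take_size// => m /ltnW; exact: h. Qed.

Lemma stopped_first D u n v : alive D u -> D (rcons u n) -> prefix (rcons u n) v ->
  stopped D v = rcons u n.
Proof.
move=> hu Dn /prefixP[w ->]; rewrite /stopped.
have hm m : (m < (size u).+1)%N -> ~ D (take m (rcons u n ++ w)).
  move=> mu; rewrite takel_cat ?size_rcons 1?ltnW// -cats1 takel_cat//.
  exact: hu.
have szE : size (rcons u n ++ w) = ((size u).+1 + size w)%N.
  by rewrite size_cat size_rcons.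
case: w hm szE => [|x w] hm szE.
  rewrite cats0 in hm *; rewrite stop_size ?take_size// => m.
  by rewrite size_rcons; exact: hm.
have -> : stop D (rcons u n ++ x :: w) = (size u).+1.
  apply: stop_uniq => //; rewrite ?szE ?leq_addr//; first by rewrite /=; lia.
  by rewrite -(size_rcons u n) take_size_cat.
by rewrite -(size_rcons u n) take_size_cat.
Qed.

(** The mask [m] marks the sets still running and [h] collects the rest. When set [i] enters [D],
    [gen_freeze] moves its term into [h] for half of the tolerance, and the other half is left for
    the remaining sets. *)
Lemma gen_stop (D : seq nat -> Prop) k (a : nat -> R) (s : state) :
  bar E U s -> size s = k ->
  forall (m : pred nat) (h : state -> X) (c e : R), 0 < e ->
  (forall j, m j -> forall t u, h (set_nth [::] t j u) = h t) ->
  (forall j, (j < k)%N -> m j -> alive D (tok s j)) ->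
  gen (fun t => `|h t + \sum_(j < k | m j) a j *: phi (tok t j)| < c) s ->
  gen (fun t => `|h t + \sum_(j < k | m j) a j *: phi (stopped D (tok t j))| < c + e) s.
Proof.
elim=> {s} [s d _ sk m h c e e0 hm live /gen_done/(_ d) hs|].
  left=> //; rewrite (eq_bigr (fun j : 'I_k => a j *: phi (tok s j))).
    by apply: (lt_trans hs); rewrite ltrDl.
  by move=> j mj; rewrite stopped_alive//; exact: live.
move=> s i A ti UA hA IH sk m h c e e0 hm live g; have [ik Ti nEi _] := ti.
apply: (gen_near ti); apply: filterS (filterI UA (gen_push UU g ti)) => n [An gn].
have sp : size (push s i n) = k by rewrite size_push.
have [[mi Di]|nD] := pselect (m i /\ D (rcons (tok s i) n)); last first.
  apply: IH => // j jk mj; rewrite tok_push; case: eqP => [ji|_]; last exact: live.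
  have li := live i; rewrite -sk in li.
  subst j => p; rewrite size_rcons leq_eqVlt => /predU1P[->|pi].
    by rewrite -(size_rcons (tok s i) n) take_size => Di; apply: nD.
  rewrite -cats1 takel_cat//; exact: li.
have ik' : (i < k)%N by rewrite -sk.
pose i0 := Ordinal ik'.
have split_i (b : nat -> X) (t : state) :
    \sum_(j < k | m j) b j = \sum_(j < k | m j && (j != i :> nat)) b j + b i.
  rewrite (bigD1 i0)//= addrC; congr (_ + _); exact: eq_bigl.
pose h1 t := h t + \sum_(j < k | m j && (j != i :> nat)) a j *: phi (tok t j).
have g1 : gen (fun t => `|h1 t + a i *: phi (tok t i)| < c) (push s i n).
  apply: gen_mono gn => t.
  by rewrite (split_i (fun j => a j *: phi (tok t j)))// addrA.
have e20 : 0 < e / 2 by lra.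
have hi1 t u : h1 (set_nth [::] t i u) = h1 t.
  rewrite /h1 hm//; congr (_ + _); apply: eq_bigr => j /andP[_ ji].
  by rewrite tok_set (negbTE ji).
have g2 : gen (fun t => `|h1 t + a i *: phi (rcons (tok s i) n)| < c + e / 2) (push s i n).
  by have := gen_freeze e20 hi1 _ g1; rewrite sp tok_push eqxx; apply.
pose h2 t := h t + a i *: phi (rcons (tok s i) n).
have g3 : gen (fun t => `|h2 t + \sum_(j < k | m j && (j != i :> nat))
    a j *: phi (stopped D (tok t j))| < c + e / 2 + e / 2) (push s i n).
  apply: (IH n An sp (fun j => m j && (j != i)) h2 (c + e / 2) (e / 2) e20).
  - by move=> j /andP[mj _] t u; rewrite /h2 hm.
  - by move=> j jk /andP[mj ji]; rewrite tok_push (negbTE ji); exact: live.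
  - apply: gen_mono g2 => t; rewrite /h1 /h2.
    by rewrite -addrA [_ + a i *: _]addrC addrA.
rewrite /=; apply: gen_mono (gen_prefix g3) => t [ht st pt].
have := pt i; rewrite tok_push eqxx => pi.
rewrite (split_i (fun j => a j *: phi (stopped D (tok t j))))//.
rewrite (stopped_first (live _ ik' mi) Di pi); move: ht.
by rewrite /h2 -[c + _ + _]addrA -splitr -addrA [a i *: _ + _]addrC.
Qed.

End WeakLimits.

Section Utilities.
Variables (R : realType) (X : normedModType R).

(* A convex function on a cube is maximal at a vertex. *)
Lemma sign_bound k (y : nat -> X) (v : X) (C : R) :
  (forall eps, eps \in words [:: 1; -1 : R] k ->
    `|v + \sum_(j < k) eps`_j *: y j| <= C) ->
  forall a : nat -> R, (forall j, `|a j| <= 1) ->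
  `|v + \sum_(j < k) a j *: y j| <= C.
Proof.
elim: k y v => [|k IH] y v h a ha.
  by have := h [::]; rewrite !big_ord0; apply.
rewrite big_ord_recl addrA.
apply: (IH (fun j => y j.+1) _ _ (fun j => a j.+1)) => // eps heps.
set S := \sum_(j < k) _.
have hs e : e \in [:: 1; -1 : R] -> `|v + e *: y 0%N + S| <= C.
  move=> he; have em : e :: eps \in words [:: 1; -1 : R] k.+1.
    move: heps; rewrite !mem_words => /andP[se ae]; apply/andP; split=> //.
    by apply/andP.
  by have := h _ em; rewrite big_ord_recl /= addrA.
have h1 := hs 1 (mem_head _ _); have h2 : `|v + (-1) *: y 0%N + S| <= C.
  by apply: hs; rewrite !inE eqxx orbT.
have -> : v + a 0%N *: y 0%N + S = ((1 + a 0%N) / 2) *: (v + 1 *: y 0%N + S) +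
    ((1 - a 0%N) / 2) *: (v + (-1) *: y 0%N + S).
  rewrite !scalerDr !scalerA addrACA; congr (_ + _); last first.
    by rewrite -scalerDl -[LHS]scale1r; congr (_ *: _); lra.
  rewrite addrACA -(scalerDl v) -(scalerDl (y 0%N)) -[in LHS](scale1r v); congr (_ *: _ + _ *: _); lra.
have := ha 0%N; rewrite ler_norml => /andP[a1 a2].
have nz t (z : X) : 0 <= t -> `|t *: z| = t * `|z| by move=> t0; rewrite normrZ ger0_norm.
apply: le_trans (ler_normD _ _) _; rewrite (nz ((1 + _) / 2)) ?(nz ((1 - _) / 2)); try lra.
have p1 : (1 + a 0%N) / 2 * `|v + 1 *: y 0%N + S| <= (1 + a 0%N) / 2 * C.
  by rewrite ler_wpM2l//; lra.
have p2 : (1 - a 0%N) / 2 * `|v + (-1) *: y 0%N + S| <= (1 - a 0%N) / 2 * C.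
  by rewrite ler_wpM2l//; lra.
by lra.
Qed.

End Utilities.

(** * Plegma tuples along a sequence *)

Section PlegmaSequences.
Local Open Scope nat_scope.
Variables (E : seq nat -> Prop) (hE : front E).
Local Notation T := (initials E).

Lemma plegmas_mkseq (A : nat -> nat -> nat) (p : nat -> nat) k :
  (forall i j c, i < j -> j < k -> A i c < A j c) ->
  (forall i j c, i < k -> j < k -> A i c < A j c.+1) ->
  plegmas (mkseq (fun j => mkseq (A j) (p j)) k).
Proof.
move=> h1 h2 i j c; rewrite size_mkseq => ik jk.
rewrite /tok (nth_mkseq _ _ ik) (nth_mkseq _ _ jk) !size_mkseq; split=> [ij ci cj|ci cj].
  by rewrite !nth_mkseq//; exact: h1.
by rewrite !nth_mkseq//; exact: h2.
Qed.

Lemma plegmas_pair s i j : plegmas s -> i < j -> j < size s ->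
  plegmas [:: tok s i; tok s j].
Proof.
move=> ps ij js; have is_ := ltn_trans ij js.
have nn := ltnn.
move=> [|[|a]] [|[|b]] c //= _ _; rewrite /tok/=; split=> //.
- exact: (ps i i c is_ is_).2.
- by move=> _; apply: (ps i j c is_ js).1.
- exact: (ps i j c is_ js).2.
- exact: (ps j i c js is_).2.
- exact: (ps j j c js js).2.
Qed.

Lemma mem_words_sorted (l : nat -> nat) t c : (forall i j, i < j -> l i < l j) ->
  sorted ltn t -> (forall y, y \in t -> exists2 i, i < c & y = l i) ->
  t \in words_upto (mkseq l c) c.
Proof.
move=> lmono st ht; have sub : {subset t <= mkseq l c}.
  by move=> y /ht[i ic ->]; apply/mapP; exists i; rewrite ?mem_iota.
apply: mem_words_upto => //; rewrite -[X in (_ <= X)%N](size_mkseq l c).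
by apply: uniq_leq_size => //; exact: (sorted_uniq ltn_trans ltnn st).
Qed.

(** Spreading admits only large enough next elements; along such an [l] every later term is
    admissible, so members of [E] are found by walking along any subsequence. *)
Definition extendable (l : nat -> nat) : Prop := forall t c, T t -> ~ E t ->
  (forall y, y \in t -> exists2 i, i < c & y = l i) -> T (rcons t (l c)).

Lemma extendable_comp l h : extendable l -> (forall i j, i < j -> h i < h j) ->
  extendable (l \o h).
Proof.
move=> el hmono t c Tt nEt ht; apply: el => // y /ht[i ic ->].
by exists (h i) => //; exact: hmono.
Qed.

Lemma extendable_front l : extendable l -> (forall i j, i < j -> l i < l j) ->
  exists p, E (mkseq l p).
Proof.
move=> el lmono; apply: front_walk => // i Ti nEi; rewrite mkseqS; apply: el => //.
by move=> y /mapP[j]; rewrite mem_iota /= add0n => ji ->; exists j.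
Qed.

(* Arithmetic progressions of indices with common difference [k.+1] interlace,
   hence at most [k.+1] consecutive ones give a plegma tuple. *)
Lemma plegma_family l k N : extendable l -> (forall i j, i < j -> l i < l j) ->
  exists p : nat -> nat,
    (forall j, E (mkseq (fun i => l (k.+1 * i + j + N)) (p j))) /\
    forall d n, n <= k.+1 ->
    plegmas (mkseq (fun j => mkseq (fun i => l (k.+1 * i + (d + j) + N)) (p (d + j))) n).
Proof.
move=> el lmono.
have : forall j, exists p, E (mkseq (fun i => l (k.+1 * i + j + N)) p).
  move=> j; apply: (@extendable_front (l \o (fun i => k.+1 * i + j + N))).
    by apply: extendable_comp => // i i' ii; rewrite !ltn_add2r ltn_pmul2l.
  by move=> i i' ii; apply: lmono; rewrite !ltn_add2r ltn_pmul2l.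
move=> /choice[p hp]; exists p; split=> // d n dn.
have := @plegmas_mkseq (fun j i => l (k.+1 * i + (d + j) + N)) (fun j => p (d + j)) n.
apply=> i j c.
  by move=> ij jn; apply: lmono; lia.
by move=> ik jk; apply: lmono; rewrite mulnS; lia.
Qed.

End PlegmaSequences.

(** * Extraction of blocks *)

Section Thresholds.
Variables (R : realType) (X : normedModType R).
Variables (E : seq nat -> Prop) (hE : front E).
Variables (U : set_system nat) (UU : UltraFilter U).
Hypothesis Uinf : forall n0, U [set n | (n0 <= n)%N].
Local Notation T := (initials E).
Local Notation state := (seq (seq nat)).
Local Notation gen := (gen E U).
Variable phi : seq nat -> X.
Hypothesis phi_lim : forall t, T t -> ~ E t -> weak_lim U (fun n => phi (rcons t n)) (phi t).
Variables (C c : R).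
Hypothesis c0 : 0 < c.
Hypothesis up : forall k (a : nat -> R), (forall j, `|a j| <= 1) ->
  gen (fun t => `|\sum_(j < k) a j *: phi (tok t j)| < C) (start k).

Lemma bound_gt0 : 0 < C.
Proof.
have := @up 0 (fun=> 0); rewrite normr0 => /(_ (fun=> ler01))/(gen_ex UU)[t].
by rewrite big_ord0 normr0.
Qed.

(* Freezing [k] sequences at their start bounds [k * `|phi [::]|] by [C], up to a
   small multiple of [k]. *)
Lemma limit_nil : phi [::] = 0.
Proof.
apply/eqP; rewrite -normr_eq0; apply: contraT => p0.
have {}p0 : 0 < `|phi [::]| by rewrite lt_def p0 normr_ge0.
have e20 : 0 < `|phi [::]| / 2 by lra.
have h k : `|phi [::]| *+ k < C + (`|phi [::]| / 2) *+ k.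
  apply: (gen_freeze_nil UU phi_lim e20).
  have := @up k (fun=> 1); rewrite normr1 => /(_ (fun=> lexx _)).
  by apply: gen_mono => t; under eq_bigr do rewrite scale1r.
have := h (Num.truncn (C / (`|phi [::]| / 2))).+1.
have := truncnS_gt (C / (`|phi [::]| / 2)).
rewrite ltr_pdivrMr// -[X in X < C + _ -> _]mulr_natl -[X in C + X]mulr_natl.
by move: (_.+1%:R) => z; lra.
Qed.

Lemma gen_stopped D k (a : nat -> R) : (forall j, `|a j| <= 1) ->
  gen (fun t => `|\sum_(j < k) a j *: phi (stopped D (tok t j))| < C + 1) (start k).
Proof.
(* If [D] holds at the empty set, every term stops there, where [phi] vanishes; otherwise all sets
   start alive and [gen_stop] applies. *)
move=> ha; have [D0|nD0] := pselect (D [::]).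
  apply: gen_mono (bar_start hE Uinf k) => t _.
  rewrite big1 => [|j _]; first by rewrite normr0 addr_gt0// bound_gt0.
  suff -> : stopped D (tok t j) = [::] by rewrite limit_nil scaler0.
  rewrite /stopped; have := @stop_lt D (tok t j) 0%N; rewrite take0.
  by case: (stop D _) => [|m]; rewrite ?take0// => /(_ isT).
have := @gen_stop R X E U UU phi phi_lim D k a (start k)
  (bar_start hE Uinf k) (size_nseq _ _) xpredT (fun=> 0) C 1 ltr01.
move=> h; apply: gen_mono (h _ _ _) => //.
- by move=> t; rewrite add0r.
- by move=> j _ _ i; rewrite tok_start leqn0 => /eqP ->.
- by apply: gen_mono (up k ha) => t; rewrite add0r.
Qed.

Definition level (n : nat) : R := c / 2 ^+ n.+1.

Lemma level_gt0 n : 0 < level n.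
Proof. by rewrite divr_gt0// exprn_gt0. Qed.

Lemma levelS n : level n = 2 * level n.+1.
Proof. by rewrite /level (exprS _ n.+1) invfM mulrCA [2 * _]mulrA divff ?mul1r// pnatr_eq0. Qed.

(** Even level 0 is below [c], so a member whose vector has norm at least [c] cannot be reached
    without a jump. *)
Lemma level_lt n : level n < c.
Proof.
rewrite /level ltr_pdivrMr ?exprn_gt0// ltr_pMr//.
by rewrite exprn_egt1// ltr1n.
Qed.

Definition jumps n t : Prop := U [set i | level n <= `|phi (rcons t i)|].

Definition rk n u : nat := stop (jumps n) u.

Lemma jumpsS n t : jumps n t -> jumps n.+1 t.
Proof.
apply: filterS => i /=; apply: le_trans; rewrite (levelS n).
by have := level_gt0 n.+1; lra.
Qed.

Lemma rkS n u : (rk n.+1 u <= rk n u)%N.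
Proof.
rewrite leqNgt; apply/negP => h.
have Dn : jumps n (take (rk n u) u).
  exact: stopP (leq_trans h (stop_le _ _)).
exact: (stop_lt h (jumpsS Dn)).
Qed.

Lemma gen_size Q k : gen Q (start k) -> gen (fun t => Q t /\ size t = k) (start k).
Proof. by move=> /gen_prefix; apply: gen_mono => t [? + _]; rewrite size_nseq. Qed.

(* Along a sequence [s_0, s_1, ...] whose consecutive terms are plegma pairs,
   [rk m (s_m)] cannot decrease for ever. *)
Lemma rk_nondecreasing_ex :
  exists n, gen (fun t => (rk n (tok t 0) <= rk n.+1 (tok t 1))%N) (start 2).
Proof.
apply: contrapT => nn.
have hn n : gen (fun t => ~ (rk n (tok t 0) <= rk n.+1 (tok t 1))%N) (start 2).
  pose Q t := (rk n (tok t 0) <= rk n.+1 (tok t 1))%N.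
  have [h|//] := gen_ultra UU Q (bar_start hE Uinf 2).
  by case: nn; exists n.
pose Q m t := (2 <= m)%N -> size t = 2 -> ~ (rk m (tok t 0) <= rk m.+1 (tok t 1))%N.
have hQ m k : (k <= m)%N -> gen (Q m) (start k).
  move=> _; have [->|k2] := eqVneq k 2; first by apply: gen_mono (hn m) => t h _ _.
  apply: gen_mono (gen_size (bar_start hE Uinf k)) => t [_ st] _ s2.
  by move: k2; rewrite -st s2 eqxx.
pose P u i := forall t, t \in words_upto u (size u) -> T t /\ ~ E t -> T (rcons t i).
have hP u : U [set i | P u i].
  apply: (filter_all UU) => t _; have [[Tt nEt]|nt] := pselect (T t /\ ~ E t).
    by have [n0 h] := initials_extend hE Tt nEt; apply: filterS (Uinf n0) => i /h Ti _.
  by apply: filterS filterT => i _ /nt.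
have [l [lmono _ lP lQ]] := homogeneous hE UU Uinf hQ hP filterT.
have el : extendable E l.
  move=> t i Tt nEt ht; apply: (lP i) => //; rewrite size_mkseq.
  by apply: mem_words_sorted => //; exact: initials_sorted Tt.
have [p [hp ps]] := plegma_family hE 1 2 el lmono.
(* Consecutive terms form plegma pairs with entries of index at least [j.+2], so homogeneity applies
   to them at level [j.+2]; the level index rises with [j] while the rank drops. *)
pose s j := mkseq (fun i => l (2 * i + j + 2)%N) (p j).
have dec j : (rk j.+3 (s j.+1) < rk j.+2 (s j))%N.
  rewrite ltnNge; apply/negP; have := lQ j.+2 _ _ (ps j 2%N isT).
  rewrite /Q /mkseq/= /tok/= !addn0 !addn1 => h; apply: h => //.
  - by move=> [|[|//]] _; exact: hp.
  - move=> [|[|//]] x _ /mapP[i _ ->]; [exists (2 * i + j + 2)%N|exists (2 * i + j.+1 + 2)%N] => //; lia.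
have : forall j, (rk j.+2 (s j) + j <= rk 2 (s 0))%N.
  by elim=> [|j IH]; [rewrite addn0|have := dec j; lia].
by move=> /(_ (rk 2 (s 0)).+1); rewrite addnS ltnNge leq_addl.
Qed.

End Thresholds.

(** * Slices of increments and their block approximations *)

Section BlockSelection.
Variables (R : realType) (X : completeNormedModType R) (b : nat -> X).
Hypothesis hb : schauder_basis b.
Variables (E : seq nat -> Prop) (hE : front E).
Variables (U : set_system nat) (UU : UltraFilter U).
Hypothesis Uinf : forall n0, U [set n | (n0 <= n)%N].
Local Notation T := (initials E).
Local Notation state := (seq (seq nat)).
Local Notation gen := (gen E U).
Variable phi : seq nat -> X.
Hypothesis phi_lim : forall t, T t -> ~ E t -> weak_lim U (fun n => phi (rcons t n)) (phi t).
Variables (C c : R).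
Hypothesis c0 : 0 < c.
Hypothesis up : forall k (a : nat -> R), (forall j, `|a j| <= 1) ->
  gen (fun t => `|\sum_(j < k) a j *: phi (tok t j)| < C) (start k).
Variable n : nat.
Hypothesis rk_n : gen (fun t => (rk U phi c n (tok t 0) <= rk U phi c n.+1 (tok t 1))%N) (start 2).

Local Notation level := (level c).
Local Notation jumps := (jumps U phi c).
Local Notation rk := (rk U phi c).
Local Notation proj := (proj b).

(** One element past a jump: this makes [rk n u + 1] a stopping time. The guard excludes the empty
    sequence, which would count as its own predecessor. *)
Definition jumped t : Prop := t <> [::] /\ jumps n (take (size t).-1 t).

Lemma stopped_jumped u : (rk n u < size u)%N -> stopped jumped u = take (rk n u).+1 u.
Proof.
move=> ru; rewrite /stopped.
have nj m : (m < (rk n u).+1)%N -> (m <= size u)%N -> ~ jumped (take m u).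
  case: m => [_ _ [+ _]|m mr mu [_]]; first by rewrite take0.
  rewrite size_takel//= take_takel//; exact: stop_lt.
have [eu|lu] := eqVneq (rk n u).+1 (size u).
  by rewrite stop_size -eu// => m mr; apply: nj => //; rewrite -eu ltnW.
have ltu : ((rk n u).+1 < size u)%N by rewrite ltn_neqAle lu.
congr (take _ u); apply: stop_uniq => //.
  by move=> m mr; apply: nj => //; apply: (leq_trans (ltnW mr)).
split; first by move=> /(congr1 size); rewrite size_takel.
by rewrite size_takel//= take_takel//; exact: stopP.
Qed.

Lemma cut_ex : exists cut : seq nat -> nat, forall u t N,
  t \in words_upto u (size u) -> (cut u <= N)%N -> `|phi t - proj N (phi t)| < 2^-1 ^+ size u.
Proof.
have : forall u, exists N0, forall t N, t \in words_upto u (size u) -> (N0 <= N)%N ->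
    `|phi t - proj N (phi t)| < 2^-1 ^+ size u.
  move=> u; elim: (words_upto _ _) => [|t r [N0 IH]]; first by exists 0%N.
  have e0 : 0 < (2^-1 : R) ^+ size u by rewrite exprn_gt0.
  have [N1 h1] := proj_cvg_lt hb (phi t) e0.
  exists (maxn N0 N1) => t' N; rewrite inE geq_max => + /andP[h0 hN].
  by move=> /predU1P[->|tr]; [exact: h1|exact: IH].
by move=> /choice[cut hcut]; exists cut.
Qed.

Lemma monotone_cut_ex (cut : seq nat -> nat) :
  exists cut' : seq nat -> nat, (forall u, (cut u <= cut' u)%N) /\
    forall l i j, (i <= j)%N -> (cut' (mkseq l i) <= cut' (mkseq l j))%N.
Proof.
(* The sum over all initial segments dominates [cut] and can only grow along a sequence. *)
exists (fun u => \sum_(i < (size u).+1) cut (take i u))%N; split.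
  by move=> u; rewrite big_ord_recr/= take_size leq_addl.
move=> l i j; elim: j => [|j IH]; first by rewrite leqn0 => /eqP ->.
rewrite leq_eqVlt => /predU1P[->//|]; rewrite ltnS => /IH h; apply: (leq_trans h).
rewrite !size_mkseq [in leqRHS]big_ord_recr/=.
rewrite (eq_bigr (fun i : 'I_j.+1 => cut (take i (mkseq l j.+1)))) ?leq_addr// => m _.
rewrite mkseqS -cats1 takel_cat// size_mkseq -ltnS; exact: ltn_ord.
Qed.

(** Almost-sure statements at all nodes written with the history [u] become facts about the chosen
    [i]. The precision improves with the length of [u], so errors along a set are summable. *)
Definition good_step (cut : seq nat -> nat) (u : seq nat) (i : nat) : Prop :=
  forall t, t \in words_upto u (size u) -> T t /\ ~ E t ->
  [/\ T (rcons t i),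
      jumps n t -> level n <= `|phi (rcons t i)|,
      ~ jumps n t -> `|phi (rcons t i)| < level n,
      ~ jumps n.+1 t -> `|phi (rcons t i)| < level n.+1 &
      forall N, N \in iota 0 (cut u).+1 ->
        `|proj N (phi (rcons t i) - phi t)| < 2^-1 ^+ size u].

Lemma good_step_near cut u : U [set i | good_step cut u i].
Proof.
apply: (filter_all UU) => t _; have [[Tt nEt]|nt] := pselect (T t /\ ~ E t); last first.
  by apply: filterS filterT => i _ /nt.
have [n0 h] := initials_extend hE Tt nEt.
have e0 : 0 < (2^-1 : R) ^+ size u by rewrite exprn_gt0.
have hp : U [set i | forall N, N \in iota 0 (cut u).+1 ->
    `|proj N (phi (rcons t i) - phi t)| < 2^-1 ^+ size u].
  apply: (filter_all UU) => N _.
  exact: (proj_weak hb N UU (phi_lim Tt nEt) e0).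
have hj m : U [set i | jumps m t <-> level m <= `|phi (rcons t i)|].
  have [j|nj] := in_ultra_setVsetC [set i | level m <= `|phi (rcons t i)|] UU.
    by apply: filterS (j) => i /= hi; split.
  apply: filterS (nj) => i /= hi; split=> [j|//].
  by have [k [hk nk]] := filter_ex (filterI j nj).
apply: filterS (filterI (Uinf n0) (filterI hp (filterI (hj n) (hj n.+1)))).
move=> i [/h Ti [hpi [j1 j2]]] _; split=> //.
- exact: j1.1.
- by move=> nj; rewrite ltNge; apply/negP => /j1.2.
- by move=> nj; rewrite ltNge; apply/negP => /j2.2.
Qed.

(** Genericity survives only finite intersections, hence sign vectors; [sign_bound] recovers all
    coefficients in [[-1, 1]]. *)
Definition good_tuple (m : nat) (t : state) : Prop :=
  ((2 <= m)%N -> size t = 2 -> (rk n (tok t 0) <= rk n.+1 (tok t 1))%N) /\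
  forall eps, eps \in words [:: 1; -1 : R] (size t) ->
    `|\sum_(j < size t) eps`_j *: phi (stopped jumped (tok t j))| < C + 1 /\
    `|\sum_(j < size t) eps`_j *: phi (stopped (jumps n.+1) (tok t j))| < C + 1.

Lemma gen_good_tuple m k : gen (good_tuple m) (start k).
Proof.
have g1 : gen (fun t => (2 <= m)%N -> k = 2 -> (rk n (tok t 0) <= rk n.+1 (tok t 1))%N) (start k).
  have [->|k2] := eqVneq k 2; first by apply: gen_mono rk_n.
  by apply: gen_mono (bar_start hE Uinf k) => t _ _ /eqP; rewrite (negbTE k2).
have g2 : gen (fun t => forall eps, eps \in words [:: 1; -1 : R] k ->
    `|\sum_(j < k) eps`_j *: phi (stopped jumped (tok t j))| < C + 1 /\
    `|\sum_(j < k) eps`_j *: phi (stopped (jumps n.+1) (tok t j))| < C + 1) (start k).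
  apply: (gen_all UU (bar_start hE Uinf k)) => eps heps.
  have he j : `|eps`_j| <= 1.
    have [jk|kj] := ltnP j (size eps); last by rewrite nth_default// normr0.
    move: heps; rewrite mem_words => /andP[_ /allP/(_ _ (mem_nth 0 jk))].
    by rewrite !inE => /orP[]/eqP ->; rewrite ?normrN normr1.
  by apply: (gen_and UU); apply: (gen_stopped hE UU Uinf phi_lim up).
apply: gen_mono (gen_size (gen_and UU g1 g2)) => t [[h1 h2] st].
by rewrite /good_tuple st.
Qed.


Variables (cut : seq nat -> nat) (l : nat -> nat).
Hypothesis cutP : forall u t N, t \in words_upto u (size u) -> (cut u <= N)%N ->
  `|phi t - proj N (phi t)| < 2^-1 ^+ size u.
Hypothesis cut_le : forall i j, (i <= j)%N -> (cut (mkseq l i) <= cut (mkseq l j))%N.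
Hypothesis lmono : forall i j, (i < j)%N -> (l i < l j)%N.
Hypothesis lstep : forall i, good_step cut (mkseq l i) (l i).

Definition within (u : seq nat) : Prop := forall y, y \in u -> exists i, y = l i.

Hypothesis low : forall u, E u -> within u -> c <= `|phi u|.

Variable idx : nat -> nat.
Hypothesis idxK : forall i, idx (l i) = i.

(** The stage of the construction of [l] at which the element was chosen; cuts and errors are
    indexed by it. *)
Definition pos u i : nat := idx (nth 0%N u i).

Lemma posE u i : within u -> (i < size u)%N -> l (pos u i) = nth 0%N u i.
Proof. by move=> wu iu; have [j jE] := wu _ (mem_nth 0%N iu); rewrite /pos jE idxK. Qed.

Lemma pos_ltE u v i j : within u -> within v -> (i < size u)%N -> (j < size v)%N ->
  (pos u i < pos v j)%N = (nth 0 u i < nth 0 v j)%N.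
Proof.
move=> wu wv iu jv; rewrite -!posE//; apply/idP/idP => [/lmono//|].
by rewrite !ltnNge; apply: contra; rewrite leq_eqVlt => /predU1P[->//|/lmono/ltnW].
Qed.

Lemma pos_lt u i j : E u -> within u -> (i < j)%N -> (j < size u)%N -> (pos u i < pos u j)%N.
Proof.
move=> Eu wu ij ju; have iu := ltn_trans ij ju; rewrite pos_ltE//.
by apply: (sorted_ltn_nth ltn_trans); rewrite ?inE//; exact: front_sorted Eu.
Qed.

Lemma take_words u i d : E u -> within u -> (i <= size u)%N ->
  (forall j, (j < i)%N -> (pos u j < d)%N) ->
  take i u \in words_upto (mkseq l d) (size (mkseq l d)).
Proof.
move=> Eu wu iu h; rewrite size_mkseq; apply: mem_words_sorted => //.
  exact: (initials_sorted hE (initials_take _ (initials_self Eu))).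
move=> y /(nthP 0%N)[j]; rewrite size_takel// => ji <-; exists (pos u j); first exact: h.
by rewrite nth_take// posE//; exact: leq_trans ji iu.
Qed.

(** The segment [take i u] is written with terms of [l] of index below [pos u i], so it was among
    the nodes handled at that stage. *)
Lemma take_step u i : E u -> within u -> (i < size u)%N ->
  [/\ jumps n (take i u) -> level n <= `|phi (take i.+1 u)|,
      ~ jumps n (take i u) -> `|phi (take i.+1 u)| < level n,
      ~ jumps n.+1 (take i u) -> `|phi (take i.+1 u)| < level n.+1 &
      forall N, (N <= cut (mkseq l (pos u i)))%N ->
        `|proj N (phi (take i.+1 u) - phi (take i u))| < 2^-1 ^+ pos u i].
Proof.
move=> Eu wu iu.
have Ti : T (take i u) by exact/initials_take/initials_self.
have nEi : ~ E (take i u).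
  move=> Et; have /(congr1 size) := front_thin hE Et Eu (prefix_take _ _).
  by rewrite size_takel 1?ltnW// => h; move: iu; rewrite h ltnn.
have tw : take i u \in words_upto (mkseq l (pos u i)) (size (mkseq l (pos u i))).
  by apply: take_words => // [|j ji]; [exact: ltnW|exact: pos_lt].
have [_ h1 h2 h3 h4] := lstep tw (conj Ti nEi).
rewrite posE// -take_nth// in h1 h2 h3 h4; split=> // N hN.
by have := h4 N; rewrite mem_iota ltnS size_mkseq => /(_ hN).
Qed.

(** Without a jump the last step into [u] would give [phi u] a norm below [level n < c]. *)
Lemma rk_lt u : E u -> within u -> (rk n u < size u)%N.
Proof.
move=> Eu wu; rewrite ltnNge; apply/negP => h.
case: u Eu wu h => [/front_nil//|x u] Eu wu h; set v := x :: u in Eu wu h *.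
have sv : (size u < size v)%N by [].
have [_ + _ _] := take_step Eu wu sv; rewrite (take_size v) => /(_ _)/lt_geF-hl.
have : ~ jumps n (take (size u) v) by apply: stop_lt; exact: leq_trans h.
move=> /hl; rewrite (le_trans (ltW (level_lt c0 n)))//; exact: low.
Qed.

(** The step into this segment starts before the first jump at level [n.+1]; at rank 0 the vector is
    [phi [::] = 0]. *)
Lemma norm_take_rk u : E u -> within u -> `|phi (take (rk n.+1 u) u)| < level n.+1.
Proof.
move=> Eu wu; have ru := leq_ltn_trans (rkS UU phi c0 n u) (rk_lt Eu wu).
case rE : (rk n.+1 u) ru => [|r] ru.
  by rewrite take0 (limit_nil UU phi_lim up) normr0 level_gt0.
have [_ _ + _] := take_step Eu wu (ltnW ru); apply.
by apply: stop_lt; rewrite -/(rk _ _) rE.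
Qed.

Definition increment u : X := phi (take (rk n u).+1 u) - phi (take (rk n.+1 u) u).

Lemma increment_ge u : E u -> within u -> level n.+1 <= `|increment u|.
Proof.
move=> Eu wu; have ru := rk_lt Eu wu.
have [+ _ _ _] := take_step Eu wu ru; rewrite -/(rk n u) => /(_ (stopP ru)).
have := norm_take_rk Eu wu; have := levelS c n.
have := lerB_dist (phi (take (rk n u).+1 u)) (phi (take (rk n.+1 u) u)).
by rewrite /increment; lra.
Qed.

(** The first increment of the slice is small below the cut of its own stage. Beyond [upper] the
    tails are small only once the last element belongs to the history, hence the [.+1] there. *)
Definition lower u : nat := cut (mkseq l (pos u (rk n.+1 u))).
Definition upper u : nat := cut (mkseq l (pos u (rk n u)).+1).

Lemma lower_le_upper u : E u -> within u -> (lower u <= upper u)%N.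
Proof.
move=> Eu wu; apply: cut_le; have ru := rk_lt Eu wu; have := rkS UU phi c0 n u.
by rewrite leq_eqVlt => /predU1P[->//|h]; apply/ltnW/ltnW/pos_lt.
Qed.

Definition block u : X := proj (upper u) (increment u) - proj (lower u) (increment u).

(** Telescoping: positions increase strictly, so the errors are dominated by the geometric sum on
    the right, and cuts increase, so each later increment is also small below [lower u]. *)
Lemma proj_increment u i : E u -> within u -> (rk n.+1 u + i < size u)%N ->
  `|proj (lower u) (phi (take (rk n.+1 u + i).+1 u) - phi (take (rk n.+1 u) u))| <=
  2 * 2^-1 ^+ pos u (rk n.+1 u) - 2^-1 ^+ pos u (rk n.+1 u + i).
Proof.
move=> Eu wu; set r := rk n.+1 u.
have h2 : (0 : R) <= 2^-1 by rewrite invr_ge0.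
elim: i => [|i IH] ru.
  rewrite addn0 in ru *; have [_ _ _ h] := take_step Eu wu ru.
  by have := h _ (leqnn _); rewrite -/(lower u); lra.
rewrite addnS in ru *; have {}IH := IH (ltnW ru).
have pl := pos_lt Eu wu (ltnSn (r + i)) ru.
have rl : (pos u r <= pos u (r + i).+1)%N.
  apply: ltnW; apply: pos_lt => //; lia.
have [_ _ _ /(_ _ (cut_le rl))] := take_step Eu wu ru; rewrite -/(lower u) => h.
have -> : phi (take (r + i).+2 u) - phi (take r u) =
    (phi (take (r + i).+2 u) - phi (take (r + i).+1 u)) +
    (phi (take (r + i).+1 u) - phi (take r u)) by rewrite addrA subrK.
rewrite projD//; apply: le_trans (ler_normD _ _) _.
have : (2^-1 : R) ^+ pos u (r + i) >= 2 * 2^-1 ^+ pos u (r + i).+1.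
  rewrite -(subnK pl) exprD exprS; set d := (_ - _)%N.
  have : (2^-1 : R) ^+ d <= 1 by rewrite exprn_ile1// invf_le1// ler1n.
  have : 0 <= (2^-1 : R) ^+ pos u (r + i) by rewrite exprn_ge0.
  move: (_ ^+ pos u _) => a a0 d1.
  have : 2^-1 ^+ d * a <= a by rewrite ler_piMl.
  by rewrite mulrCA; lra.
by lra.
Qed.

(** The tails of the two end vectors beyond [upper] and the head below [lower] each contribute at
    most 2 of the factor 4. *)
Lemma block_approx u : E u -> within u ->
  `|increment u - block u| <= 4 * 2^-1 ^+ pos u (rk n.+1 u).
Proof.
move=> Eu wu; have ru := rk_lt Eu wu; have rr := rkS UU phi c0 n u.
have h1 : `|increment u - proj (upper u) (increment u)| <= 2 * 2^-1 ^+ (pos u (rk n u)).+1.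
  have hw i : (i <= (rk n u).+1)%N -> `|phi (take i u) - proj (upper u) (phi (take i u))| <
      2^-1 ^+ (pos u (rk n u)).+1.
    move=> ir; have := @cutP (mkseq l (pos u (rk n u)).+1) (take i u) (upper u).
    rewrite size_mkseq -{2}(size_mkseq l (pos u (rk n u)).+1); apply=> //.
    apply: take_words => //; first exact: leq_trans ir _.
    move=> j ji; rewrite ltnS.
    have : (j <= rk n u)%N by rewrite -ltnS; exact: leq_trans ji ir.
    by rewrite leq_eqVlt => /predU1P[->//|jr]; apply/ltnW/pos_lt.
  have := hw _ (leqnn _); have := hw _ (leq_trans rr (leqnSn _)).
  set A := phi (take (rk n u).+1 u); set B := phi (take (rk n.+1 u) u) => a1 a2.
  have -> : increment u - proj (upper u) (increment u) =
      (A - proj (upper u) A) - (B - proj (upper u) B).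
    by rewrite /increment projB// !opprD !opprK addrACA.
  by apply: le_trans (ler_normB _ _) _; lra.
have h2 : `|proj (lower u) (increment u)| <= 2 * 2^-1 ^+ pos u (rk n.+1 u).
  have := @proj_increment u (rk n u - rk n.+1 u)%N Eu wu; rewrite subnKC// => /(_ ru).
  have : (0 : R) <= 2^-1 ^+ pos u (rk n u) by rewrite exprn_ge0// invr_ge0.
  by rewrite -/(increment u); lra.
have h3 : (2^-1 : R) ^+ (pos u (rk n u)).+1 <= 2^-1 ^+ pos u (rk n.+1 u).
  apply: ler_wiXn2l; [by rewrite invr_ge0|by rewrite invf_le1// ler1n|].
  rewrite ltnW// ltnS; move: rr; rewrite leq_eqVlt => /predU1P[->//|h].
  exact/ltnW/pos_lt.
rewrite /block opprB addrCA addrC.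
by apply: le_trans (ler_normD _ _) _; lra.
Qed.

Lemma coord_block u i : Defs.coord b (block u) i =
  (if (i < upper u)%N then Defs.coord b (increment u) i else 0) -
  (if (i < lower u)%N then Defs.coord b (increment u) i else 0).
Proof.
rewrite /block (coordD hb) -scaleN1r (coordZ hb) !(coord_proj hb).
by rewrite mulN1r.
Qed.


Hypothesis lhom : forall m s, (size s <= m)%N -> plegmas s -> done E s ->
  (forall j y, (j < size s)%N -> y \in tok s j -> exists2 i, (m <= i)%N & y = l i) ->
  good_tuple m s.

Definition beyond m (s : state) : Prop :=
  forall j y, (j < size s)%N -> y \in tok s j -> exists2 i, (m <= i)%N & y = l i.

Lemma within_tok m s j : beyond m s -> (j < size s)%N -> within (tok s j).
Proof. by move=> bs js y /(bs _ _ js)[i _ ->]; exists i. Qed.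

Lemma pos_ge m s j i : beyond m s -> (j < size s)%N -> (i < size (tok s j))%N ->
  (m <= pos (tok s j) i)%N.
Proof. by move=> bs js ij; have [d md dE] := bs _ _ js (mem_nth 0%N ij); rewrite /pos dE idxK. Qed.

(** With [r = rk n u <= rk n.+1 v], the plegma inequality puts the element of [u] at [r] strictly
    before that of [v], and the strictness pays for the [.+1] in [upper]. *)
Lemma upper_le_lower u v : E u -> E v -> plegmas [:: u; v] -> beyond 2 [:: u; v] ->
  (upper u <= lower v)%N.
Proof.
move=> Eu Ev puv buv.
have wu : within u := @within_tok 2 [:: u; v] 0 buv isT.
have wv : within v := @within_tok 2 [:: u; v] 1 buv isT.
have duv : done E [:: u; v] by move=> [|[|]].
have [/(_ isT erefl) ruv _] := @lhom 2 [:: u; v] isT puv duv buv.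
apply: cut_le; have ru := rk_lt Eu wu.
have rv := leq_ltn_trans (rkS UU phi c0 n v) (rk_lt Ev wv).
have rv' : (rk n u < size v)%N by apply: leq_ltn_trans ruv rv.
apply: (@leq_trans (pos v (rk n u))).
  by rewrite pos_ltE//; exact: (puv 0 1 _ isT isT).1.
by move: ruv; rewrite leq_eqVlt => /predU1P[/= -> //|h]; apply/ltnW/pos_lt.
Qed.

Lemma block_lt_block u v : E u -> E v -> plegmas [:: u; v] -> beyond 2 [:: u; v] ->
  block_lt b (block u) (block v).
Proof.
move=> Eu Ev puv buv i j; have uv := upper_le_lower Eu Ev puv buv.
have wv : within v := @within_tok 2 [:: u; v] 1 buv isT.
have wu : within u := @within_tok 2 [:: u; v] 0 buv isT.
have lu := lower_le_upper Eu wu.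
rewrite /supp/= !coord_block => ui vj.
have iu : (i < upper u)%N.
  rewrite ltnNge; apply/negP => ui'; move: ui.
  by rewrite !ltnNge ui' (leq_trans lu ui') subrr eqxx.
apply: (leq_trans iu); apply: (leq_trans uv); rewrite leqNgt; apply/negP => jl.
have lv := lower_le_upper Ev wv.
by move: vj; rewrite jl (leq_trans jl lv) subrr eqxx.
Qed.

Lemma finitely_supported_block u : finitely_supported b (block u).
Proof.
apply: (sub_finite_set _ (finite_II (maxn (upper u) (lower u)))) => i.
rewrite /supp/= coord_block => h; rewrite ltnNge; apply/negP.
by rewrite geq_max => /andP[iu il]; move: h; rewrite !ltnNge iu il subrr eqxx.
Qed.

(** Increments are differences of two stopped vectors, whence [2 * (C + 1)]; at most [m] block
    errors of size [4 * 2^-m] add 4. *)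
Lemma block_sum_le m s (a : nat -> R) : (size s <= m)%N -> plegmas s -> done E s ->
  beyond m s -> (forall j, `|a j| <= 1) ->
  `|\sum_(j < size s) a j *: block (tok s j)| <= 2 * C + 6.
Proof.
move=> sm ps ds bs ha; have [_ hs] := lhom sm ps ds bs.
have wj j : (j < size s)%N -> within (tok s j) by move=> js; exact: within_tok bs js.
have h1 : `|0 + \sum_(j < size s) a j *: increment (tok s j)| <= 2 * (C + 1).
  apply: (sign_bound (y := fun j => increment (tok s j))) => // eps heps.
  have [] := hs _ heps; rewrite add0r.
  rewrite (eq_bigr (fun j : 'I_(size s) => eps`_j *: phi (take (rk n (tok s j)).+1 (tok s j)))).
    move=> a1 a2; rewrite (eq_bigr _ (fun _ _ => scalerBr _ _ _)) sumrB.
    by apply: le_trans (ler_normB _ _) _; rewrite /stopped in a2; lra.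
  move=> j _; rewrite stopped_jumped//; apply: rk_lt; last exact: wj.
  exact: ds.
have h2 : `|\sum_(j < size s) a j *: (increment (tok s j) - block (tok s j))| <= 4.
  apply: (le_trans (ler_norm_sum _ _ _)).
  apply: (@le_trans _ _ (\sum_(j < size s) 4 * 2^-1 ^+ m)).
    apply: ler_sum => j _; have Ej := ds _ (ltn_ord j); have wsj := wj _ (ltn_ord j).
    rewrite normrZ; apply: (@le_trans _ _ (1 * `|increment (tok s j) - block (tok s j)|)).
      by rewrite ler_wpM2r.
    rewrite mul1r; apply: (le_trans (block_approx Ej wsj)); rewrite ler_pM2l//.
    apply: ler_wiXn2l; [by rewrite invr_ge0|by rewrite invf_le1// ler1n|].
    apply: pos_ge bs (ltn_ord j) _.
    exact: leq_ltn_trans (rkS UU phi c0 n _) (rk_lt Ej wsj).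
  rewrite sumr_const card_ord -mulrnAr ler_piMr//.
  rewrite -mulr_natl exprVn ler_pdivrMr ?exprn_gt0// mul1r -natrX ler_nat.
  by apply: (leq_trans sm); rewrite ltnW// ltn_expl.
have -> : \sum_(j < size s) a j *: block (tok s j) =
    (\sum_(j < size s) a j *: increment (tok s j)) -
    \sum_(j < size s) a j *: (increment (tok s j) - block (tok s j)).
  rewrite -sumrB; apply: eq_bigr => j _.
  by rewrite -scalerBr opprB addrC subrK.
rewrite add0r in h1; apply: le_trans (ler_normB _ _) _; lra.
Qed.

Lemma proj_block N u : proj N (block u) =
  proj (minn N (upper u)) (increment u) - proj (minn N (lower u)) (increment u).
Proof.
have pp P v : proj N (proj P v) = proj (minn N P) v.
  rewrite /proj (eq_bigr (fun i : 'I_N => if (i < P)%N then Defs.coord b v i *: b i else 0)).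
    rewrite -big_mkcond/=; have [NP|PN] := leqP N P.
      by apply: eq_bigl => i; exact: leq_trans (ltn_ord i) NP.
    by rewrite -(big_ord_widen N (fun i => Defs.coord b v i *: b i) (ltnW PN)).
  by move=> i _; rewrite (coord_proj hb); case: ifP; rewrite ?scale0r.
by rewrite /block projB// !pp.
Qed.

(** The interval projection [P] kills all blocks but the [j]-th and has norm at most [2 * K]; by the
    smallness of [4 * 2^-m] that block keeps half of the norm [level n.+1] of its increment. *)
Lemma block_sum_ge K m s (a : nat -> R) j : (forall N x, `|proj N x| <= K * `|x|) ->
  0 < K -> (2 <= m)%N -> 4 * 2^-1 ^+ m <= level n.+1 / 2 ->
  (size s <= m)%N -> plegmas s -> done E s -> beyond m s -> (j < size s)%N ->
  level n.+1 / (4 * K) * `|a j| <= `|\sum_(i < size s) a i *: block (tok s i)|.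
Proof.
move=> hK K0 m2 hm sm ps ds bs js.
have wj i : (i < size s)%N -> within (tok s i) by move=> is_; exact: within_tok bs is_.
have lu i : (i < size s)%N -> (lower (tok s i) <= upper (tok s i))%N.
  by move=> is_; apply: lower_le_upper (ds _ is_) (wj _ is_).
have ul i i' : (i < i')%N -> (i' < size s)%N -> (upper (tok s i) <= lower (tok s i'))%N.
  move=> ii is_; have is1 := ltn_trans ii is_.
  apply: upper_le_lower; [exact: ds|exact: ds|exact: plegmas_pair|].
  move=> [|[|//]] y _ yi.
  - by have [d md ->] := bs _ _ is1 yi; exists d => //; exact: leq_trans md.
  - by have [d md ->] := bs _ _ is_ yi; exists d => //; exact: leq_trans md.
set x := \sum_(i < size s) _.
pose P v := proj (upper (tok s j)) v - proj (lower (tok s j)) v.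
have Px : P x = a j *: block (tok s j).
  rewrite /P /x !proj_sum// -sumrB (bigD1 (Ordinal js))//= big1 ?addr0.
    rewrite !projZ// -scalerBr !proj_block; congr (_ *: _).
    have lj := lu _ js.
    by rewrite !minnn (minn_idPr lj) (minn_idPl lj) subrr subr0.
  move=> i; rewrite -(inj_eq val_inj)/= neq_ltn => ij.
  rewrite !projZ// -scalerBr !proj_block; apply/eqP; rewrite scaler_eq0; apply/orP; right.
  have li := lu _ (ltn_ord i); have lj := lu _ js.
  case/orP: ij => ij.
    have h := ul _ _ ij js.
    rewrite (minn_idPr (leq_trans h lj)) (minn_idPr (leq_trans li (leq_trans h lj))).
    by rewrite (minn_idPr h) (minn_idPr (leq_trans li h)) subrr.
  have h := ul _ _ ij (ltn_ord i).
  rewrite (minn_idPl (leq_trans h li)) (minn_idPl h).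
  by rewrite (minn_idPl (leq_trans lj (leq_trans h li))) (minn_idPl (leq_trans lj h)) !subrr.
have PK : `|P x| <= 2 * K * `|x|.
  apply: le_trans (ler_normB _ _) _; have := hK (upper (tok s j)) x.
  by have := hK (lower (tok s j)) x; lra.
have bj : level n.+1 / 2 <= `|block (tok s j)|.
  have Ej := ds _ js; have wsj := wj _ js.
  have := increment_ge Ej wsj; have := block_approx Ej wsj.
  have : (2^-1 : R) ^+ pos (tok s j) (rk n.+1 (tok s j)) <= 2^-1 ^+ m.
    apply: ler_wiXn2l; [by rewrite invr_ge0|by rewrite invf_le1// ler1n|].
    apply: pos_ge bs js _.
    exact: leq_ltn_trans (rkS UU phi c0 n _) (rk_lt Ej wsj).
  have := ler_normD (increment (tok s j) - block (tok s j)) (block (tok s j)).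
  by rewrite subrK; lra.
have : level n.+1 / 2 * `|a j| <= 2 * K * `|x|.
  apply: le_trans PK; rewrite Px normrZ mulrC; apply: ler_wpM2l => //.
have -> : level n.+1 / (4 * K) * `|a j| = level n.+1 / 2 * `|a j| / (2 * K).
  by field; rewrite gt_eqF.
rewrite ler_pdivrMr ?mulr_gt0//; lra.
Qed.

End BlockSelection.

(** * From upper and lower bounds to a block subsequence *)

Section BlockSubsequence.
Variables (R : realType) (X : completeNormedModType R) (b : nat -> X).
Hypothesis hb : schauder_basis b.
Variables (E : seq nat -> Prop) (hE : front E).
Local Notation state := (seq (seq nat)).

Definition ranges (P : nat -> Prop) (s : state) : Prop :=
  forall j y, (j < size s)%N -> y \in tok s j -> P y.

Lemma left_inverse_ex (l : nat -> nat) : (forall i j, (i < j)%N -> (l i < l j)%N) ->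
  exists idx, forall i, idx (l i) = i.
Proof.
move=> lmono; have : forall y, exists i, (exists j, y = l j) -> y = l i.
  move=> y; have [[j jE]|nj] := pselect (exists j, y = l j); last by exists 0%N.
  by exists j.
move=> /choice[idx hidx]; exists idx => i.
have /esym := hidx (l i) (ex_intro _ i erefl).
by have [/lmono|/lmono|//] := ltngtP (idx (l i)) i; move=> + e; rewrite e ltnn.
Qed.

Lemma block_subsequence (M : set nat) (K : set X) (x : seq nat -> X) (C c : R) :
  infinite_set M -> compact (K : set (weak_space X)) ->
  (forall u, E u -> (forall y, y \in u -> M y) -> K (x u)) ->
  (forall k, exists n0, forall s, size s = k -> plegmas s -> done E s ->
    ranges (fun y => M y /\ (n0 <= y)%N) s -> forall a : nat -> R, (forall j, `|a j| <= 1) ->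
    `|\sum_(j < k) a j *: x (tok s j)| <= C) ->
  0 < c ->
  (exists n0, forall u, E u -> (forall y, y \in u -> M y /\ (n0 <= y)%N) -> c <= `|x u|) ->
  exists (l : nat -> nat) (w : seq nat -> X) (c' C' : R),
  [/\ 0 < c', forall i j, (i < j)%N -> (l i < l j)%N, forall i, M (l i), extendable E l &
  [/\ forall u, finitely_supported b (w u),
    forall u v, E u -> E v -> plegmas [:: u; v] ->
      ranges (fun y => exists i, y = l i) [:: u; v] -> block_lt b (w u) (w v) &
    forall m s, (size s <= m)%N -> plegmas s -> done E s ->
      ranges (fun y => exists2 i, (m <= i)%N & y = l i) s -> forall a : nat -> R,
      ((forall j, `|a j| <= 1) -> `|\sum_(j < size s) a j *: w (tok s j)| <= C') /\
      forall j, (j < size s)%N -> c' * `|a j| <= `|\sum_(i < size s) a i *: w (tok s i)| ]].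
Proof.
move=> Minf Kc Kx hup c0 [nlow hlow].
have [U [UU Uinf UM]] := free_ultrafilter Minf.
have [u0 Eu0 Mu0] : exists2 u, E u & forall y, y \in u -> M y.
  have [t [dt _ st Mt]] := gen_ex UU (gen_start hE UU Uinf 1 UM).
  by exists (tok t 0); [apply: dt; rewrite st|move=> y; apply: Mt; rewrite st].
(* The recursion runs over the whole tree, but [x] is controlled only on members inside [M];
   elsewhere a fixed value in [K] is used. *)
pose x' u := if `[< forall y, y \in u -> M y >] then x u else x u0.
have Kx' u : E u -> K (x' u).
  by move=> Eu; rewrite /x'; case: asboolP => [Mu|_]; exact: Kx.
have [phi [phi_x phi_lim]] := iterated_weak_limit hE UU Uinf Kc Kx'.
have phiE u : E u -> (forall y, y \in u -> M y) -> phi u = x u.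
  by move=> Eu Mu; rewrite phi_x// /x'; case: asboolP.
(* Genericity absorbs the thresholds [n0], which depend on [k]: almost all elements lie in [M]
   beyond them. *)
have up k (a : nat -> R) : (forall j, `|a j| <= 1) ->
    gen E U (fun t => `|\sum_(j < k) a j *: phi (tok t j)| < C + 1) (start k).
  move=> ha; have [n0 h] := hup k.
  have UM' : U [set y | M y /\ (n0 <= y)%N] by apply: filterI UM (Uinf n0).
  apply: gen_mono (gen_start hE UU Uinf k UM') => t [dt pt st Mt].
  have := h t st pt dt Mt a ha; rewrite (eq_bigr (fun j : 'I_k => a j *: phi (tok t j))).
    by move=> /le_lt_trans; apply; rewrite ltrDl.
  move=> j _; have jt : (j < size t)%N by rewrite st.
  by rewrite phiE//; [exact: dt|move=> y /(Mt _ _ jt)[]].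
have [n hn] := rk_nondecreasing_ex hE UU Uinf phi c0.
have [cut0 hcut0] := cut_ex hb phi.
have [cut [cut_ge cut_le]] := monotone_cut_ex cut0.
have cutP u t N : t \in words_upto u (size u) -> (cut u <= N)%N ->
    `|phi t - proj b N (phi t)| < 2^-1 ^+ size u.
  by move=> tu cN; apply: hcut0 => //; exact: leq_trans (cut_ge u) cN.
have hQ m k : (k <= m)%N -> gen E U (good_tuple U phi (C + 1) c n m) (start k).
  by move=> _; exact: (gen_good_tuple hE UU Uinf phi_lim up hn).
have UM' : U [set y | M y /\ (nlow <= y)%N] by apply: filterI UM (Uinf nlow).
have [l [lmono lM lP lQ]] := homogeneous hE UU Uinf hQ
  (good_step_near hb hE UU Uinf phi_lim c n cut) UM'.
have [idx idxK] := left_inverse_ex lmono.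
have low u : E u -> within l u -> c <= `|phi u|.
  move=> Eu wu; rewrite phiE//; last by move=> y /wu[i ->]; exact: (lM i).1.
  by apply: hlow => // y /wu[i ->]; exact: lM.
have [B B0 hB] := proj_bounded hb.
have el : extendable E l.
  move=> t i Tt nEt ht.
  have tw : t \in words_upto (mkseq l i) (size (mkseq l i)).
    by rewrite size_mkseq; apply: mem_words_sorted => //; exact: initials_sorted Tt.
  by have [] := lP i t tw (conj Tt nEt).
(* From index 2 on, pairs are homogeneous; the second demand keeps block errors below half of the
   norm. The final sequence is [l] shifted by [m0]. *)
have [m0 m02 hm0] : exists2 m0, (2 <= m0)%N &
    forall m, (m0 <= m)%N -> 4 * (2^-1 : R) ^+ m <= level c n.+1 / 2.
  have l0 : 0 < level c n.+1 / 8 by rewrite divr_gt0// level_gt0.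
  exists (maxn 2 (Num.truncn (level c n.+1 / 8)^-1).+1); first by rewrite leq_max.
  move=> m; rewrite geq_max => /andP[_ hm].
  have : (level c n.+1 / 8)^-1 <= 2 ^+ m.
    apply: (le_trans (ltW (truncnS_gt _))); rewrite -natrX ler_nat.
    by apply: (leq_trans hm); rewrite ltnW// ltn_expl.
  rewrite exprVn -[X in X <= _ -> _]invrK; rewrite -lef_pV2 ?posrE ?invr_gt0 ?exprn_gt0//.
  by rewrite ?invrK; lra.
pose w := block b U phi c n cut l idx.
exists (fun i => l (i + m0)%N), w, (level c n.+1 / (4 * B)), (2 * (C + 1) + 6).
have rb m s : ranges (fun y => exists2 i, (m <= i)%N & y = l (i + m0)%N) s -> beyond l (m + m0) s.
  by move=> h j y js /(h _ _ js)[i mi ->]; exists (i + m0)%N; rewrite ?leq_add2r.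
split.
- by rewrite divr_gt0 ?mulr_gt0// level_gt0.
- by move=> i j ij; apply: lmono; rewrite ltn_add2r.
- by move=> i; exact: (lM _).1.
- by apply: (extendable_comp (h := fun i => (i + m0)%N) el) => i j ij; rewrite ltn_add2r.
split.
- exact: (finitely_supported_block hb).
- move=> u v Eu Ev puv ruv.
  apply: (block_lt_block hb hE UU c0 (cut_le l) lmono lP low idxK lQ Eu Ev puv).
  move=> j y js /(ruv _ _ js)[i ->]; exists (i + m0)%N => //.
  exact: leq_trans m02 (leq_addl _ _).
- move=> m s sm ps ds /rb bs a; have sm' := leq_trans sm (leq_addr m0 m).
  split=> [ha|j js].
    exact: (block_sum_le hb hE UU c0 cutP (cut_le l) lmono lP low idxK lQ sm').
  apply: (block_sum_ge hb hE UU phi_lim c0 up cutP (cut_le l) lmono lP low idxK lQ a hB B0) sm' ps ds bs js.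
  + exact: leq_trans m02 (leq_addl _ _).
  + by apply: hm0; exact: leq_addl.
Qed.

End BlockSubsequence.

Lemma unbounded_infinite (M : set nat) :
  (forall n, exists2 y, (n <= y)%N & M y) -> infinite_set M.
Proof.
move=> h /finite_seqP[s sE]; have [y] := h (\max_(x <- s) x).+1.
rewrite sE => hy /= ys; have := @leq_bigmax_seq _ s xpredT id y ys isT.
by rewrite leqNgt hy.
Qed.

Lemma strict_mono_le (l : nat -> nat) i : (forall i j, (i < j)%N -> (l i < l j)%N) ->
  (i <= l i)%N.
Proof.
by move=> lmono; elim: i => // i IH; exact: leq_ltn_trans IH (lmono _ _ (ltnSn i)).
Qed.

(** * Extraction of a spreading model *)

Section SpreadingModel.
Variables (R : realType) (X : normedModType R).
Variables (E : seq nat -> Prop) (hE : front E).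
Local Notation state := (seq (seq nat)).

Definition grid (D : nat) : seq R :=
  [seq (i%:R - D%:R) / D%:R | i <- iota 0 (2 * D).+1].

Lemma grid_approx D k (a : nat -> R) : (0 < D)%N -> (forall j, `|a j| <= 1) ->
  exists2 g, g \in words (grid D) k & forall j, (j < k)%N -> `|a j - g`_j| <= D%:R^-1.
Proof.
move=> D0 ha; have D0' : 0 < D%:R :> R by rewrite ltr0n.
have : forall j, exists2 r, r \in grid D & `|a j - r| <= D%:R^-1.
  move=> j; have := ha j; rewrite ler_norml => /andP[a1 a2].
  have y0 : 0 <= D%:R * (a j + 1) by rewrite mulr_ge0//; lra.
  have yD : D%:R * (a j + 1) <= 2 * D%:R by rewrite mulrC ler_wpM2r//; lra.
  pose i := Num.truncn (D%:R * (a j + 1)).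
  have /andP[i1 i2] := truncn_itv y0.
  exists ((i%:R - D%:R) / D%:R).
    apply/mapP; exists i => //; rewrite mem_iota add0n ltnS/= -(ler_nat R) natrM.
    exact: le_trans yD.
  have -> : a j - (i%:R - D%:R) / D%:R = (D%:R * (a j + 1) - i%:R) / D%:R.
    by field; rewrite gt_eqF.
  rewrite normrM normfV (gtr0_norm D0') ger0_norm ?subr_ge0//.
  rewrite ler_piMl ?invr_ge0 ?ltW//; move: i2; rewrite -natr1; lra.
move=> h; have {}h j : exists r, r \in grid D /\ `|a j - r| <= D%:R^-1.
  by have [r ? ?] := h j; exists r.
have [r hr] := choice h; exists (mkseq r k).
  rewrite mem_words size_mkseq eqxx; apply/allP => _ /mapP[j _ ->].
  exact: (hr j).1.
by move=> j jk; rewrite nth_mkseq//; exact: (hr j).2.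
Qed.

Lemma norm_sum_le (a : nat -> R) (y : nat -> X) (A B : R) k :
  (forall j, (j < k)%N -> `|a j| <= A) -> (forall j, (j < k)%N -> `|y j| <= B) ->
  `|\sum_(j < k) a j *: y j| <= A * B *+ k.
Proof.
move=> ha hy; apply: (le_trans (ler_norm_sum _ _ _)).
rewrite -[k in leRHS]card_ord -sumr_const; apply: ler_sum => j _.
by rewrite normrZ ler_pM// ?ha ?hy.
Qed.

Variables (l : nat -> nat) (w : seq nat -> X) (c C : R).
Hypothesis lmono : forall i j, (i < j)%N -> (l i < l j)%N.
Hypothesis el : extendable E l.
Hypothesis w_le : forall m s, (size s <= m)%N -> plegmas s -> done E s ->
  ranges (fun y => exists2 i, (m <= i)%N & y = l i) s ->
  forall a : nat -> R, (forall j, `|a j| <= 1) ->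
  `|\sum_(j < size s) a j *: w (tok s j)| <= C.
Hypothesis c0 : 0 < c.
Hypothesis w_ge : forall m s, (size s <= m)%N -> plegmas s -> done E s ->
  ranges (fun y => exists2 i, (m <= i)%N & y = l i) s ->
  forall (a : nat -> R) j, (j < size s)%N ->
  c * `|a j| <= `|\sum_(i < size s) a i *: w (tok s i)|.

Lemma w_bounded u : E u -> (forall y, y \in u -> exists2 i, (1 <= i)%N & y = l i) ->
  `|w u| <= C.
Proof.
move=> Eu hu.
have := @w_le 1 [:: u] isT _ _ _ (fun=> 1); rewrite big_ord1 scale1r; apply.
- move=> [|//] [|//] k _ _; rewrite /tok/=; split=> // _ ku.
  apply: (sorted_ltn_nth ltn_trans); rewrite ?inE//; last exact: ltnW.
  exact: front_sorted Eu.
- by move=> [|//].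
- by move=> [|//] y _; exact: hu.
- by move=> _; rewrite normr1.
Qed.

Lemma w_le_ge0 : 0 <= C.
Proof.
apply: le_trans (normr_ge0 _) (@w_le 0 [::] isT _ _ _ (fun=> 0) _) => //.
by rewrite normr0.
Qed.

Lemma coef_sumX k (a : nat -> R) j :
  (\sum_(i < k) a i *: 'X^i : {poly R})`_j = if (j < k)%N then a j else 0.
Proof. by rewrite -poly_def coef_poly. Qed.

Lemma sum_coefX k m (a : nat -> R) (y : nat -> X) : (k <= m)%N ->
  \sum_(j < m) (\sum_(i < k) a i *: 'X^i : {poly R})`_j *: y j = \sum_(j < k) a j *: y j.
Proof.
move=> km; rewrite (big_ord_widen m (fun j => a j *: y j) km) [RHS]big_mkcond.
by apply: eq_bigr => j _; rewrite coef_sumX; case: ifP; rewrite ?scale0r.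
Qed.

(** For each length and grid vector the norms have an iterated limit [V]; at stage [m] homogeneity
    brings all plegma tuples within [1 / m.+1] of it, and general coefficients are rounded to the
    grid. *)
Lemma plegma_cauchy : exists h : nat -> nat,
  [/\ forall i j, (i < j)%N -> (h i < h j)%N, forall i, (i < h i)%N &
  forall m s s' (a : nat -> R), (size s <= m)%N -> size s' = size s ->
    plegmas s -> done E s -> plegmas s' -> done E s' ->
    ranges (fun y => exists2 i, (m <= i)%N & y = l (h i)) s ->
    ranges (fun y => exists2 i, (m <= i)%N & y = l (h i)) s' ->
    (forall j, `|a j| <= 1) ->
    `| `|\sum_(j < size s) a j *: w (tok s j)| - `|\sum_(j < size s) a j *: w (tok s' j)| |
      <= (2 * C + 2) / m.+1%:R].
Proof.
(* Index 0 is left out: [w_bounded] asks for indices at least 1, and this also yields [i < h i]. *)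
pose M := [set y | exists2 i, (1 <= i)%N & y = l i].
have Minf : infinite_set M.
  apply: unbounded_infinite => n; exists (l n.+1); last by exists n.+1.
  exact: ltnW (strict_mono_le n.+1 lmono).
have [U [UU Uinf UM]] := free_ultrafilter Minf.
(* [genlim] asks for a bound at every state, so [w] is set to 0 where it is not controlled. *)
pose w' u := if `[< E u /\ forall y, y \in u -> M y >] then w u else 0.
have w'C u : `|w' u| <= C.
  rewrite /w'; case: asboolP => [[Eu Mu]|_]; first exact: w_bounded.
  by rewrite normr0 w_le_ge0.
pose val k (g : seq R) (t : state) := `|\sum_(j < k) g`_j *: w' (tok t j)|.
have : forall kg : nat * seq R, exists v, forall e, 0 < e ->
    gen E U (fun t => `|val kg.1 kg.2 t - v| < e) (start kg.1).
  move=> [k g]; apply: (@genlim E U UU R (val k g) (\sum_(j < k) `|g`_j| * C)).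
    move=> t; rewrite /val normr_id; apply: (le_trans (ler_norm_sum _ _ _)).
    by apply: ler_sum => j _; rewrite normrZ ler_wpM2l.
  exact: bar_start.
move=> /choice[V hV].
(* Rounding with mesh [1 / m.+1 ^ 2] the coefficients of at most [m] vectors of norm at most [C]
   costs at most [C / m.+1]. *)
pose D m := (m.+1 * m.+1)%N.
pose Q m t := forall g, g \in words (grid (D m)) (size t) ->
  `|val (size t) g t - V (size t, g)| < m.+1%:R^-1.
have hQ m k : (k <= m)%N -> gen E U (Q m) (start k).
  move=> _.
  have g1 : gen E U (fun t => forall g, g \in words (grid (D m)) k ->
      `|val k g t - V (k, g)| < m.+1%:R^-1) (start k).
    apply: (gen_all UU (bar_start hE Uinf k)) => g _.
    by apply: (hV (k, g)); rewrite invr_gt0.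
  by apply: gen_mono (gen_size g1) => t [h st]; rewrite /Q st.
have [l' [l'mono l'M _ l'Q]] := homogeneous hE UU Uinf hQ
  (fun u => filterS (fun i _ => I : (fun _ _ => True) u i) filterT) UM.
have : forall i, exists j, (1 <= j)%N /\ l' i = l j.
  by move=> i; have [j ? ?] := l'M i; exists j.
move=> /choice[h hh].
have hmono i j : (i < j)%N -> (h i < h j)%N.
  move=> /l'mono; rewrite !(hh _).2 !ltnNge; apply: contra.
  by rewrite leq_eqVlt => /predU1P[->//|/lmono/ltnW].
exists h; split=> //.
  by elim=> [|i IH]; [exact: (hh 0%N).1|exact: leq_ltn_trans IH (hmono _ _ _)].
move=> m s s' a sm ss ps ds ps' ds' rs rs' ha.
have D0 : (0 < D m)%N by [].
have [g gw ga] := grid_approx (size s) D0 ha.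
have m0 : 0 < m.+1%:R :> R by rewrite ltr0n.
have close t : size t = size s -> plegmas t -> done E t ->
    ranges (fun y => exists2 i, (m <= i)%N & y = l (h i)) t ->
    `| `|\sum_(j < size s) a j *: w (tok t j)| - V (size s, g)| <= (C + 1) / m.+1%:R.
  move=> ts pt dt rt.
  have Qt : Q m t.
    apply: l'Q => //; first by rewrite ts.
    by move=> j y jt /(rt _ _ jt)[i mi ->]; exists i => //; rewrite (hh i).2.
  have wE j : (j < size s)%N -> w' (tok t j) = w (tok t j).
    rewrite -ts => jt; rewrite /w'; case: asboolP => // -[]; split; first exact: dt.
    by move=> y /(rt _ _ jt)[i _ ->]; rewrite -(hh i).2; exact: l'M.
  have := Qt g; rewrite ts => /(_ gw); rewrite /val => /ltW h1.
  have h2 : `|\sum_(j < size s) (a j - g`_j) *: w' (tok t j)| <= C / m.+1%:R.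
    apply: (le_trans (@norm_sum_le (fun j => a j - g`_j) (fun j => w' (tok t j)) _ _ _
      ga (fun j _ => w'C (tok t j)))).
    rewrite -mulr_natr /D natrM.
    have -> : (m.+1%:R * m.+1%:R)^-1 * C * (size s)%:R =
        C / m.+1%:R * ((size s)%:R / m.+1%:R) by field; rewrite gt_eqF.
    apply: ler_piMr; first by rewrite divr_ge0 ?w_le_ge0// ltW.
    rewrite ler_pdivrMr// mul1r ler_nat.
    exact: leq_trans sm (leqnSn m).
  have -> : \sum_(j < size s) a j *: w (tok t j) =
      \sum_(j < size s) g`_j *: w' (tok t j) +
      \sum_(j < size s) (a j - g`_j) *: w' (tok t j).
    rewrite -big_split/=; apply: eq_bigr => j _.
    by rewrite scalerBl addrC subrK wE.
  set x := \sum_(j < size s) _ in h1 *; set y := \sum_(j < size s) _ in h2 *.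
  have h3 : `| `|x + y| - `|x| | <= `|y|.
    by have := ler_dist_dist (x + y) x; rewrite [in X in _ <= X -> _](addrC x) addrK.
  have := ler_distD `|x| `|x + y| (V (size s, g)); rewrite mulrDl mul1r.
  by move=> /le_trans; apply; apply: lerD => //; exact: le_trans h3 h2.
have h1 := close s erefl ps ds rs; have h2 := close s' ss ps' ds' rs'.
rewrite distrC in h2; apply: (le_trans (ler_distD (V (size s, g)) _ _)).
have -> : (2 * C + 2) / m.+1%:R = (C + 1) / m.+1%:R + (C + 1) / m.+1%:R by ring.
exact: lerD.
Qed.


(** Polynomials are the free space on the monomials. [N] is an ultralimit of the norms computed on
    one plegma [m]-tuple [S m] for each [m], further and further out; by [plegma_cauchy] any other
    tuple gives nearly the same norm. *)
Lemma plegma_spreading_model : exists (h : nat -> nat) (N : {poly R} -> R) (delta : nat -> R),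
  [/\ forall i j, (i < j)%N -> (h i < h j)%N, seminorm N, forall m, 0 < delta m,
    delta @ \oo --> 0 &
  [/\ forall m s (a : nat -> R), (size s <= m)%N -> plegmas s -> done E s ->
      ranges (fun y => exists2 i, (m <= i)%N & y = l (h i)) s ->
      (forall j, `|a j| <= 1) ->
      `| `|\sum_(j < size s) a j *: w (tok s j)| - N (\sum_(j < size s) a j *: 'X^j) |
        <= delta m,
    forall k (a : nat -> R), (forall j, `|a j| <= 1) -> N (\sum_(j < k) a j *: 'X^j) <= C &
    forall k (a : nat -> R) j, (j < k)%N -> c * `|a j| <= N (\sum_(i < k) a i *: 'X^i)] ].
Proof.
have [h [hmono hlt hcauchy]] := plegma_cauchy.
have elh : extendable E (l \o h) := extendable_comp el hmono.
have lhmono i j : (i < j)%N -> (l (h i) < l (h j))%N by move=> /hmono/lmono.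
have /choice[S hS] : forall m, exists s, [/\ size s = m, plegmas s, done E s &
    ranges (fun y => exists2 i, (m <= i)%N & y = l (h i)) s].
  move=> [|m]; first by exists [::]; split.
  have [p [hp ps]] := plegma_family hE m m.+1 elh lhmono.
  exists (mkseq (fun j => mkseq (fun i => l (h (m.+1 * i + j + m.+1)%N)) (p j)) m.+1).
  split; [by rewrite size_mkseq|exact: (ps 0%N m.+1 (leqnn _))| |].
    by move=> j; rewrite size_mkseq => jm; rewrite /tok nth_mkseq//; exact: hp.
  move=> j y; rewrite size_mkseq => jm; rewrite /tok nth_mkseq// => /mapP[i _ ->].
  by exists (m.+1 * i + j + m.+1)%N => //; exact: leq_addl.
have lh m s : ranges (fun y => exists2 i, (m <= i)%N & y = l (h i)) s ->
    ranges (fun y => exists2 i, (m <= i)%N & y = l i) s.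
  move=> rs j y js /(rs _ _ js)[i mi ->]; exists (h i) => //.
  by apply: (leq_trans mi); exact: ltnW.
have [U [UU Uinf _]] := free_ultrafilter infinite_nat.
pose v m (p : {poly R}) := `|\sum_(j < m) p`_j *: w (tok (S m) j)|.
have v_le m (a : nat -> R) : (forall j, `|a j| <= 1) ->
    `|\sum_(j < m) a j *: w (tok (S m) j)| <= C.
  move=> ha; have [sS pS dS rS] := hS m.
  have := w_le (eq_leq sS) pS dS (lh _ _ rS) ha.
  by rewrite sS.
have v_bounded p m : `|v m p| <= (1 + \sum_(j < size p) `|p`_j|) * C.
  set B := 1 + _; have B0 : 0 < B by rewrite ltr_pwDl// sumr_ge0.
  have pB j : `|p`_j / B| <= 1.
    rewrite normrM normfV (gtr0_norm B0) ler_pdivrMr// mul1r /B.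
    have [jp|pj] := ltnP j (size p); last by rewrite nth_default// normr0 ltW.
    rewrite (bigD1 (Ordinal jp))//= addrCA lerDl addr_ge0// sumr_ge0//.
  rewrite /v normr_id; have -> : \sum_(j < m) p`_j *: w (tok (S m) j) =
      B *: \sum_(j < m) (p`_j / B) *: w (tok (S m) j).
    by rewrite scaler_sumr; apply: eq_bigr => j _; rewrite scalerA mulrC divfK ?gt_eqF.
  by rewrite normrZ gtr0_norm// ler_pM2l//; exact: (v_le m (fun j => p`_j / B)).
have /choice[N hN] : forall p, exists y, forall e, 0 < e -> U [set m | `|v m p - y| < e].
  by move=> p; apply: (ultra_lim UU (B := (1 + \sum_(j < size p) `|p`_j|) * C));
    apply: filterS filterT => m _ /=; exact: v_bounded.
have N_le p B n0 : (forall m, (n0 <= m)%N -> v m p <= B) -> N p <= B.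
  move=> hB; apply/ler_addgt0Pr => e e0.
  have [m [/= nm]] := filter_ex (filterI (Uinf n0) (hN p e e0)).
  by rewrite ltr_distl => /andP[? _]; have := hB m nm; lra.
have N_ge p B n0 : (forall m, (n0 <= m)%N -> B <= v m p) -> B <= N p.
  move=> hB; apply/ler_addgt0Pr => e e0.
  have [m [/= nm]] := filter_ex (filterI (Uinf n0) (hN p e e0)).
  by rewrite ltr_distl => /andP[_ ?]; have := hB m nm; lra.
exists h, N, (fun m => (2 * C + 2) / m.+1%:R); split=> //.
- split=> [p|p q|t p].
  + by apply: (@N_ge p 0 0%N) => m _; exact: normr_ge0.
  + apply/ler_addgt0Pr => e e0; have e30 : 0 < e / 3 by lra.
    have [m [/= h1 [h2 h3]]] := filter_ex (filterI (hN p _ e30) (filterI (hN q _ e30) (hN (p + q) _ e30))).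
    have : v m (p + q) <= v m p + v m q.
      rewrite /v; under eq_bigr do rewrite coefD scalerDl.
      by rewrite big_split/=; exact: ler_normD.
    by move: h1 h2 h3; rewrite !ltr_distl => /andP[? ?] /andP[? ?] /andP[? ?]; lra.
  + have vZ m : v m (t *: p) = `|t| * v m p.
      rewrite /v -normrZ scaler_sumr; congr (`| _ |); apply: eq_bigr => j _.
      by rewrite coefZ scalerA.
    apply/eqP; rewrite -subr_eq0 -normr_le0; apply/ler_addgt0Pr => e e0; rewrite add0r.
    have t0 : 0 < `|t| + 1 by rewrite ltr_wpDl.
    have e20 : 0 < e / 2 by lra.
    have [m [h1 h2]] := filter_ex (filterI (hN p _ (divr_gt0 e20 t0)) (hN (t *: p) _ e20)).
    move: h1 h2 => /= h1; rewrite vZ distrC => h2.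
    have h3 : `| `|t| * v m p - `|t| * N p| <= e / 2.
      rewrite -mulrBr normrM normr_id; apply: (@le_trans _ _ ((`|t| + 1) * `|v m p - N p|)).
        by rewrite ler_wpM2r// lerDl.
      by rewrite mulrC -ler_pdivlMr// ltW.
    by apply: (le_trans (ler_distD (`|t| * v m p) _ _)); lra.
- by move=> m; rewrite divr_gt0//; have := w_le_ge0; lra.
- rewrite -(mulr0 (2 * C + 2)); apply: cvgM (cvg_cst _) _; exact: cvg_harmonic.
split.
- move=> m s a sm ps ds rs ha; set p : {poly R} := \sum_(j < _) _.
  (* The first [size s] sets of [S m'] again form a plegma tuple, comparable with [s]; the remaining
     sets carry zero coefficients. *)
  have close m' : (m <= m')%N ->
      `| `|\sum_(j < size s) a j *: w (tok s j)| - v m' p| <= (2 * C + 2) / m.+1%:R.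
    move=> mm; have [sS pS dS rS] := hS m'.
    have sm' : (size s <= size (S m'))%N by rewrite sS (leq_trans sm mm).
    have tkE j : (j < size s)%N -> tok (take (size s) (S m')) j = tok (S m') j.
      by move=> js; rewrite /tok nth_take.
    have -> : v m' p = `|\sum_(j < size s) a j *: w (tok (take (size s) (S m')) j)|.
      rewrite /v (sum_coefX a (fun j => w (tok (S m') j))) ?(leq_trans sm mm)//.
      by congr (`| _ |); apply: eq_bigr => j _; rewrite tkE.
    apply: hcauchy => //.
    + by rewrite size_takel.
    + move=> i j k; rewrite size_takel// => is_ js; rewrite !tkE//.
      by apply: pS; [exact: leq_trans is_ sm'|exact: leq_trans js sm'].
    + by move=> j; rewrite size_takel// => js; rewrite tkE//; apply: dS; exact: leq_trans js sm'.
    + move=> j y; rewrite size_takel// => js; rewrite tkE// => yj.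
      have [i mi ->] := rS j y (leq_trans js sm') yj; exists i => //.
      exact: leq_trans mm mi.
  rewrite distrC ler_distl; apply/andP; split.
    apply: (@N_ge _ _ m) => m' /close; rewrite distrC ler_distl => /andP[//].
  by apply: (@N_le _ _ m) => m' /close; rewrite distrC ler_distl => /andP[_ //].
- move=> k a ha; apply: (@N_le _ _ 0%N) => m _.
  apply: (v_le m (fun j => (\sum_(j < k) a j *: 'X^j : {poly R})`_j)) => j.
  by rewrite coef_sumX; case: ifP => // _; rewrite normr0.
- move=> k a j jk; apply: (@N_ge _ _ k) => m km; have [sS pS dS rS] := hS m.
  have := w_ge (eq_leq sS) pS dS (lh _ _ rS) (fun i => (\sum_(j < k) a j *: 'X^j : {poly R})`_i).
  rewrite sS => /(_ j (leq_trans jk km)).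
  by rewrite coef_sumX jk.
Qed.

End SpreadingModel.

(** * Regular thin families as fronts *)

Section FiniteSetsAsSequences.
Local Open Scope nat_scope.
Implicit Types (s t : {fset nat}) (u v : seq nat).

Definition fset_of u : {fset nat} := [fset y in u]%fset.

Lemma elts_sorted s : sorted ltn (elts s).
Proof.
by rewrite ltn_sorted_uniq_leq sort_uniq fset_uniq; exact: (sort_sorted leq_total).
Qed.

Lemma mem_elts s y : (y \in elts s) = (y \in s).
Proof. by rewrite mem_sort. Qed.

Lemma size_elts s : size (elts s) = #|` s|.
Proof. by rewrite size_sort. Qed.

Lemma fset_ofK u : sorted ltn u -> elts (fset_of u) = u.
Proof.
move=> su; apply: (irr_sorted_eq ltn_trans ltnn) => //; first exact: elts_sorted.
by move=> y; rewrite mem_elts in_fset_.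
Qed.

Lemma eltsK s : fset_of (elts s) = s.
Proof. by apply/fsetP => y; rewrite in_fset_ /= mem_elts. Qed.

Lemma elts_nil s : (elts s == [::]) = (s == fset0).
Proof. by rewrite -size_eq0 size_elts cardfs_eq0. Qed.

Lemma plegma_plegmas (t : seq {fset nat}) : plegma t -> plegmas (map elts t).
Proof.
move=> [t0 t1 t2] i j k; rewrite size_map => it jt.
rewrite /tok !(nth_map fset0)// !size_elts; split=> [ij ki kj|ki kj].
  have := t1 i j k.+1; rewrite ij jt /elt/=; apply=> //.
  by rewrite leq_min ki kj.
have := t2 i j k.+1 it jt; rewrite /elt/=; apply.
by rewrite leq_min ki ltn_subRL add1n.
Qed.

Lemma plegmas_plegma (t : seq {fset nat}) : (forall s, s \in t -> s != fset0) ->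
  plegmas (map elts t) -> plegma t.
Proof.
move=> t0 pt; split=> // [i j [|k]//|i j [|k]//].
  move=> /andP[ij jt]; have it := ltn_trans ij jt.
  have := (pt i j k); rewrite size_map /tok !(nth_map fset0)// !size_elts.
  by move=> /(_ it jt)[+ _] /=; rewrite leq_min => h /andP[ki kj]; exact: h.
move=> it jt; have := (pt i j k); rewrite size_map /tok !(nth_map fset0)// !size_elts.
move=> /(_ it jt)[_ +] /=; rewrite leq_min ltn_subRL add1n => h /andP[ki kj].
exact: h.
Qed.

Lemma inf_elt_range (g : nat -> nat) m : (forall i j, i < j -> g i < g j) ->
  inf_elt (range g) m.+1 = g m.
Proof.
move=> gmono.
have cE n : count (fun i => `[< range g i >]) (iota 0 (g n).+1) = n.+1.
  rewrite -size_filter -[RHS](size_mkseq g); congr size.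
  apply: (irr_sorted_eq ltn_trans ltnn).
  - by apply: (sorted_filter ltn_trans); exact: iota_ltn_sorted.
  - apply: (homo_sorted (e := ltn)); last exact: iota_ltn_sorted.
    by move=> i j; exact: gmono.
  - move=> y; rewrite mem_filter mem_iota add0n ltnS /=; apply/andP/mapP.
      move=> [/asboolP[i _ <-] gi]; exists i => //; rewrite mem_iota add0n ltnS/=.
      by rewrite leqNgt; apply/negP => /gmono; rewrite ltnNge gi.
    move=> [i + ->]; rewrite mem_iota add0n ltnS/= leq_eqVlt => hi.
    split; first by apply/asboolP; exists i.
    by case/predU1P: hi => [->//|/gmono/ltnW].
have [[n _ <-] + ] : [set y | range g y /\
    count (fun i => `[< range g i >]) (iota 0 y.+1) = m.+1] (inf_elt (range g) m.+1).
  apply: (@xgetI _ 0 [set y | range g y /\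
    count (fun i => `[< range g i >]) (iota 0 y.+1) = m.+1] (g m)).
  by split; [exists m|exact: cE].
by rewrite cE => -[->].
Qed.

Definition front_of (F : set {fset nat}) (u : seq nat) : Prop :=
  exists2 s, F s & elts s = u.

Lemma front_of_elts (F : set {fset nat}) s : F s -> front_of F (elts s).
Proof. by exists s. Qed.

Lemma front_of_fset (F : set {fset nat}) u : front_of F u -> F (fset_of u).
Proof. by move=> [s Fs <-]; rewrite eltsK. Qed.

Lemma initials_hat (F : set {fset nat}) u : initials (front_of F) u ->
  hat F (fset_of u) /\ sorted ltn u.
Proof.
move=> [v [s Fs sE] uv].
have su : sorted ltn u.
  move: uv => /prefixP[w vE]; have := elts_sorted s; rewrite sE vE.
  by move=> /cat_sorted2[].
by split=> //; exists s => //; rewrite /initial_segment fset_ofK// sE.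
Qed.

Lemma hat_initials (F : set {fset nat}) u : sorted ltn u -> hat F (fset_of u) ->
  initials (front_of F) u.
Proof.
move=> su [s Fs]; rewrite /initial_segment fset_ofK// => us.
by exists (elts s) => //; exists s.
Qed.

(* The union of an infinite chain of initial segments would be a pointwise limit
   of finite sets of the compact family. *)
Lemma front_of_wf (F : set {fset nat}) : compact_family (hat F) -> well_founded
  (fun u v => initials (front_of F) u /\ exists n, u = rcons v n).
Proof.
set r := (fun u v => _) => cF v; apply: contrapT => nv.
have : forall v, exists u, ~ Acc r v -> r u v /\ ~ Acc r u.
  move=> {nv}v; have [a|nv] := pselect (Acc r v); first by exists [::].
  have [[u [ru nu]]|nu] := pselect (exists u, r u v /\ ~ Acc r u); first by exists u.
  exfalso; apply: nv; apply: Acc_intro => u ru; apply: contrapT => nau.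
  by apply: nu; exists u.
move=> /choice[nx hnx].
pose g i := iter i nx v.
have gacc i : ~ Acc r (g i) by elim: i => [//|i IH]; exact: (hnx _ IH).2.
have gr i : r (g i.+1) (g i) by exact: (hnx _ (gacc i)).1.
have gs i : size (g i) = size v + i.
  elim: i => [|i IH]; first by rewrite addn0.
  by have [_ [n ->]] := gr i; rewrite size_rcons IH addnS.
have gsub i j : i <= j -> {subset g i <= g j}.
  move=> /subnK <-; elim: (j - i) => [//|k IH] y /IH; rewrite addSn.
  by have [_ [n ->]] := gr (k + i); rewrite mem_rcons inE orbC => ->.
pose chi : cantor_space := fun n => `[< exists i, n \in g i >].
have gchi : (fun i => char_fun (fset_of (g i.+1)) : cantor_space) @ \oo --> chi.
  apply/cvg_sup => n A; rewrite nbhsE => -[B [[C Cop CB] Bchi] BA].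
  have nC : C (chi n) by move: Bchi; rewrite -CB.
  have [[i ni]|nn] := pselect (exists i, n \in g i).
    exists i => // j /= ij; apply: BA; rewrite -CB /preimage/= /char_fun in_fset_ /=.
    rewrite (gsub i j.+1 (leq_trans ij (leqnSn j)) _ ni).
    by move: nC; rewrite /chi asboolT//; exists i.
  exists 0 => // j _; apply: BA; rewrite -CB /preimage/= /char_fun in_fset_ /=.
  have -> : (n \in g j.+1) = false by apply/negP => h; apply: nn; exists j.+1.
  by move: nC; rewrite /chi asboolF.
have [s hs schi] : (char_fun @` hat F) chi.
  apply: (closed_cvg (fun z => (char_fun @` hat F) z) cF _ _ gchi).
  by exists 0 => // i _; exists (fset_of (g i.+1)) => //; exact: (initials_hat (gr i).1).1.
have gin i : {subset g i.+1 <= elts s}.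
  move=> y yg; rewrite mem_elts -[_ \in s]/(char_fun s y) schi.
  by apply/asboolP; exists i.+1.
have := uniq_leq_size (sorted_uniq ltn_trans ltnn (initials_hat (gr (size (elts s))).1).2) (gin _).
by rewrite gs addnS ltnNge leq_addl.
Qed.

Lemma regular_thin_front F : regular_thin F -> front (front_of F).
Proof.
move=> [F0 Fthin [_ Fspread Fcompact] [s0 Fs0 s00]]; split.
- by move=> _ [s _ <-]; exact: elts_sorted.
- by move=> _ _ [s Fs <-] [t Ft <-] st; congr elts; exact: Fthin.
- move=> u v /initials_hat[hu su] svu sv huv; apply: hat_initials => //.
  apply: (Fspread _ _ hu); rewrite -!size_elts !fset_ofK// => k /andP[k1 k2].
  by rewrite /elt !fset_ofK//; apply: huv; lia.
- exact: front_of_wf.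
- by exists (elts s0); [exists s0|rewrite elts_nil].
Qed.

End FiniteSetsAsSequences.

(** * The unit vector basis of [c_0] and its equivalence with the monomials *)

Section C0Norm.
Variable R : realType.

Definition extend0 k (a : 'I_k -> R) (j : nat) : R :=
  if insub j is Some i then a i else 0.

Lemma extend0E k (a : 'I_k -> R) (j : 'I_k) : extend0 a j = a j.
Proof. by rewrite /extend0 valK. Qed.

Lemma extend0_le k (a : 'I_k -> R) (B : R) : 0 <= B -> (forall j, `|a j| <= B) ->
  forall j, `|extend0 a j| <= B.
Proof. by move=> B0 ha j; rewrite /extend0; case: insubP => [i _ _|_]; rewrite ?normr0. Qed.

Lemma sum_extend0 k (V : lmodType R) (a : 'I_k -> R) (y : nat -> V) :
  \sum_(i < k) a i *: y i = \sum_(i < k) extend0 a i *: y i.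
Proof. by apply: eq_bigr => i _; rewrite extend0E. Qed.

Lemma c0_sumE k (a : 'I_k -> R) j : (\sum_(i < k) a i *: @c0_basis R i) j = extend0 a j.
Proof.
rewrite fct_sumE /extend0; case: insubP => [i _ <-|jk].
  rewrite (bigD1 i)//= big1 ?addr0.
    by rewrite /c0_basis/= fctE eqxx /GRing.scale/= mulr1.
  move=> m mi; rewrite fctE /c0_basis.
  by rewrite (_ : (i == m :> nat) = false) ?scaler0//; apply/negbTE; rewrite eq_sym.
rewrite big1// => m _; rewrite fctE /c0_basis.
rewrite (_ : (j == m :> nat) = false) ?scaler0//; apply/negbTE; apply: contra jk => /eqP ->.
exact: ltn_ord.
Qed.

Lemma c0_norm_le k (a : 'I_k -> R) (B : R) : 0 <= B -> (forall j, `|a j| <= B) ->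
  c0_norm (\sum_(i < k) a i *: @c0_basis R i) <= B.
Proof.
move=> B0 ha; apply: ge_sup.
  by exists `|(\sum_(i < k) a i *: @c0_basis R i) 0%N|, 0%N.
by move=> _ [j _ <-]; rewrite c0_sumE; exact: extend0_le.
Qed.

Lemma c0_norm_ge_ext k (a : 'I_k -> R) j :
  `|extend0 a j| <= c0_norm (\sum_(i < k) a i *: @c0_basis R i).
Proof.
apply: ub_le_sup; last by exists j => //; rewrite c0_sumE.
exists (\sum_(i < k) `|a i|) => _ [i _ <-]; rewrite c0_sumE.
apply: extend0_le => [|m]; first by rewrite sumr_ge0.
by rewrite (bigD1 m)//= lerDl sumr_ge0.
Qed.

Lemma c0_norm_ge k (a : 'I_k -> R) j :
  `|a j| <= c0_norm (\sum_(i < k) a i *: @c0_basis R i).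
Proof. by rewrite -(extend0E a); exact: c0_norm_ge_ext. Qed.

Lemma c0_norm_ge0 k (a : 'I_k -> R) : 0 <= c0_norm (\sum_(i < k) a i *: @c0_basis R i).
Proof. exact: le_trans (normr_ge0 _) (c0_norm_ge_ext a 0%N). Qed.

Lemma hamel_basisX : hamel_basis (fun j => 'X^j : {poly R}).
Proof.
split=> [k a a0 i|v].
  have := coef_sumX k (extend0 a) i; rewrite -(sum_extend0 a (fun j => 'X^j : {poly R})) a0.
  by rewrite coef0 ltn_ord extend0E.
exists (size v), (fun i => v`_i); rewrite -[LHS]coefK poly_def.
by [].
Qed.

(** Dividing by the [c_0] norm [P] reduces the upper inequality to coefficients in [[-1, 1]]; if
    [P = 0] all coefficients vanish. *)
Lemma equivalent_c0 (N : {poly R} -> R) (c C : R) : 0 < c -> seminorm N ->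
  (forall k (a : nat -> R), (forall j, `|a j| <= 1) -> N (\sum_(j < k) a j *: 'X^j) <= C) ->
  (forall k (a : nat -> R) j, (j < k)%N -> c * `|a j| <= N (\sum_(i < k) a i *: 'X^i)) ->
  equivalent N (fun j => 'X^j) (@c0_norm R) (@c0_basis R).
Proof.
move=> c0 [N0 ND NZ] hC hc.
have C0 : 0 < C.
  apply: (lt_le_trans c0); have := hc 1%N (fun=> 1) 0%N isT; rewrite normr1 mulr1.
  by move=> /le_trans; apply; apply: (hC 1%N (fun=> 1)) => _; rewrite normr1.
exists c, C; split=> // k a; rewrite (sum_extend0 a (fun j => 'X^j : {poly R})).
apply/andP; split.
  rewrite -ler_pdivlMl// mulrC; apply: c0_norm_le; first by rewrite divr_ge0// ltW.
  move=> j; rewrite ler_pdivlMr// mulrC -(extend0E a j); apply: hc; exact: ltn_ord.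
set P := c0_norm _; have P0 : 0 <= P by exact: (c0_norm_ge0 a).
have aP j : `|extend0 a j| <= P by apply: extend0_le => // i; exact: (c0_norm_ge a i).
have [P1|P1] := eqVneq P 0.
  rewrite big1 => [|j _].
    by rewrite -(scale0r (0 : {poly R})) NZ normr0 mul0r P1 mulr0.
  have := aP j; rewrite P1 normr_le0 => /eqP ->; exact: scale0r.
have {}P0 : 0 < P by rewrite lt_def P1.
have -> : \sum_(j < k) extend0 a j *: 'X^j =
    P *: \sum_(j < k) (extend0 a j / P) *: 'X^j :> {poly R}.
  by rewrite scaler_sumr; apply: eq_bigr => j _; rewrite scalerA mulrC divfK.
rewrite NZ (gtr0_norm P0) mulrC ler_pM2r//.
apply: (hC k (fun j => extend0 a j / P)) => j.
by rewrite normrM normfV (gtr0_norm P0) ler_pdivrMr// mul1r.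
Qed.

End C0Norm.

(** * Norm bounds extracted from a [c_0] spreading model *)

Section Conversion.
Variables (R : realType) (X : normedModType R).
Variables (F : set {fset nat}) (M : set nat) (x : {fset nat} -> X).
Hypothesis hF : regular_thin F.
Local Notation E := (front_of F).

(** Far enough out [delta] is at most [d = min 1 (c / 2)], so passing from the seminorm to norms in
    [X] turns [C] into [C + 1] and [c] into [c / 2]. *)
Lemma generates_c0_bounds : generates_c0 F M x -> exists c C : R, [/\ 0 < c,
  forall k, exists n0, forall s, size s = k -> plegmas s -> done E s ->
    ranges (fun y => M y /\ (n0 <= y)%N) s -> forall a : nat -> R, (forall j, `|a j| <= 1) ->
    `|\sum_(j < k) a j *: x (fset_of (tok s j))| <= C &
  exists n0, forall u, E u -> (forall y, y \in u -> M y /\ (n0 <= y)%N) ->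
    c <= `|x (fset_of u)|].
Proof.
move=> [V [N [e [[N0 ND NZ] _ [delta [d0 dlim hgen]] [c [C [c0 C0 hequiv]]]]]]].
have hE := regular_thin_front hF.
pose d := Num.min 1 (c / 2).
have dpos : 0 < d by rewrite lt_min ltr01 divr_gt0.
have [m0 _ hm0] : \forall m \near \oo, `|0 - delta m| < d.
  by move/cvgrPdist_lt: dlim; apply.
have hd m : (m0 <= m)%N -> delta m <= d.
  by move=> /hm0; rewrite /= sub0r normrN gtr0_norm// => /ltW.
have main k m (s : seq (seq nat)) (a : nat -> R) : (1 <= k <= m)%N -> size s = k -> plegmas s ->
    done E s -> ranges (fun y => M y /\ (inf_elt M m <= y)%N) s -> (forall j, `|a j| <= 1) ->
    `| `|\sum_(j < k) a j *: x (fset_of (tok s j))| - N (\sum_(j < k) a j *: e j)| <= delta m.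
  move=> km sk ps ds rs ha.
  have sk' : size (map fset_of s) == k by rewrite size_map sk.
  pose t := Tuple sk'.
  have tE (j : 'I_k) : tnth t j = fset_of (tok s j).
    by rewrite (tnth_nth fset0) /= (nth_map [::])// sk.
  have Fs j : (j < size s)%N -> F (fset_of (tok s j)).
    by move=> js; exact: front_of_fset (ds _ js).
  have ets : map elts (map fset_of s) = s.
    rewrite -map_comp -[RHS]map_id; apply/eq_in_map => u /(nthP [::])[j js <-].
    by rewrite /= fset_ofK//; exact: (front_sorted hE (ds _ js)).
  have pt : plegma t.
    apply: plegmas_plegma; last by rewrite /= ets.
    move=> _ /mapP[u /(nthP [::])[j js <-] ->]; apply/eqP => u0.
    have := ds _ js; rewrite -(fset_ofK (front_sorted hE (ds _ js))) u0.
    have /eqP -> : elts fset0 == [::] by rewrite elts_nil.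
    exact: front_nil.
  have -> : \sum_(j < k) a j *: x (fset_of (tok s j)) = \sum_(j < k) a j *: x (tnth t j).
    by apply: eq_bigr => j _; rewrite tE.
  apply: (hgen k m t (fun j => a j) km pt).
  - move=> j; rewrite tE; have js : (j < size s)%N by rewrite sk.
    split; first exact: Fs.
    move=> y /=; rewrite in_fset_ /= => ys; exact: (rs _ _ js ys).1.
  - have s0 : (0 < size s)%N by rewrite sk; case/andP: km.
    rewrite /elt /= (nth_map [::])// fset_ofK; last exact: (front_sorted hE (ds _ s0)).
    apply: (rs 0%N _ s0 _).2; apply: mem_nth.
    rewrite lt0n size_eq0; apply/eqP => s00; have := ds _ s0; rewrite /tok s00.
    exact: front_nil.
  - by move=> j; rewrite -ler_norml.
have Nle k (a : nat -> R) : (forall j, `|a j| <= 1) -> N (\sum_(j < k) a j *: e j) <= C.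
  move=> ha; have /andP[_ h] := hequiv k (fun j => a j).
  apply: (le_trans h); rewrite ler_piMr ?(ltW C0)//.
  by apply: c0_norm_le => // j.
exists (c / 2), (C + 1); split; first by rewrite divr_gt0.
  move=> [|k].
    exists 0%N => s _ _ _ _ a _; rewrite big_ord0 normr0; have := C0; lra.
  exists (inf_elt M (maxn k.+1 m0)) => s sk ps ds rs a ha.
  have := main k.+1 (maxn k.+1 m0) s a _ sk ps ds rs ha.
  rewrite leq_maxl => /(_ isT).
  have := hd _ (leq_maxr k.+1 m0); have := Nle k.+1 a ha.
  have : d <= 1 by rewrite ge_min lexx.
  by rewrite ler_distl => ? ? ? /andP[_ ?]; lra.
exists (inf_elt M m0.+1) => u Eu hu.
have := main 1%N m0.+1 [:: u] (fun=> 1) isT erefl _ _ _ _.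
rewrite !big_ord1 !scale1r /tok/= => h.
have : d <= c / 2 by rewrite ge_min lexx orbT.
have := hd _ (leqnSn m0).
have : c <= N (e 0%N).
  have /andP[+ _] := hequiv 1%N (fun=> 1); rewrite !big_ord1 !scale1r; apply: le_trans.
  have := @c0_norm_ge R 1 (fun=> 1) ord0; rewrite big_ord1 scale1r normr1 => h1.
  by rewrite ler_pMr.
have : `| `|x (fset_of u)| - N (e 0%N)| <= delta m0.+1.
  apply: h => //.
  - move=> [|//] [|//] k _ _; rewrite /tok/=; split=> // _ ku.
    apply: (sorted_ltn_nth ltn_trans); rewrite ?inE//; last exact: ltnW.
    exact: front_sorted hE _ Eu.
  - by move=> [|//].
  - by move=> [|//] y _; exact: hu.
  - by move=> _; rewrite normr1.
rewrite ler_distl => /andP[h1 _] h2 h3 h4; have c2 : c - c / 2 = c / 2 by rewrite {1}(splitr c) addrK.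
rewrite -c2; apply: le_trans h1; exact: lerB h2 (le_trans h3 h4).
Qed.

End Conversion.

Theorem theorem0p28 (R : realType) (X : completeNormedModType R)
    (b : nat -> X) (hb : schauder_basis b) :
  admits_c0_wrc X -> admits_c0_plegma_block b.
Proof.
move=> [F [M [x [hF [Minf M0] Kc hx]]]].
have hE := regular_thin_front hF.
have [c1 [C1 [c10 hup hlow]]] := generates_c0_bounds hF hx.
pose K : set X := closure ((x @` restrict_family F M) : set (weak_space X)).
have Kx u : front_of F u -> (forall y, y \in u -> M y) -> K (x (fset_of u)).
  move=> Eu Mu; apply: (@subset_closure (weak_space X)).
  exists (fset_of u) => //; split; first exact: front_of_fset.
  by move=> y /=; rewrite in_fset_; exact: Mu.
have [l [w [c [C [c0 lmono lM el [wfin wblock wbound]]]]]] :=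
  @block_subsequence R X b hb _ hE M K (x \o fset_of) C1 c1 Minf Kc Kx hup c10 hlow.
have wle m s : (size s <= m)%N -> plegmas s -> done (front_of F) s ->
    ranges (fun y => exists2 i, (m <= i)%N & y = l i) s -> forall a : nat -> R,
    (forall j, `|a j| <= 1) -> `|\sum_(j < size s) a j *: w (tok s j)| <= C.
  by move=> sm ps ds rs a ha; apply: (wbound m s sm ps ds rs a).1.
have wge m s : (size s <= m)%N -> plegmas s -> done (front_of F) s ->
    ranges (fun y => exists2 i, (m <= i)%N & y = l i) s -> forall (a : nat -> R) j,
    (j < size s)%N -> c * `|a j| <= `|\sum_(i < size s) a i *: w (tok s i)|.
  by move=> sm ps ds rs a j; apply: (wbound m s sm ps ds rs a).2.
have [h [N [delta [hmono hN d0 dlim [hgen hC hc]]]]] :=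
  plegma_spreading_model hE lmono el wle wge.
(* Positions in an infinite set count from 1: the shift makes the [m]-th element of [range g] equal
   to [l (h m)], as the index bound in [hgen] requires. *)
pose g i := l (h i.+1).
have gmono i j : (i < j)%N -> (g i < g j)%N.
  by move=> ij; apply/lmono/hmono; rewrite ltnS.
exists F, (range g), (fun s => w (elts s)); split=> //.
- split; first by apply: unbounded_infinite => n; exists (g n); [exact: strict_mono_le|exists n].
  by move=> [i _ gi]; apply: M0; rewrite -gi; exact: lM.
- split=> [s _|s1 s2 [F1 M1] [F2 M2] /plegma_plegmas/= p12]; first exact: wfin.
  apply: wblock => //; try exact: front_of_elts.
  move=> [|[|//]] y _; rewrite /tok/= mem_elts => ys.
    by have [i _ <-] := M1 _ ys; exists (h i.+1).
  by have [i _ <-] := M2 _ ys; exists (h i.+1).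
exists {poly R}, N, (fun j => 'X^j); split=> //.
- exact: hamel_basisX.
- exists delta; split=> // k m s a /andP[k1 km] ps Fs hs ha.
  have ks : size (map elts s) = k by rewrite size_map size_tuple.
  have tE (j : 'I_k) : tok (map elts s) j = elts (tnth s j).
    by rewrite /tok (nth_map fset0) ?size_tuple// -tnth_nth.
  have ps' := plegma_plegmas ps.
  have ds : done (front_of F) (map elts s).
    move=> j; rewrite ks => jk; rewrite -[j]/(val (Ordinal jk)) tE.
    by apply: front_of_elts; exact: (Fs _).1.
  (* The plegma inequalities make the first element of the first set the least of all, so the bound
     on it passes to every element. *)
  have rs : ranges (fun y => exists2 i, (m <= i)%N & y = l (h i)) (map elts s).
    move=> j y; rewrite ks => jk.
    have /= [_ Mj] := Fs (Ordinal jk); rewrite -[j]/(val (Ordinal jk)) tE => yj.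
    have [i _ iy] : range g y by apply: Mj; rewrite /= -mem_elts.
    exists i.+1; last by rewrite -iy.
    have k0 : (0 < k)%N := k1; have jt : (j < size (map elts s))%N by rewrite ks.
    have st : (0 < size (map elts s))%N by rewrite ks.
    case: m {km} hs (leq_trans k1 km) => // m; rewrite inf_elt_range// => hs _.
    have hs' : (g m <= nth 0 (tok (map elts s) 0) 0)%N.
      by move: hs; rewrite /elt /tok (nth_map fset0) ?size_tuple.
    have n0 j' : (j' < size (map elts s))%N -> (0 < size (tok (map elts s) j'))%N.
      move=> j's; rewrite lt0n size_eq0; apply/eqP => e; have := ds _ j's.
      by rewrite e; exact: front_nil.
    have h0j : (nth 0 (tok (map elts s) 0) 0 <= nth 0 (tok (map elts s) j) 0)%N.
      case: (posnP j) => [->//|j0].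
      by apply/ltnW; apply: (ps' 0 j 0 st jt).1 => //; exact: n0.
    have hjy : (nth 0 (tok (map elts s) j) 0 <= y)%N.
      rewrite -[j]/(val (Ordinal jk)) tE.
      move: yj => /(nthP 0%N)[p pj <-]; have so := elts_sorted (tnth s (Ordinal jk)).
      have so' : sorted leq (elts (tnth s (Ordinal jk))).
        by apply: sub_sorted so => a1 a2 /ltnW.
      apply: (sorted_leq_nth leq_trans leqnn 0 so') => //.
      by rewrite inE; exact: leq_ltn_trans pj.
    have gmi : (g m <= g i)%N.
      by rewrite iy; exact: leq_trans hs' (leq_trans h0j hjy).
    by rewrite ltnS leqNgt; apply/negP => /gmono; rewrite ltnNge gmi.
  have ha' j : `|extend0 a j| <= 1.
    by apply: extend0_le => // i; rewrite ler_norml; exact: ha.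
  have := hgen m _ (extend0 a) _ ps' ds rs ha'; rewrite ks => /(_ km).
  rewrite -(sum_extend0 a (fun j => 'X^j : {poly R})).
  congr (`| `| _ | - _| <= _ : Prop); apply: eq_bigr => j _.
  by rewrite extend0E tE.
- exact: equivalent_c0 c0 hN hC hc.
Qed.
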